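(* The following statements are provably equivalent over $\mathsf{RCA}_0$ (all notions being formalized in the language $L_2$ of second-order arithmetic): (a) Weak König's Lemma $\mathrm{WKL}$. (b) The Heine-Borel theorem for countable coverings: if $(O_i)_{i\in\mathbb{N}}$ is a sequence of open intervals covering $[0,1]$, then there is $j\in\mathbb{N}$ such that $[0,1]\subseteq\bigcup_{i<j}O_i$. (c) The Creeping Lemma $\mathrm{CL}(\Psi)$ for all $\Sigma^0_1$-formulas $\Psi(x)$.
   Context: Language and systems. $L_2$ is the language of second-order arithmetic: number variables $n,m,\ldots$, symbols $0,+,\times,<$, and set variables $X,Y,\ldots$ ranging over sets of natural numbers. $\mathsf{PA}^-$ denotes the usual basic axioms of arithmetic without induction. $\mathsf{RCA}_0$ consists of $\mathsf{PA}^-$ together with: - $\Sigma^0_1$-induction: for every $\varphi(n)\equiv(\exists m)\psi(n,m)$ with $\psi$ containing only bounded quantifiers, $[\varphi(0)\wedge(\forall n)(\varphi(n)\to\varphi(n+1))]\to(\forall m)\varphi(m)$; - $\Delta^0_1$-comprehension: for $\varphi(n,m),\psi(n,k)$ with only bounded quantifiers, if $(\forall n)[(\exists m)\varphi(n,m)\leftrightarrow(\forall k)\psi(n,k)]$ then $\exists X(\forall n)(n\in X\leftrightarrow(\forall k)\psi(n,k))$. $\mathrm{WKL}$ is the statement that every infinite binary tree (a set of finite $0$-$1$ sequences closed under initial segments) has an infinite path. Following the standard conventions of reverse mathematics, formulas in schemas may contain number and set parameters. Coding. Rationals are coded by natural numbers. A real number $x$ is coded by a sequence of rationals $q_0,q_1,q_2,\ldots$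 with $\forall k\,\forall i\,(|q_k-q_{k+i}|\le 2^{-k})$, with the usual definitions of equality and order of reals. A sequence of reals is coded by a doubly indexed sequence of rationals. A countable family of open intervals $(O_i)_{i\in\mathbb{N}}$ is given by the two sequences of its left and right endpoints. A $\Sigma^0_1$-formula $\Psi(x)$ is applied to (codes for) reals $x$. Creeping Lemma. For a formula $\Psi(x)$ about reals and a countable family $\mathcal{C}=(O_i)_{i\in\mathbb{N}}$ of open intervals, $\mathrm{Cov}(\Psi,\mathcal{C})$ abbreviates the conjunction of: (i) $\forall x\in[0,1]\,\exists i\,(x\in O_i)$; and (ii) $\forall i\,\forall x,y\in O_i\,(\Psi(x)\leftrightarrow\Psi(y))$. Then $\mathrm{CL}(\Psi)$ is the statement $$(\exists\mathcal{C}\,\mathrm{Cov}(\Psi,\mathcal{C})\wedge\Psi(0))\to\forall x\in[0,1]\,\Psi(x).$$ *)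

(* Defs.v *)
From Stdlib Require Import List.
Import ListNotations.

(** * The language of second-order arithmetic

    Two sorts of de Bruijn variables, with separate numbering: [AllNum] binds
    number variable 0, [AllSet] binds set variable 0.  The primitive logical
    symbols are falsum, implication and the two universal quantifiers; the logic
    is classical, so the others are abbreviations.  As usual there is no
    primitive equality between sets. *)

Inductive term : Type :=
| Var (n : nat)
| Zero
| One
| Plus (s t : term)
| Times (s t : term).

Inductive form : Type :=
| Bot
| EqN (s t : term)
| LtN (s t : term)
| Mem (t : term) (X : nat)
| Imp (A B : form)
| AllNum (A : form)
| AllSet (A : form).

Definition Not (A : form) : form := Imp A Bot.
Definition And (A B : form) : form := Not (Imp A (Not B)).
Definition Or (A B : form) : form := Imp (Not A) B.
Definition Iff (A B : form) : form := And (Imp A B) (Imp B A).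
Definition ExNum (A : form) : form := Not (AllNum (Not A)).
Definition ExSet (A : form) : form := Not (AllSet (Not A)).

(** Simultaneous substitution of terms for number variables and of set
    variables for set variables. *)

Fixpoint tsubst (sg : nat -> term) (t : term) : term :=
  match t with
  | Var n => sg n
  | Zero => Zero
  | One => One
  | Plus s u => Plus (tsubst sg s) (tsubst sg u)
  | Times s u => Times (tsubst sg s) (tsubst sg u)
  end.

Definition tlift : term -> term := tsubst (fun n => Var (S n)).

Definition scons {T : Type} (a : T) (f : nat -> T) (n : nat) : T :=
  match n with
  | 0 => a
  | S m => f m
  end.

Fixpoint fsubst (sg : nat -> term) (rh : nat -> nat) (A : form) : form :=
  match A with
  | Bot => Bot
  | EqN s t => EqN (tsubst sg s) (tsubst sg t)
  | LtN s t => LtN (tsubst sg s) (tsubst sg t)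
  | Mem t X => Mem (tsubst sg t) (rh X)
  | Imp B C => Imp (fsubst sg rh B) (fsubst sg rh C)
  | AllNum B => AllNum (fsubst (scons (Var 0) (fun n => tlift (sg n))) rh B)
  | AllSet B => AllSet (fsubst sg (scons 0 (fun X => S (rh X))) B)
  end.

Definition liftN : form -> form := fsubst (fun n => Var (S n)) (fun X => X).
Definition liftS : form -> form := fsubst Var S.
Definition instN (t : term) : form -> form := fsubst (scons t Var) (fun X => X).
Definition instS (X : nat) : form -> form := fsubst Var (scons X (fun Y => Y)).

(** * Provability

    Classical natural deduction with equality.  Free variables of the axioms in
    [T] stand for arbitrary parameters: an axiom is asserted in the form of its
    universal closure, since the eigenvariable condition of the two
    generalization rules concerns the hypotheses [G] only. *)

Definition theory : Type := form -> Prop.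

Inductive prv (T : theory) : list form -> form -> Prop :=
| prv_ax G A : T A -> prv T G A
| prv_hyp G A : In A G -> prv T G A
| prv_impI G A B : prv T (A :: G) B -> prv T G (Imp A B)
| prv_impE G A B : prv T G (Imp A B) -> prv T G A -> prv T G B
| prv_raa G A : prv T (Not A :: G) Bot -> prv T G A
| prv_allNI G A : prv T (map liftN G) A -> prv T G (AllNum A)
| prv_allNE G A t : prv T G (AllNum A) -> prv T G (instN t A)
| prv_allSI G A : prv T (map liftS G) A -> prv T G (AllSet A)
| prv_allSE G A X : prv T G (AllSet A) -> prv T G (instS X A)
| prv_refl G t : prv T G (EqN t t)
| prv_eq G A s t : prv T G (EqN s t) -> prv T G (instN s A) -> prv T G (instN t A).

Definition provable (T : theory) (A : form) : Prop := prv T [] A.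

Definition extend (T U : theory) : theory := fun A => T A \/ U A.

Definition single (A : form) : theory := fun B => B = A.

(** Two sets of statements are provably equivalent over [T]. *)
Definition equivalent_over (T U V : theory) : Prop :=
  (forall A, V A -> provable (extend T U) A) /\
  (forall A, U A -> provable (extend T V) A).

(** * Writing formulas with named bound variables

    An [xform] is a formula waiting for the numbers [d] and [e] of number and set
    binders above it; the variable introduced by the binder at depth [d0] has
    index [d - S d0] at depth [d].  A closed [xform] is turned into a formula by
    [close]. *)

Definition xterm : Type := nat -> term.
Definition xset : Type := nat -> nat.
Definition xform : Type := nat -> nat -> form.

Definition close (A : xform) : form := A 0 0.

Definition xzero : xterm := fun _ => Zero.
Definition xone : xterm := fun _ => One.
Definition xadd (s t : xterm) : xterm := fun d => Plus (s d) (t d).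
Definition xmul (s t : xterm) : xterm := fun d => Times (s d) (t d).

Definition xeq (s t : xterm) : xform := fun d _ => EqN (s d) (t d).
Definition xlt (s t : xterm) : xform := fun d _ => LtN (s d) (t d).
Definition xmem (t : xterm) (X : xset) : xform := fun d e => Mem (t d) (X e).
Definition xnot (A : xform) : xform := fun d e => Not (A d e).
Definition ximp (A B : xform) : xform := fun d e => Imp (A d e) (B d e).
Definition xand (A B : xform) : xform := fun d e => And (A d e) (B d e).
Definition xor (A B : xform) : xform := fun d e => Or (A d e) (B d e).
Definition xiff (A B : xform) : xform := fun d e => Iff (A d e) (B d e).

Definition xallN (f : xterm -> xform) : xform :=
  fun d e => AllNum (f (fun d' => Var (d' - S d)) (S d) e).
Definition xexN (f : xterm -> xform) : xform :=
  fun d e => ExNum (f (fun d' => Var (d' - S d)) (S d) e).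
Definition xallS (f : xset -> xform) : xform :=
  fun d e => AllSet (f (fun e' => e' - S e) d (S e)).
Definition xexS (f : xset -> xform) : xform :=
  fun d e => ExSet (f (fun e' => e' - S e) d (S e)).

Declare Scope l2_scope.
Delimit Scope l2_scope with l2.
Bind Scope l2_scope with xterm.
Bind Scope l2_scope with xform.

Notation "0" := xzero : l2_scope.
Notation "1" := xone : l2_scope.
Notation "2" := (xadd xone xone) : l2_scope.
Notation "s + t" := (xadd s t) : l2_scope.
Notation "s * t" := (xmul s t) : l2_scope.
Notation "s = t" := (xeq s t) : l2_scope.
Notation "s < t" := (xlt s t) : l2_scope.
Notation "s <= t" := (xor (xlt s t) (xeq s t)) : l2_scope.
Notation "t \el X" := (xmem t X) (at level 70, X at level 0) : l2_scope.
Notation "~ A" := (xnot A) : l2_scope.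
Notation "A /\ B" := (xand A B) : l2_scope.
Notation "A \/ B" := (xor A B) : l2_scope.
Notation "A ===> B" := (ximp A B)
  (at level 96, right associativity) : l2_scope.
Notation "A <-> B" := (xiff A B) : l2_scope.
Notation "'allN' x .. y , A" := (xallN (fun x => .. (xallN (fun y => A)) ..))
  (at level 200, x binder, y binder, right associativity) : l2_scope.
Notation "'exN' x .. y , A" := (xexN (fun x => .. (xexN (fun y => A)) ..))
  (at level 200, x binder, y binder, right associativity) : l2_scope.
Notation "'allS' X .. Y , A" := (xallS (fun X => .. (xallS (fun Y => A)) ..))
  (at level 200, X binder, Y binder, right associativity) : l2_scope.
Notation "'exS' X .. Y , A" := (xexS (fun X => .. (xexS (fun Y => A)) ..))
  (at level 200, X binder, Y binder, right associativity) : l2_scope.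

Local Open Scope l2_scope.

(** * The system RCA0 *)

(** Axioms of discretely ordered commutative semirings. *)
Definition PA_minus : list form :=
  map close
  [ allN x y z, (x + y) + z = x + (y + z);
    allN x y, x + y = y + x;
    allN x y z, (x * y) * z = x * (y * z);
    allN x y, x * y = y * x;
    allN x y z, x * (y + z) = x * y + x * z;
    allN x, x + 0 = x;
    allN x, x * 0 = 0;
    allN x, x * 1 = x;
    allN x y z, x < y /\ y < z ===> x < z;
    allN x, ~ x < x;
    allN x y, x < y \/ (x = y \/ y < x);
    allN x y z, x < y ===> x + z < y + z;
    allN x y z, 0 < z /\ x < y ===> x * z < y * z;
    allN x y, x < y ===> (exN z, x + z = y);
    0 < 1;
    allN x, 0 < x ===> 1 <= x;
    allN x, 0 <= x ].

(** Formulas all of whose quantifiers are bounded number quantifiers.  The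
    bounded existential quantifier is the dual of the universal one. *)
Inductive bounded : form -> Prop :=
| bounded_bot : bounded Bot
| bounded_eq s t : bounded (EqN s t)
| bounded_lt s t : bounded (LtN s t)
| bounded_mem t X : bounded (Mem t X)
| bounded_imp A B : bounded A -> bounded B -> bounded (Imp A B)
| bounded_all t A :
    bounded A -> bounded (AllNum (Imp (LtN (Var 0) (tlift t)) A)).

Inductive Sigma01 : form -> Prop :=
| Sigma01_ex A : bounded A -> Sigma01 (ExNum A).

(** Induction on number variable 0 of [A]. *)
Definition induction (A : form) : form :=
  Imp (And (instN Zero A)
           (AllNum (Imp A (fsubst (scons (Plus (Var 0) One) (fun n => Var (S n)))
                                (fun X => X) A))))
      (AllNum A).

(** In [A] and [B], number variable 0 is the unbounded variable and number
    variable 1 is the argument n.  [liftS] makes the new set X non-free in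
    [B]. *)
Definition comprehension (A B : form) : form :=
  Imp (AllNum (Iff (ExNum A) (AllNum B)))
      (ExSet (AllNum (Iff (Mem (Var 0) 0) (AllNum (liftS B))))).

Inductive RCA0 : theory :=
| RCA0_basic A : In A PA_minus -> RCA0 A
| RCA0_induction A : Sigma01 A -> RCA0 (induction A)
| RCA0_comprehension A B :
    bounded A -> bounded B -> RCA0 (comprehension A B).

(** * Pairs, functions, powers of two *)

Definition code_pair (x y : xterm) : xterm := (x + y) * (x + y) + x.

Definition set_of_pairs (F : xset) : xform :=
  allN m, m \el F ===> (exN x y, m = code_pair x y).

Definition is_function (F : xset) : xform :=
  set_of_pairs F /\
  (allN x, exN y, code_pair x y \el F) /\
  (allN x y z, code_pair x y \el F ===> code_pair x z \el F ===> y = z).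

(** p = 2^k, the exponential being given by primitive recursion. *)
Definition pow2 (k p : xterm) : xform :=
  exS F, is_function F /\ code_pair 0 1 \el F /\
    (allN i q, code_pair i q \el F ===> code_pair (i + 1) (2 * q) \el F) /\
    code_pair k p \el F.

(** * Binary trees

    The sequence b_0, ..., b_(n-1) of bits is coded by the positive number with
    binary expansion 1 b_0 ... b_(n-1).  This is a bijection between finite 0-1
    sequences and positive numbers, so a set of sequences is infinite when the
    set of codes is unbounded. *)

Definition seq_length (s n : xterm) : xform :=
  exN p, pow2 n p /\ p <= s /\ s < 2 * p.

(** t (nonempty in binary, i.e. positive) is what remains of s after deleting
    the last j digits. *)
Definition initial_segment (t s : xterm) : xform :=
  0 < t /\ (exN j p r, pow2 j p /\ r < p /\ s = t * p + r).

(** The entry number i of s is the bit b. *)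
Definition seq_entry (s i b : xterm) : xform :=
  exN t, seq_length t i /\ initial_segment (2 * t + b) s.

Definition binary_tree (T : xset) : xform :=
  (allN s, s \el T ===> 0 < s) /\
  (allN s t, s \el T ===> initial_segment t s ===> t \el T).

Definition infinite_set (T : xset) : xform := allN n, exN s, n < s /\ s \el T.

Definition is_path (F T : xset) : xform :=
  is_function F /\
  (allN i b, code_pair i b \el F ===> b = 0 \/ b = 1) /\
  (allN n, exN s, s \el T /\ seq_length s n /\
     (allN i b, i < n ===> code_pair i b \el F ===> seq_entry s i b)).

Definition WKL : form :=
  close (allS T, binary_tree T /\ infinite_set T ===> (exS F, is_path F T)).

(** * Rationals and reals *)

(** Code of the rational (a - b) / (c + 1). *)
Definition rat (a b c : xterm) : xterm := code_pair (code_pair a b) c.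

Definition is_rat (q : xterm) : xform := exN a b c, q = rat a b c.

(** q <= r + m / p for codes q, r of rationals and p > 0, with denominators
    cleared and negative terms moved to the other side. *)
Definition rat_le_plus (q r m p : xterm) : xform :=
  exN a b c a' b' c', q = rat a b c /\ r = rat a' b' c' /\
    p * (a * (c' + 1) + b' * (c + 1)) <=
    p * (b * (c' + 1) + a' * (c + 1)) + m * ((c + 1) * (c' + 1)).

(** A sequence of numbers is presented by its graph, so that the same formulas
    apply to a real, to a member of a sequence of reals and to a constant. *)
Definition xseq : Type := xterm -> xterm -> xform.

Definition of_set (X : xset) : xseq := fun k q => code_pair k q \el X.
Definition row (S : xset) (i : xterm) : xseq :=
  fun k q => code_pair (code_pair i k) q \el S.
Definition constant (c : xterm) : xseq := fun _ q => q = c.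

Definition real_zero : xseq := constant (rat 0 0 0).
Definition real_one : xseq := constant (rat 1 0 0).

(** |q_k - q_(k+i)| <= 2^(-k) *)
Definition represents_real (u : xseq) : xform :=
  (allN k, exN q, u k q) /\
  (allN k q r, u k q ===> u k r ===> q = r) /\
  (allN k q, u k q ===> is_rat q) /\
  (allN k i p q r, pow2 k p ===> u k q ===> u (k + i) r ===>
     rat_le_plus q r 1 p /\ rat_le_plus r q 1 p).

Definition is_real (X : xset) : xform :=
  set_of_pairs X /\ represents_real (of_set X).

Definition is_real_sequence (S : xset) : xform :=
  (allN m, m \el S ===> (exN i k q, m = code_pair (code_pair i k) q)) /\
  (allN i, represents_real (row S i)).

(** x <= y iff q_k <= r_k + 2^(-k+1) for all k, and x < y iff not y <= x. *)
Definition real_le (u v : xseq) : xform :=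
  allN k p q r, pow2 k p ===> u k q ===> v k r ===> rat_le_plus q r 2 p.

Definition real_lt (u v : xseq) : xform := ~ real_le v u.

Definition in_unit_interval (X : xset) : xform :=
  is_real X /\ real_le real_zero (of_set X) /\ real_le (of_set X) real_one.

(** Membership in O_i, where [A] and [B] are the sequences of left and right
    endpoints.  An interval whose left endpoint is not less than the right one
    is empty. *)
Definition in_interval (A B : xset) (i : xterm) (X : xset) : xform :=
  is_real X /\ real_lt (row A i) (of_set X) /\ real_lt (of_set X) (row B i).

Definition interval_family (A B : xset) : xform :=
  is_real_sequence A /\ is_real_sequence B.

Definition covers (A B : xset) : xform :=
  allS X, in_unit_interval X ===> (exN i, in_interval A B i X).

Definition HeineBorel : form :=
  close (allS A B, interval_family A B /\ covers A B ===>
    (exN j, allS X, in_unit_interval X ===>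
       (exN i, i < j /\ in_interval A B i X))).

(** * The Creeping Lemma *)

(** In [Psi], set variable 0 is (a code of) the real argument; all other free
    variables are parameters, shifted over the binders in scope. *)
Definition apply_form (Psi : form) (X : xset) : xform :=
  fun d e => fsubst (fun n => Var (d + n)%nat) (scons (X e) (fun Y => (e + Y)%nat)) Psi.

Definition Cov (Psi : form) (A B : xset) : xform :=
  covers A B /\
  (allN i, allS X Y, in_interval A B i X ===> in_interval A B i Y ===>
     (apply_form Psi X <-> apply_form Psi Y)).

(** Psi(0), for the code of 0 which is the constant sequence. *)
Definition holds_at_zero (Psi : form) : xform :=
  exS Z, (allN m, m \el Z <-> (exN k q, real_zero k q /\ m = code_pair k q)) /\
    apply_form Psi Z.

Definition CL (Psi : form) : form :=
  close ((exS A B, interval_family A B /\ Cov Psi A B) /\ holds_at_zero Psi ===>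
    (allS X, in_unit_interval X ===> apply_form Psi X)).

Inductive CreepingLemma : theory :=
| CreepingLemma_inst Psi : Sigma01 Psi -> CreepingLemma (CL Psi).

(* Main.v *)
From Stdlib Require Import List Cantor Lia.
From mathcomp Require Import ssreflect ssrfun ssrbool.
From mathcomp Require Import boolp.
Require Import Defs.
Import ListNotations.
Set Implicit Arguments.
Unset Strict Implicit.
Unset Printing Implicit Defensive.

(** By Henkin's completeness theorem it suffices to show that WKL, Heine-Borel and
    the Creeping Lemma for Sigma^0_1 formulas hold in the same models of RCA0.  A
    model is handled through the ordered field of fractions of its numbers and
    through the functions with Sigma^0_1 graph, which are closed under primitive
    recursion.

    WKL implies Heine-Borel: the dyadic intervals not yet seen to lie inside one of
    the given open intervals form a tree; a path through it would be an uncovered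
    real, so the tree is finite.  Heine-Borel implies the Creeping Lemma: apply
    Heine-Borel to the rational intervals whose double is seen to lie inside one of
    the given intervals; this yields some j such that any real is well inside an
    interval containing its 2^-j-neighbourhood, and Sigma^0_1 induction on m carries
    Psi from 0 to m 2^-j.  The Creeping Lemma implies WKL: place the nodes of an
    infinite tree without path as dyadic intervals in [1/4, 1/2]; "x is to the left
    of all nodes of some length" is Sigma^0_1, holds at 0, fails at 1, and is
    constant on every interval missing all nodes of some length, while such
    intervals cover [0, 1] because a real near nodes of every length has a dyadic
    expansion that is a path. *)

(** A model of RCA0 may be nonstandard, so induction on [nat] says nothing about its numbers: every
    induction needs a definability proof for its predicate, and only Delta^0_1 predicates are known
    to give sets. Hence the classes [S1], [D1], [DF], [KF] and the tactics [dfn] and [kfn], which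
    discharge these obligations by following the shape of the predicate. Codes of reals are
    exchanged for definable functions from numbers to the fraction field ([set_presents]), so that
    the analysis becomes arithmetic in an ordered field. A formula [Psi] speaks about codes and need
    not respect equality of reals; two codes are therefore compared only through a common interval
    of the covering. The uniform step length of the creeping argument comes from the pairing
    function: the index of a nonempty refined interval bounds its precision, so those with index
    below j are not shorter than a fixed length. *)

Module Completeness.

Arguments prv_impE {T G A B}.
Arguments prv_eq {T G A s t}.

(** * Substitution *)

Definition up (sg : nat -> term) : nat -> term :=
  scons (Var 0) (fun n => tlift (sg n)).
Definition upS (rh : nat -> nat) : nat -> nat := scons 0 (fun X => S (rh X)).

Lemma tsubst_comp s r t : tsubst s (tsubst r t) = tsubst (fun n => tsubst s (r n)) t.
Proof. by elim: t => //= [a -> b ->|a -> b ->]. Qed.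

Lemma tsubst_id t : tsubst Var t = t.
Proof. by elim: t => //= [a -> b ->|a -> b ->]. Qed.

Lemma tsubst_tlift s t : tsubst s (tlift t) = tsubst (fun n => s (S n)) t.
Proof. by rewrite tsubst_comp. Qed.

Lemma tsubst_up sg t : tsubst (up sg) (tlift t) = tlift (tsubst sg t).
Proof. by rewrite tsubst_tlift /tlift tsubst_comp. Qed.

Lemma up_comp s r : (fun n => tsubst (up s) (up r n)) = up (fun n => tsubst s (r n)).
Proof. by apply: funext => -[|n] //=; rewrite tsubst_up. Qed.

Lemma upS_comp s r : (fun n => upS s (upS r n)) = upS (fun n => s (r n)).
Proof. by apply: funext => -[|n]. Qed.

Lemma up_Var : up Var = Var.
Proof. by apply: funext => -[|n]. Qed.

Lemma upS_id : upS (fun X => X) = fun X => X.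
Proof. by apply: funext => -[|n]. Qed.

Lemma fsubst_comp A : forall s r s' r', fsubst s r (fsubst s' r' A) =
  fsubst (fun n => tsubst s (s' n)) (fun X => r (r' X)) A.
Proof.
elim: A => //= [a b|a b|a X|A IA B IB|A IA|A IA] s r s' r'.
- by rewrite !tsubst_comp.
- by rewrite !tsubst_comp.
- by rewrite !tsubst_comp.
- by rewrite IA IB.
- by rewrite IA -/(up s) -/(up s') up_comp.
- by rewrite IA -/(upS r) -/(upS r') upS_comp.
Qed.

Lemma fsubst_id A : fsubst Var (fun X => X) A = A.
Proof.
elim: A => //= [a b|a b|a X|A -> B ->|A IA|A IA] //; rewrite ?tsubst_id //.
- by rewrite -/(up Var) up_Var IA.
- by rewrite -/(upS _) upS_id IA.
Qed.

Lemma instN_up t sg rh A : instN t (fsubst (up sg) rh A) = fsubst (scons t sg) rh A.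
Proof.
rewrite /instN fsubst_comp; congr (fsubst _ _ A); apply: funext => -[|n] //=.
by rewrite tsubst_tlift tsubst_id.
Qed.

Lemma instS_upS Y sg rh A : instS Y (fsubst sg (upS rh) A) = fsubst sg (scons Y rh) A.
Proof.
rewrite /instS fsubst_comp; congr (fsubst _ _ A); apply: funext => n //=.
- by rewrite tsubst_id.
- by case: n.
Qed.

Lemma fsubst_instN sg rh t A :
  fsubst sg rh (instN t A) = instN (tsubst sg t) (fsubst (up sg) rh A).
Proof.
rewrite instN_up /instN fsubst_comp; congr (fsubst _ _ A).
by apply: funext => -[|n].
Qed.

Lemma fsubst_instS sg rh Y A :
  fsubst sg rh (instS Y A) = instS (rh Y) (fsubst sg (upS rh) A).
Proof.
rewrite instS_upS /instS fsubst_comp; congr (fsubst _ _ A).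
by apply: funext => -[|n].
Qed.

Lemma fsubst_liftN sg rh A : fsubst (up sg) rh (liftN A) = liftN (fsubst sg rh A).
Proof. by rewrite /liftN !fsubst_comp. Qed.

Lemma fsubst_liftS sg rh A : fsubst sg (upS rh) (liftS A) = liftS (fsubst sg rh A).
Proof.
rewrite /liftS !fsubst_comp; congr (fsubst _ _ A).
by apply: funext => n /=; rewrite tsubst_id.
Qed.

(** Strict bounds on the free variables: every variable from the bound on is fresh. *)
Fixpoint tbound (t : term) : nat :=
  match t with
  | Var n => S n
  | Plus s u | Times s u => max (tbound s) (tbound u)
  | _ => 0
  end.

Fixpoint numbound (A : form) : nat :=
  match A with
  | Bot => 0
  | EqN s t | LtN s t => max (tbound s) (tbound t)
  | Mem t _ => tbound t
  | Imp B C => max (numbound B) (numbound C)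
  | AllNum B => Nat.pred (numbound B)
  | AllSet B => numbound B
  end.

Fixpoint setbound (A : form) : nat :=
  match A with
  | Mem _ X => S X
  | Imp B C => max (setbound B) (setbound C)
  | AllNum B => setbound B
  | AllSet B => Nat.pred (setbound B)
  | _ => 0
  end.

Lemma tsubst_agree t s s' : (forall n, n < tbound t -> s n = s' n) ->
  tsubst s t = tsubst s' t.
Proof.
elim: t => //= [n H|a IA b IB H|a IA b IB H]; first exact/H/PeanoNat.Nat.lt_succ_diag_r.
- by rewrite IA ?IB // => n Hn; apply: H; apply/PeanoNat.Nat.max_lt_iff; auto.
- by rewrite IA ?IB // => n Hn; apply: H; apply/PeanoNat.Nat.max_lt_iff; auto.
Qed.

Lemma fsubst_agree A : forall s r s' r',
  (forall n, n < numbound A -> s n = s' n) ->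
  (forall X, X < setbound A -> r X = r' X) -> fsubst s r A = fsubst s' r' A.
Proof.
have mx a b n : n < a \/ n < b -> n < max a b by move/PeanoNat.Nat.max_lt_iff.
elim: A => //= [a b|a b|a X|A IA B IB|A IA|A IA] s r s' r' Hs Hr.
- by rewrite (@tsubst_agree a s s') ?(@tsubst_agree b s s') // => n Hn; apply/Hs/mx; auto.
- by rewrite (@tsubst_agree a s s') ?(@tsubst_agree b s s') // => n Hn; apply/Hs/mx; auto.
- by rewrite (@tsubst_agree a s s') // Hr.
- by rewrite (IA s r s' r') 1?(IB s r s' r') // => n Hn; (apply: Hs || apply: Hr); apply: mx;
    auto.
- congr AllNum; apply: IA => // -[|n] //= Hn; rewrite Hs //.
  lia.
- congr AllSet; apply: IA => // -[|n] //= Hn; rewrite Hr //.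
  lia.
Qed.

(** * Structural rules *)

Lemma prv_weaken T G A : prv T G A -> forall G', incl G G' -> prv T G' A.
Proof.
elim => {G A}.
- by move=> G A TA G' _; apply: prv_ax.
- by move=> G A GA G' sub; apply/prv_hyp/sub.
- move=> G A B _ IH G' sub; apply/prv_impI/IH => C [->|GC]; first by left.
  by right; apply: sub.
- by move=> G A B _ IA _ IB G' sub; apply: (prv_impE (IA _ sub) (IB _ sub)).
- move=> G A _ IH G' sub; apply/prv_raa/IH => C [->|GC]; first by left.
  by right; apply: sub.
- by move=> G A _ IH G' sub; apply/prv_allNI/IH/incl_map.
- by move=> G A t _ IH G' sub; apply/prv_allNE/IH.
- by move=> G A _ IH G' sub; apply/prv_allSI/IH/incl_map.
- by move=> G A t _ IH G' sub; apply/prv_allSE/IH.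
- by move=> *; apply: prv_refl.
- by move=> G A s t _ I1 _ I2 G' sub; apply: prv_eq (I1 _ sub) (I2 _ sub).
Qed.

Fixpoint genN k A := match k with 0 => A | S k => genN k (AllNum A) end.
Fixpoint genS k A := match k with 0 => A | S k => genS k (AllSet A) end.

Lemma prv_genN T k A : prv T [] A -> prv T [] (genN k A).
Proof. by elim: k A => //= k IH A HA; apply/IH/prv_allNI. Qed.

Lemma prv_genS T k A : prv T [] A -> prv T [] (genS k A).
Proof. by elim: k A => //= k IH A HA; apply/IH/prv_allSI. Qed.

Lemma numbound_genN k A : numbound (genN k A) = numbound A - k.
Proof.
elim: k A => [|k IH] A /=; first by rewrite PeanoNat.Nat.sub_0_r.
by rewrite IH /=; case: (numbound A).
Qed.

Lemma setbound_genN k A : setbound (genN k A) = setbound A.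
Proof. by elim: k A => [|k IH] A //=; rewrite IH. Qed.

Lemma numbound_genS k A : numbound (genS k A) = numbound A.
Proof. by elim: k A => [|k IH] A //=; rewrite IH. Qed.

Lemma setbound_genS k A : setbound (genS k A) = setbound A - k.
Proof.
elim: k A => [|k IH] A /=; first by rewrite PeanoNat.Nat.sub_0_r.
by rewrite IH /=; case: (setbound A).
Qed.

Lemma prv_instN T G k : forall sg rh A,
  prv T G (fsubst (fun n => sg (k + n)) rh (genN k A)) -> prv T G (fsubst sg rh A).
Proof.
elim: k => [|k IH] sg rh A //= /(IH (fun n => sg (S n)) rh (AllNum A)) /= /prv_allNE.
move=> /(_ (sg 0)); rewrite -/(up _) instN_up.
by rewrite (_ : scons _ _ = sg) //; apply: funext => -[].
Qed.

Lemma prv_instS T G k : forall sg rh A,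
  prv T G (fsubst sg (fun n => rh (k + n)) (genS k A)) -> prv T G (fsubst sg rh A).
Proof.
elim: k => [|k IH] sg rh A //= /(IH sg (fun n => rh (S n)) (AllSet A)) /= /prv_allSE.
move=> /(_ (rh 0)); rewrite -/(upS _) instS_upS.
by rewrite (_ : scons _ _ = rh) //; apply: funext => -[].
Qed.

(* The eigenvariable conditions do not concern the axioms, so a provable formula
   can be generalized over all its free variables and instantiated again. *)
Lemma prv_subst_closed T G A sg rh : prv T [] A -> prv T G (fsubst sg rh A).
Proof.
move=> HA.
have H : prv T G (genN (numbound A) (genS (setbound A) A)).
  by apply: (prv_weaken (prv_genN _ (prv_genS _ HA))).
apply: (@prv_instS _ _ (setbound A)); apply: (@prv_instN _ _ (numbound A)).
rewrite (@fsubst_agree _ _ _ Var (fun X => X)) ?fsubst_id // => n.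
- by rewrite numbound_genN numbound_genS PeanoNat.Nat.sub_diag => /PeanoNat.Nat.nlt_0_r.
- by rewrite setbound_genN setbound_genS PeanoNat.Nat.sub_diag => /PeanoNat.Nat.nlt_0_r.
Qed.

Lemma prv_subst T G A : prv T G A ->
  forall sg rh, prv T (map (fsubst sg rh) G) (fsubst sg rh A).
Proof.
elim => {G A} /=.
- by move=> G A TA sg rh; apply/prv_subst_closed/prv_ax.
- by move=> G A GA sg rh; apply/prv_hyp/in_map.
- by move=> G A B _ IH sg rh; apply/prv_impI/IH.
- by move=> G A B _ IA _ IB sg rh; apply: (prv_impE (IA _ _) (IB _ _)).
- by move=> G A _ IH sg rh; apply/prv_raa/IH.
- move=> G A _ IH sg rh; apply: prv_allNI.
  move: (IH (up sg) rh); rewrite !map_map.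
  by rewrite (map_ext _ _ (fsubst_liftN sg rh)).
- by move=> G A t _ IH sg rh; rewrite fsubst_instN; apply/prv_allNE/IH.
- move=> G A _ IH sg rh; apply: prv_allSI.
  move: (IH sg (upS rh)); rewrite !map_map.
  by rewrite (map_ext _ _ (fsubst_liftS sg rh)).
- by move=> G A t _ IH sg rh; rewrite fsubst_instS; apply/prv_allSE/IH.
- by move=> *; apply: prv_refl.
- move=> G A s t _ I1 _ I2 sg rh; rewrite fsubst_instN.
  by apply: prv_eq (I1 sg rh) _; rewrite -fsubst_instN; apply: I2.
Qed.

Lemma fold_max_le (f : form -> nat) G A :
  In A G -> f A <= fold_right (fun B m => max (f B) m) 0 G.
Proof.
elim: G => //= B G IH [->|/IH H]; first exact: PeanoNat.Nat.le_max_l.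
exact: (PeanoNat.Nat.le_trans _ _ _ H (PeanoNat.Nat.le_max_r _ _)).
Qed.

(** The renaming that sends the fresh variable [y] to 0 and shifts all others acts on [G] as
    [liftN], which brings the premise into the form required by [prv_allNI]. *)
Lemma prv_allN_fresh T G A y :
  (forall B, In B G -> numbound B <= y) -> numbound (AllNum A) <= y ->
  prv T G (instN (Var y) A) -> prv T G (AllNum A).
Proof.
move=> HG HA /prv_subst.
set sg := fun n => if PeanoNat.Nat.eqb n y then Var 0 else Var (S n).
have sgS n : n < y -> sg n = Var (S n).
  rewrite /sg; case: PeanoNat.Nat.eqb_spec => // -> /PeanoNat.Nat.lt_irrefl [].
move=> /(_ sg (fun X => X)) H; apply: prv_allNI.
have -> : map liftN G = map (fsubst sg (fun X => X)) G.
  apply: map_ext_in => B GB; apply: fsubst_agree => // n Hn.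
  by rewrite sgS //; apply: PeanoNat.Nat.lt_le_trans (HG _ GB).
rewrite (_ : A = fsubst sg (fun X => X) (instN (Var y) A)) //.
rewrite /instN fsubst_comp -[LHS]fsubst_id; apply: fsubst_agree => // -[_|n Hn] /=.
  by rewrite /sg PeanoNat.Nat.eqb_refl.
rewrite sgS //; move: HA => /=; lia.
Qed.

Lemma prv_allS_fresh T G A y :
  (forall B, In B G -> setbound B <= y) -> setbound (AllSet A) <= y ->
  prv T G (instS y A) -> prv T G (AllSet A).
Proof.
move=> HG HA /prv_subst.
set rh := fun n => if PeanoNat.Nat.eqb n y then 0 else S n.
have rhS n : n < y -> rh n = S n.
  rewrite /rh; case: PeanoNat.Nat.eqb_spec => // -> /PeanoNat.Nat.lt_irrefl [].
move=> /(_ Var rh) H; apply: prv_allSI.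
have -> : map liftS G = map (fsubst Var rh) G.
  apply: map_ext_in => B GB; apply: fsubst_agree => // n Hn.
  by rewrite rhS //; apply: PeanoNat.Nat.lt_le_trans (HG _ GB).
rewrite (_ : A = fsubst Var rh (instS y A)) //.
rewrite /instS fsubst_comp -[LHS]fsubst_id; apply: fsubst_agree => // -[_|n Hn] /=.
  by rewrite /rh PeanoNat.Nat.eqb_refl.
rewrite rhS //; move: HA => /=; lia.
Qed.

(** * Henkin models and completeness *)

(** Henkin structures: [sets] is an arbitrary type and need not be extensional, which is harmless
    because the language has no equality of sets. *)
Record structure : Type := Structure {
  num : Type;
  sets : Type;
  nzero : num;
  none : num;
  nadd : num -> num -> num;
  nmul : num -> num -> num;
  nlt : num -> num -> Prop;
  smem : num -> sets -> Prop }.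

Section Satisfaction.
Variable M : structure.

Fixpoint teval (v : nat -> num M) (t : term) : num M :=
  match t with
  | Var n => v n
  | Zero => nzero M
  | One => none M
  | Plus s u => nadd (teval v s) (teval v u)
  | Times s u => nmul (teval v s) (teval v u)
  end.

Fixpoint msat (v : nat -> num M) (w : nat -> sets M) (A : form) : Prop :=
  match A with
  | Bot => False
  | EqN s t => teval v s = teval v t
  | LtN s t => nlt (teval v s) (teval v t)
  | Mem t X => smem (teval v t) (w X)
  | Imp B C => msat v w B -> msat v w C
  | AllNum B => forall x, msat (scons x v) w B
  | AllSet B => forall X, msat v (scons X w) B
  end.

Lemma teval_tsubst v sg t : teval v (tsubst sg t) = teval (fun n => teval v (sg n)) t.
Proof. by elim: t => //= [a -> b ->|a -> b ->]. Qed.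

Lemma msat_fsubst A : forall v w sg rh, msat v w (fsubst sg rh A) =
  msat (fun n => teval v (sg n)) (fun X => w (rh X)) A.
Proof.
elim: A => //= [a b|a b|a X|A IA B IB|A IA|A IA] v w sg rh; rewrite ?teval_tsubst //.
- by rewrite IA IB.
- apply: eq_forall => x; rewrite IA.
  by congr (msat _ _ A); apply: funext => -[|n] //=; rewrite teval_tsubst.
- apply: eq_forall => x; rewrite IA.
  by congr (msat _ _ A); apply: funext => -[|n].
Qed.

(** Axioms count as universally closed, in accordance with [prv_ax]. *)
Definition models (T : theory) : Prop := forall A v w, T A -> msat v w A.

End Satisfaction.

(** * Quotients by an equivalence relation *)

Section Quotient.
Variables (T : Type) (E : T -> T -> Prop).
Hypotheses (E_refl : forall x, E x x) (E_sym : forall x y, E x y -> E y x)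
  (E_trans : forall x y z, E x y -> E y z -> E x z).

(** Classes are predicates, so extensionality turns equivalence into equality. The construction
    serves both the term model and the field of fractions. *)
Definition quotient : Type := {P : T -> Prop | exists x, P = E x}.

Definition cls (x : T) : quotient := exist _ (E x) (ex_intro _ x erefl).

Definition repr (q : quotient) : T := projT1 (cid (projT2 q)).

Lemma reprK q : cls (repr q) = q.
Proof.
by case: q => P HP; rewrite /repr /=; case: cid => x /= e; apply: eq_exist.
Qed.

Lemma clsP x y : cls x = cls y <-> E x y.
Proof.
split=> [[] H|H]; first by apply: E_sym; rewrite -H; apply: E_refl.
apply: eq_exist; apply: funext => z; apply: propext; split.
  exact: E_trans (E_sym H).
exact: E_trans H.
Qed.

Lemma repr_cls x : E (repr (cls x)) x.
Proof. by apply/clsP; rewrite reprK. Qed.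

End Quotient.

(* Enumeration of the formulas *)
#[local] Opaque to_nat.

Fixpoint code_term (t : term) : nat :=
  match t with
  | Var n => to_nat (0, n)
  | Zero => to_nat (1, 0)
  | One => to_nat (2, 0)
  | Plus s u => to_nat (3, to_nat (code_term s, code_term u))
  | Times s u => to_nat (4, to_nat (code_term s, code_term u))
  end.

Fixpoint code_form (A : form) : nat :=
  match A with
  | Bot => to_nat (0, 0)
  | EqN s t => to_nat (1, to_nat (code_term s, code_term t))
  | LtN s t => to_nat (2, to_nat (code_term s, code_term t))
  | Mem t X => to_nat (3, to_nat (code_term t, X))
  | Imp B C => to_nat (4, to_nat (code_form B, code_form C))
  | AllNum B => to_nat (5, code_form B)
  | AllSet B => to_nat (6, code_form B)
  end.

Lemma code_term_inj : injective code_term.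
Proof.
move=> s; elim: s => [n|||a IA b IB|a IA b IB] [m|||c d|c d] // /to_nat_inj [] //.
- by move=> ->.
- by move=> /to_nat_inj [/IA -> /IB ->].
- by move=> /to_nat_inj [/IA -> /IB ->].
Qed.

Lemma code_form_inj : injective code_form.
Proof.
move=> A; elim: A => [|a b|a b|a X|A IA B IB|A IA|A IA] [|c d|c d|c Y|C D|C|C] // /to_nat_inj
  [] //.
- by move=> /to_nat_inj [/code_term_inj -> /code_term_inj ->].
- by move=> /to_nat_inj [/code_term_inj -> /code_term_inj ->].
- by move=> /to_nat_inj [/code_term_inj -> ->].
- by move=> /to_nat_inj [/IA -> /IB ->].
- by move=> /IA ->.
- by move=> /IA ->.
Qed.

Lemma form_enumeration : exists f : nat -> form, forall A, exists n, f n = A.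
Proof.
exists (fun n => if pselect (exists A, code_form A = n) is left e then projT1 (cid e) else Bot).
move=> A; exists (code_form A); case: pselect => [e|[]]; last by exists A.
by case: cid => B /= /code_form_inj.
Qed.

Section Henkin.
Variables (T : theory) (G0 : list form).
Hypothesis G0_cons : ~ prv T G0 Bot.

Definition formulas : nat -> form := projT1 (cid form_enumeration).

Lemma formulasP A : exists n, formulas n = A.
Proof. by rewrite /formulas; case: cid. Qed.

Definition fresh (f : form -> nat) (G : list form) : nat :=
  fold_right (fun B m => max (f B) m) 0 G.

(** Variables serve as Henkin constants: the context stays a finite list, so a fresh variable is
    always left to name the counterexample to a refuted universal formula. *)
Definition henkin_step (G : list form) (A : form) : list form :=
  if pselect (prv T (A :: G) Bot) then
    match A with
    | AllNum B => [Not (instN (Var (fresh numbound (Not A :: G))) B); Not A] ++ G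
    | AllSet B => [Not (instS (fresh setbound (Not A :: G)) B); Not A] ++ G
    | _ => Not A :: G
    end
  else A :: G.

Lemma henkin_step_incl G A : incl G (henkin_step G A).
Proof.
rewrite /henkin_step => B GB; case: pselect => ? /=; last by right.
by destruct A; rewrite /=; auto.
Qed.

(** If the negated instance were inconsistent with the context, the instance at a fresh variable
    would be provable and could be generalized, against the negated universal formula. *)
Lemma henkin_step_cons G A : ~ prv T G Bot -> ~ prv T (henkin_step G A) Bot.
Proof.
rewrite /henkin_step => HG; case: pselect => // HA.
have H : ~ prv T (Not A :: G) Bot.
  move=> HN; apply: HG; apply: (@prv_impE _ _ A _); last exact: prv_raa.
  exact: prv_impI.
have bd f B : In B (Not A :: G) -> f B <= fresh f (Not A :: G) by exact: fold_max_le.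
case: A HA H bd => //= B HB H bd.
- move=> /prv_raa HN; apply: H.
  apply: (@prv_impE _ _ (AllNum B) _); first by apply: prv_hyp; left.
  apply: prv_allN_fresh HN => [C|]; first exact: bd.
  by move: (bd numbound _ (or_introl erefl)) => /=; lia.
- move=> /prv_raa HN; apply: H.
  apply: (@prv_impE _ _ (AllSet B) _); first by apply: prv_hyp; left.
  apply: prv_allS_fresh HN => [C|]; first exact: bd.
  by move: (bd setbound _ (or_introl erefl)) => /=; lia.
Qed.

Fixpoint stage (n : nat) : list form :=
  match n with
  | 0 => G0
  | S m => henkin_step (stage m) (formulas m)
  end.

Lemma stage_cons n : ~ prv T (stage n) Bot.
Proof. by elim: n => //= n IH; apply: henkin_step_cons. Qed.

Lemma stage_incl m n : incl (stage m) (stage (n + m)).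
Proof.
elim: n => [|n IH] /=; first exact: incl_refl.
by apply: incl_tran (@henkin_step_incl _ _).
Qed.

Definition thm (A : form) : Prop := exists n, prv T (stage n) A.

Lemma thm_impE A B : thm (Imp A B) -> thm A -> thm B.
Proof.
move=> [n Hn] [m Hm]; exists (n + m); apply: (@prv_impE _ _ A _).
  by rewrite PeanoNat.Nat.add_comm; apply: prv_weaken Hn _ (@stage_incl _ _).
by apply: prv_weaken Hm _ (@stage_incl _ _).
Qed.

Lemma thm_prv A : (forall G, prv T G A) -> thm A.
Proof. by exists 0. Qed.

Lemma thm_cons : ~ thm Bot.
Proof. by case=> n /stage_cons. Qed.

Lemma thm_not A : thm (Not A) <-> ~ thm A.
Proof.
split=> [HN HA|HA]; first exact: thm_cons (thm_impE HN HA).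
have [n An] := formulasP A; exists (S n) => /=; rewrite An /henkin_step.
case: pselect => [?|?] /=; last first.
  by case: HA; exists (S n); rewrite /= An /henkin_step; case: pselect => // H;
    apply: prv_hyp; left.
by apply: prv_hyp; destruct A; rewrite /=; auto.
Qed.

Lemma thm_imp A B : thm (Imp A B) <-> (thm A -> thm B).
Proof.
split=> [H1 H2|H]; first exact: thm_impE H1 H2.
case: (EM (thm A)) => [/H [n HB]|/thm_not HA].
  by exists n; apply/prv_impI/prv_weaken; [exact: HB|right].
apply: thm_impE HA; apply: thm_prv => G; apply/prv_impI/prv_impI/prv_raa.
by apply: (@prv_impE _ _ A _); apply: prv_hyp; rewrite /=; auto.
Qed.

Lemma thm_allN A : thm (AllNum A) <-> forall t, thm (instN t A).
Proof.
split=> [[n H] t|H]; first by exists n; apply: prv_allNE.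
apply: contrapT => HN.
have [n An] := formulasP (AllNum A).
have : prv T (stage (S n)) (AllNum A) \/ exists t, prv T (stage (S n)) (Not (instN t A)).
  rewrite /= An /henkin_step; case: pselect => ? /=; last by left; apply: prv_hyp; left.
  by right; eexists; apply: prv_hyp; left.
case=> [H1|[t H1]]; first by apply: HN; exists (S n).
by apply/thm_not: (H t); exists (S n).
Qed.

Lemma thm_allS A : thm (AllSet A) <-> forall X, thm (instS X A).
Proof.
split=> [[n H] t|H]; first by exists n; apply: prv_allSE.
apply: contrapT => HN.
have [n An] := formulasP (AllSet A).
have : prv T (stage (S n)) (AllSet A) \/ exists X, prv T (stage (S n)) (Not (instS X A)).
  rewrite /= An /henkin_step; case: pselect => ? /=; last by left; apply: prv_hyp; left.
  by right; eexists; apply: prv_hyp; left.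
case=> [H1|[t H1]]; first by apply: HN; exists (S n).
by apply/thm_not: (H t); exists (S n).
Qed.

Lemma thm_eq A s t : thm (EqN s t) -> thm (instN s A) -> thm (instN t A).
Proof.
move=> [n Hn] [m Hm]; exists (n + m); apply: (@prv_eq _ _ _ s _).
  by rewrite PeanoNat.Nat.add_comm; apply: prv_weaken Hn _ (@stage_incl _ _).
by apply: prv_weaken Hm _ (@stage_incl _ _).
Qed.

Definition teq (s t : term) : Prop := thm (EqN s t).

Let sub_lift s t : tsubst (scons s Var) (tlift t) = t.
Proof. by rewrite tsubst_tlift tsubst_id. Qed.

Lemma teq_refl t : teq t t.
Proof. by apply: thm_prv => G; apply: prv_refl. Qed.

Lemma teq_sym s t : teq s t -> teq t s.
Proof.
move=> H; have := @thm_eq (EqN (Var 0) (tlift s)) s t H.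
by rewrite /instN /= !sub_lift; apply; apply: teq_refl.
Qed.

Lemma teq_trans s t u : teq s t -> teq t u -> teq s u.
Proof.
move=> H1 H2; have := @thm_eq (EqN (tlift s) (Var 0)) t u H2.
by rewrite /instN /= !sub_lift; apply.
Qed.

Lemma teq_op (op : term -> term -> term) s s' t t' :
  (forall sg a b, tsubst sg (op a b) = op (tsubst sg a) (tsubst sg b)) ->
  teq s s' -> teq t t' -> teq (op s t) (op s' t').
Proof.
move=> opE H1 H2; apply: (@teq_trans _ (op s' t)).
  have := @thm_eq (EqN (tlift (op s t)) (op (Var 0) (tlift t))) s s' H1.
  by rewrite /instN /= !sub_lift !opE /= !sub_lift; apply; apply: teq_refl.
have := @thm_eq (EqN (tlift (op s' t)) (op (tlift s') (Var 0))) t t' H2.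
by rewrite /instN /= !sub_lift !opE /= !sub_lift; apply; apply: teq_refl.
Qed.

Lemma thm_lt_congr s s' t t' : teq s s' -> teq t t' -> thm (LtN s t) -> thm (LtN s' t').
Proof.
move=> H1 H2 H3.
have := @thm_eq (LtN (Var 0) (tlift t)) s s' H1; rewrite /instN /= !sub_lift => /(_ H3).
by have := @thm_eq (LtN (tlift s') (Var 0)) t t' H2; rewrite /instN /= !sub_lift.
Qed.

Lemma thm_mem_congr s s' X : teq s s' -> thm (Mem s X) -> thm (Mem s' X).
Proof.
by move=> H; have := @thm_eq (Mem (Var 0) X) s s' H; rewrite /instN /=.
Qed.

Local Notation tcls := (@cls term teq).
Local Notation trepr := (@repr term teq).

(** Terms up to provable equality are the numbers. The set variables themselves are the sets, since
    there are no other set terms. *)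
Definition term_model : structure :=
  @Structure (quotient teq) nat (tcls Zero) (tcls One)
    (fun x y => tcls (Plus (trepr x) (trepr y)))
    (fun x y => tcls (Times (trepr x) (trepr y)))
    (fun x y => thm (LtN (trepr x) (trepr y)))
    (fun x X => thm (Mem (trepr x) X)).

Let clsP s t : tcls s = tcls t <-> teq s t.
Proof. exact: (clsP teq_refl teq_sym teq_trans). Qed.

Let repr_cls s : teq (trepr (tcls s)) s.
Proof. exact: (repr_cls teq_refl teq_sym teq_trans). Qed.

Lemma teval_term_model sg t :
  @teval term_model (fun n => tcls (sg n)) t = tcls (tsubst sg t).
Proof.
elim: t => //= [a -> b ->|a -> b ->]; apply/clsP.
  by apply: (@teq_op Plus).
by apply: (@teq_op Times).
Qed.

Lemma msat_term_model A : forall sg rh,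
  @msat term_model (fun n => tcls (sg n)) rh A <-> thm (fsubst sg rh A).
Proof.
elim: A => /= [|a b|a b|a X|A IA B IB|A IA|A IA] sg rh.
- by split=> // /thm_cons.
- by rewrite !teval_term_model; apply: clsP.
- rewrite !teval_term_model; split; apply: thm_lt_congr; try exact: repr_cls.
    exact/teq_sym/repr_cls.
  exact/teq_sym/repr_cls.
- rewrite !teval_term_model; split; apply: thm_mem_congr; first exact: repr_cls.
  exact/teq_sym/repr_cls.
- by rewrite thm_imp IA IB.
- rewrite thm_allN; split=> H.
  + move=> t; rewrite -/(up sg) instN_up; apply/IA.
    have := H (tcls t); congr (msat _ _ A); by apply: funext => -[].
  + move=> x; have := H (trepr x); rewrite -/(up sg) instN_up => /IA.
    congr (msat _ _ A); apply: funext => -[|n] //=.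
    exact: (reprK x).
- rewrite thm_allS; split=> H X; have := H X; rewrite -/(upS rh) instS_upS.
    by move=> {}H; apply/IA.
  by move/IA.
Qed.

Lemma term_model_models : models term_model T.
Proof.
move=> A v w TA.
have -> : v = (fun n => tcls (trepr (v n))).
  by apply: funext => n; exact: (esym (reprK (v n))).
by apply/msat_term_model; exists 0; apply/prv_subst_closed/prv_ax.
Qed.

Lemma term_model_hyp A : In A G0 -> @msat term_model (fun n => tcls (Var n)) (fun X => X) A.
Proof. by move=> GA; apply/msat_term_model; rewrite fsubst_id; exists 0; apply: prv_hyp. Qed.

End Henkin.

Theorem completeness T A :
  (forall M, models M T -> forall v w, @msat M v w A) -> provable T A.
Proof.
move=> H; apply: contrapT => HA.
have cons : ~ prv T [Not A] Bot by move=> /prv_raa.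
have := term_model_hyp cons (or_introl erefl); apply => /=.
exact: H (term_model_models cons) _ _.
Qed.

End Completeness.

From HB Require Import structures.
From mathcomp Require Import all_boot all_order all_algebra ring lra.
Import boolp.
Import Order.TTheory GRing.Theory Num.Theory.
Import Defs Completeness.
Local Open Scope ring_scope.

(** * The field of fractions of a discretely ordered semiring *)

Record discrete_semiring (M : structure) : Prop := DiscreteSemiring {
  dsr_addA : associative (@nadd M);
  dsr_addC : commutative (@nadd M);
  dsr_add0 : left_id (nzero M) (@nadd M);
  dsr_mulA : associative (@nmul M);
  dsr_mulC : commutative (@nmul M);
  dsr_mul1 : left_id (none M) (@nmul M);
  dsr_mul0 : left_zero (nzero M) (@nmul M);
  dsr_mulD : left_distributive (@nmul M) (@nadd M);
  dsr_trans : forall x y z : num M, nlt x y -> nlt y z -> nlt x z;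
  dsr_irrefl : forall x : num M, ~ nlt x x;
  dsr_total : forall x y : num M, nlt x y \/ x = y \/ nlt y x;
  dsr_ltD : forall x y z : num M, nlt x y -> nlt (nadd x z) (nadd y z);
  dsr_ltM : forall x y z : num M, nlt (nzero M) z -> nlt x y -> nlt (nmul x z) (nmul y z);
  dsr_sub : forall x y : num M, nlt x y -> exists z, nadd x z = y;
  dsr_lt01 : nlt (nzero M) (none M);
  dsr_ge1 : forall x : num M, nlt (nzero M) x -> x = none M \/ nlt (none M) x;
  dsr_ge0 : forall x : num M, x = nzero M \/ nlt (nzero M) x }.

Section Fractions.
Variable M : structure.
Hypothesis HM : discrete_semiring M.

(** A copy of the numbers indexed by the proof of the axioms, so that the algebraic structures
    attached to it can depend on that proof. *)
Definition carrier_of (_ : discrete_semiring M) : Type := num M.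
Local Notation carrier := (carrier_of HM).
HB.instance Definition _ := gen_eqMixin carrier.
HB.instance Definition _ := gen_choiceMixin carrier.
HB.instance Definition _ := GRing.isNmodule.Build carrier
  (dsr_addA HM) (dsr_addC HM) (dsr_add0 HM).

Lemma carrier_oner_neq0 : (none M : carrier) != 0.
Proof.
apply/negP => /eqP e; have := dsr_lt01 HM.
by rewrite e => /(dsr_irrefl HM).
Qed.

HB.instance Definition _ := GRing.Nmodule_isComNzSemiRing.Build carrier
  (dsr_mulA HM) (dsr_mulC HM) (dsr_mul1 HM) (dsr_mulD HM) (dsr_mul0 HM) carrier_oner_neq0.

Implicit Types x y z : carrier.

Local Notation lt := (@nlt M : carrier -> carrier -> Prop).

Lemma lt_addr z x y : lt x y <-> lt (x + z) (y + z).
Proof.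
split=> [|H]; first exact: (dsr_ltD HM).
case: (dsr_total HM x y) => [//|[e|/(dsr_ltD HM z) H1]].
  by rewrite e in H; case: (dsr_irrefl HM H).
by case: (dsr_irrefl HM (dsr_trans HM H H1)).
Qed.

Lemma addr_inj z x y : x + z = y + z -> x = y.
Proof.
move=> e; have {}e : nadd x z = nadd y z := e.
by case: (dsr_total HM x y) => [|[//|]] /(dsr_ltD HM z); rewrite e => /(dsr_irrefl HM).
Qed.

Lemma lt_mulr z x y : lt 0 z -> lt x y <-> lt (x * z) (y * z).
Proof.
move=> z0; split=> [|H]; first exact: (dsr_ltM HM).
case: (dsr_total HM x y) => [//|[e|/(dsr_ltM HM z0) H1]].
  by rewrite e in H; case: (dsr_irrefl HM H).
by case: (dsr_irrefl HM (dsr_trans HM H H1)).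
Qed.

Lemma mulr_inj z x y : lt 0 z -> x * z = y * z -> x = y.
Proof.
move=> z0 e; have {}e : nmul x z = nmul y z := e.
by case: (dsr_total HM x y) => [|[//|]] /(dsr_ltM HM z0); rewrite e => /(dsr_irrefl HM).
Qed.

Lemma lt0S x : lt 0 (x + 1).
Proof.
case: (dsr_ge0 HM x) => [->|H]; first by rewrite add0r; apply: (dsr_lt01 HM).
apply: (dsr_trans HM H); have /(@lt_addr x 0 1) := dsr_lt01 HM.
by rewrite add0r addrC.
Qed.

(* The triple (a, b, c) stands for (a - b) / (c + 1). *)
Definition frac : Type := (carrier * carrier * carrier)%type.
Implicit Types p q r : frac.

Definition frac_eq p q : Prop :=
  p.1.1 * (q.2 + 1) + q.1.2 * (p.2 + 1) = q.1.1 * (p.2 + 1) + p.1.2 * (q.2 + 1).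

Lemma frac_eq_refl p : frac_eq p p.
Proof. by []. Qed.

Lemma frac_eq_sym p q : frac_eq p q -> frac_eq q p.
Proof. by rewrite /frac_eq => ->. Qed.

Lemma frac_eq_trans p q r : frac_eq p q -> frac_eq q r -> frac_eq p r.
Proof.
rewrite /frac_eq; case: p q r => [[a b] c] [[a' b'] c'] [[a'' b''] c''] /= H1 H2.
apply: (mulr_inj (lt0S c')).
(* In a semiring the middle fraction cannot be subtracted; it is added to both sides and
   cancelled. *)
apply: (@addr_inj ((a' + b') * (c + 1) * (c'' + 1))).
transitivity ((a * (c' + 1) + b' * (c + 1)) * (c'' + 1) + (a' * (c'' + 1) + b'' * (c' + 1)) *
  (c + 1)).
  by ring.
by rewrite H1 H2; ring.
Qed.

Definition K : Type := quotient frac_eq.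
HB.instance Definition _ := gen_eqMixin K.
HB.instance Definition _ := gen_choiceMixin K.

Local Notation "[: a , b , c ]" := (cls frac_eq ((a, b), c) : K).

Lemma KP (k : K) : exists a b c, k = [: a, b, c].
Proof.
rewrite -(reprK k); case: (repr k) => -[a b] c; by exists a, b, c.
Qed.

Lemma K_eq a b c a' b' c' : [: a, b, c] = [: a', b', c'] <->
  a * (c' + 1) + b' * (c + 1) = a' * (c + 1) + b * (c' + 1).
Proof. exact: (clsP frac_eq_refl frac_eq_sym frac_eq_trans). Qed.

Definition lift1 (f : frac -> frac) (k : K) : K := cls frac_eq (f (repr k)).
Definition lift2 (f : frac -> frac -> frac) (k l : K) : K :=
  cls frac_eq (f (repr k) (repr l)).

Lemma lift1E f p : (forall p q, frac_eq p q -> frac_eq (f p) (f q)) ->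
  lift1 f (cls frac_eq p) = cls frac_eq (f p).
Proof.
move=> H; apply/(clsP frac_eq_refl frac_eq_sym frac_eq_trans)/H.
exact: (repr_cls frac_eq_refl frac_eq_sym frac_eq_trans).
Qed.

(** Commutativity reduces compatibility in both arguments to compatibility in the first. *)
Lemma lift2E f p q : (forall p q r, frac_eq p q -> frac_eq (f p r) (f q r)) ->
  (forall p q, frac_eq (f p q) (f q p)) ->
  lift2 f (cls frac_eq p) (cls frac_eq q) = cls frac_eq (f p q).
Proof.
move=> H C; apply/(clsP frac_eq_refl frac_eq_sym frac_eq_trans).
have E s : frac_eq (repr (cls frac_eq s)) s.
  exact: (repr_cls frac_eq_refl frac_eq_sym frac_eq_trans).
apply: frac_eq_trans (H _ _ _ (E p)) _; apply: frac_eq_trans (C _ _) _.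
by apply: frac_eq_trans (H _ _ _ (E q)) _; apply: C.
Qed.

(** Denominators are stored as predecessors, and [c * c' + c + c'] is the predecessor of
    [(c + 1) * (c' + 1)]. *)
Definition frac_add p q : frac :=
  ((p.1.1 * (q.2 + 1) + q.1.1 * (p.2 + 1), p.1.2 * (q.2 + 1) + q.1.2 * (p.2 + 1)),
   p.2 * q.2 + p.2 + q.2).
Definition frac_opp p : frac := ((p.1.2, p.1.1), p.2).
Definition frac_mul p q : frac :=
  ((p.1.1 * q.1.1 + p.1.2 * q.1.2, p.1.1 * q.1.2 + p.1.2 * q.1.1),
   p.2 * q.2 + p.2 + q.2).

Lemma K_add a b c a' b' c' : lift2 frac_add [: a, b, c] [: a', b', c'] =
  [: a * (c' + 1) + a' * (c + 1), b * (c' + 1) + b' * (c + 1), c * c' + c + c'].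
Proof.
rewrite lift2E //; last by move=> [[? ?] ?] [[? ?] ?]; rewrite /frac_eq /frac_add /=; ring.
move=> {a b c a' b' c'} [[a b] c] [[a' b'] c'] [[d e] f]; rewrite /frac_eq /frac_add /= => H.
transitivity ((a * (c' + 1) + b' * (c + 1)) * (f + 1) ^+ 2 + (d + e) * (c + 1) * (c' + 1) *
  (f + 1)).
  by ring.
by rewrite H; ring.
Qed.

Lemma K_opp a b c : lift1 frac_opp [: a, b, c] = [: b, a, c].
Proof.
rewrite lift1E // => {a b c} -[[a b] c] [[a' b'] c']; rewrite /frac_eq /frac_opp /= => H.
by rewrite addrC -H addrC.
Qed.

Lemma K_mul a b c a' b' c' : lift2 frac_mul [: a, b, c] [: a', b', c'] =
  [: a * a' + b * b', a * b' + b * a', c * c' + c + c'].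
Proof.
rewrite lift2E //; last by move=> [[? ?] ?] [[? ?] ?]; rewrite /frac_eq /frac_mul /=; ring.
move=> {a b c a' b' c'} [[a b] c] [[a' b'] c'] [[d e] f]; rewrite /frac_eq /frac_mul /= => H.
transitivity ((a * (c' + 1) + b' * (c + 1)) * d * (f + 1) + (a' * (c + 1) + b * (c' + 1)) * e
  * (f + 1)).
  by ring.
by rewrite H -[in X in _ + X]H; ring.
Qed.

Lemma K_addA : associative (lift2 frac_add).
Proof.
move=> k l m; have [a [b [c ->]]] := KP k; have [a' [b' [c' ->]]] := KP l.
by have [d [e [f ->]]] := KP m; rewrite !K_add; apply/K_eq; ring.
Qed.

Lemma K_addC : commutative (lift2 frac_add).
Proof.
move=> k l; have [a [b [c ->]]] := KP k; have [a' [b' [c' ->]]] := KP l.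
by rewrite !K_add; apply/K_eq; ring.
Qed.

Lemma K_add0 : left_id [: 0, 0, 0] (lift2 frac_add).
Proof.
by move=> k; have [a [b [c ->]]] := KP k; rewrite !K_add; apply/K_eq; ring.
Qed.

Lemma K_addN : left_inverse [: 0, 0, 0] (lift1 frac_opp) (lift2 frac_add).
Proof.
by move=> k; have [a [b [c ->]]] := KP k; rewrite !K_opp !K_add; apply/K_eq; ring.
Qed.

HB.instance Definition _ := GRing.isZmodule.Build K K_addA K_addC K_add0 K_addN.

Lemma K_mulA : associative (lift2 frac_mul).
Proof.
move=> k l m; have [a [b [c ->]]] := KP k; have [a' [b' [c' ->]]] := KP l.
by have [d [e [f ->]]] := KP m; rewrite !K_mul; apply/K_eq; ring.
Qed.

Lemma K_mulC : commutative (lift2 frac_mul).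
Proof.
move=> k l; have [a [b [c ->]]] := KP k; have [a' [b' [c' ->]]] := KP l.
by rewrite !K_mul; apply/K_eq; ring.
Qed.

Lemma K_mul1 : left_id [: 1, 0, 0] (lift2 frac_mul).
Proof.
by move=> k; have [a [b [c ->]]] := KP k; rewrite !K_mul; apply/K_eq; ring.
Qed.

Lemma K_mulD : left_distributive (lift2 frac_mul) (lift2 frac_add).
Proof.
move=> k l m; have [a [b [c ->]]] := KP k; have [a' [b' [c' ->]]] := KP l.
by have [d [e [f ->]]] := KP m; rewrite !(K_add, K_mul); apply/K_eq; ring.
Qed.

Lemma K_1neq0 : [: 1, 0, 0] != 0 :> K.
Proof.
apply/negP => /eqP/K_eq; rewrite !mul0r !addr0 add0r mulr1 => /eqP.
by rewrite oner_eq0.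
Qed.

HB.instance Definition _ := GRing.Zmodule_isComNzRing.Build K
  K_mulA K_mulC K_mul1 K_mulD K_1neq0.

(** By trichotomy a nonzero numerator is [d + 1] up to sign, hence a legal denominator. The second
    clause is the convention for the inverse of 0. *)
Lemma K_inv (k : K) : exists l : K, (k != 0 -> l * k = 1) /\ (k = 0 -> l = 0).
Proof.
have [->|k0] := eqVneq k 0; first by exists 0; split=> //; rewrite eqxx.
have [a [b [c kE]]] := KP k.
have pos x : lt 0 x -> exists y, x = y + 1.
  move=> /(dsr_ge1 HM)[->|/(dsr_sub HM)[y <-]]; first by exists 0; rewrite add0r.
  by exists y; apply: (dsr_addC HM).
have diff x y : lt x y -> exists z, y = x + z + 1.
  move=> H; have [z zE] := dsr_sub HM H; have {}zE : x + z = y := zE.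
  have [t tE] : exists t : carrier, (z : carrier) = t + 1.
    by apply: pos; apply/(@lt_addr x); rewrite add0r addrC zE.
  by exists t; rewrite -zE tE addrA.
case: (dsr_total HM a b) => [/diff[d e]|[e|/diff[d e]]].
- exists [: 0, c + 1, d]; split=> [_|k00]; last by rewrite k00 eqxx in k0.
  by rewrite kE e; change (lift2 frac_mul [: 0, c + 1, d] [: a, a + d + 1, c] = [: 1, 0, 0]);
     rewrite K_mul; apply/K_eq; ring.
- by case/eqP: k0; rewrite kE; apply/K_eq; rewrite e; ring.
- exists [: c + 1, 0, d]; split=> [_|k00]; last by rewrite k00 eqxx in k0.
  by rewrite kE e; change (lift2 frac_mul [: c + 1, 0, d] [: b + d + 1, b, c] = [: 1, 0, 0]);
     rewrite K_mul; apply/K_eq; ring.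
Qed.

Definition K_inverse (k : K) : K := projT1 (cid (K_inv k)).

Lemma K_mulVf (k : K) : k != 0 -> K_inverse k * k = 1.
Proof. by rewrite /K_inverse; case: cid => l /= [H _] /H. Qed.

Lemma K_inv0 : K_inverse 0 = 0.
Proof. by rewrite /K_inverse; case: cid => l /= [_ H]; apply: H. Qed.

HB.instance Definition _ := GRing.ComNzRing_isField.Build K K_mulVf K_inv0.

Definition K_nonneg (k : K) : Prop := exists a b c, k = [: a, b, c] /\ ~ lt a b.

Lemma K_nonnegP a b c : K_nonneg [: a, b, c] <-> ~ lt a b.
Proof.
split=> [[a' [b' [c' [/K_eq e H]]]] H1|H]; last by exists a, b, c.
apply: H; apply/(lt_mulr _ _ (lt0S c))/(@lt_addr (b * (c' + 1))).
rewrite -e [b' * _ + _]addrC.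
by apply: (proj1 (lt_addr _ _ _)); apply: (proj1 (lt_mulr _ _ (lt0S c'))).
Qed.

Definition K_le (k l : K) : bool := `[< K_nonneg (l - k) >].
Definition K_lt (k l : K) : bool := (l != k) && K_le k l.
Definition K_norm (k : K) : K := if K_le 0 k then k else - k.

Lemma K_subE a b c a' b' c' : [: a, b, c] - [: a', b', c'] =
  [: a * (c' + 1) + b' * (c + 1), b * (c' + 1) + a' * (c + 1), c * c' + c + c'].
Proof. by rewrite /GRing.add /GRing.opp /= K_opp K_add. Qed.

Lemma K_le_sub k l : K_le 0 (l - k) = K_le k l.
Proof. by rewrite /K_le subr0. Qed.

Lemma K_le0D k l : K_le 0 k -> K_le 0 l -> K_le 0 (k + l).
Proof.
rewrite /K_le !subr0; have [a [b [c ->]]] := KP k; have [a' [b' [c' ->]]] := KP l.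
move=> /asboolP/K_nonnegP H1 /asboolP/K_nonnegP H2; apply/asboolP.
rewrite /GRing.add /= K_add; apply/K_nonnegP => H.
have {}H1 : lt b a \/ a = b by case: (dsr_total HM a b); tauto.
have {}H2 : lt b' a' \/ a' = b' by case: (dsr_total HM a' b'); tauto.
case: H1 => [|e].
  move=> /(lt_mulr _ _ (lt0S c'))/(lt_addr (b' * (c + 1))) H1.
  case: H2 => [/(lt_mulr _ _ (lt0S c))/(lt_addr (a * (c' + 1)))|e].
    rewrite [_ + a * _]addrC [_ + a * _]addrC => /(dsr_trans HM H1) /(dsr_trans HM).
    by move=> /(_ _ H)/(dsr_irrefl HM).
  by move: H; rewrite e => /(dsr_trans HM H1)/(dsr_irrefl HM).
rewrite {a}e in H; case: H2 => [/(lt_mulr _ _ (lt0S c))/(lt_addr (b * (c' + 1)))|e].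
  by rewrite [_ + b * _]addrC [_ + b * _]addrC => /(dsr_trans HM H)/(dsr_irrefl HM).
by rewrite e in H; case: (dsr_irrefl HM H).
Qed.

Lemma K_le0M k l : K_le 0 k -> K_le 0 l -> K_le 0 (k * l).
Proof.
rewrite /K_le !subr0; have [a [b [c ->]]] := KP k; have [a' [b' [c' ->]]] := KP l.
have ge x y : ~ lt x y -> exists z, x = y + z.
  move=> H; case: (dsr_total HM x y) => [/H//|[->|/(dsr_sub HM)[z <-]]]; last by exists z.
  by exists 0; rewrite addr0.
move=> /asboolP/K_nonnegP/ge[d ->] /asboolP/K_nonnegP/ge[d' ->]; apply/asboolP.
rewrite {1}/GRing.mul /= K_mul; apply/K_nonnegP.
rewrite (_ : (b + d) * (b' + d') + b * b' = d * d' + ((b + d) * b' + b * (b' + d')));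
  last by ring.
move=> H; case: (dsr_ge0 HM (d * d')) => [e|H1]; first by rewrite e add0r in H;
  case: (dsr_irrefl HM H).
move: H1 => /(lt_addr ((b + d) * b' + b * (b' + d'))); rewrite add0r => /(dsr_trans HM H).
exact: (dsr_irrefl HM).
Qed.

Lemma K_le0_anti k : K_le 0 k -> K_le k 0 -> k = 0.
Proof.
rewrite /K_le subr0 sub0r; have [a [b [c ->]]] := KP k.
rewrite /GRing.opp /= K_opp => /asboolP/K_nonnegP H1 /asboolP/K_nonnegP H2.
by case: (dsr_total HM a b) => [|[->|]] //; apply/K_eq; ring.
Qed.

Lemma K_le0_total k : K_le 0 k || K_le k 0.
Proof.
rewrite /K_le subr0 sub0r; have [a [b [c ->]]] := KP k.
rewrite /GRing.opp /= K_opp; apply/orP.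
case: (EM (lt a b)) => H; [right|left]; apply/asboolP/K_nonnegP => // H1.
by case: (dsr_irrefl HM (dsr_trans HM H H1)).
Qed.

Lemma K_normN k : K_norm (- k) = K_norm k.
Proof.
rewrite /K_norm; have e : K_le 0 (- k) = K_le k 0 by rewrite -sub0r K_le_sub.
rewrite e opprK; have := K_le0_total k.
case H1: (K_le 0 k); case H2: (K_le k 0) => // _.
by rewrite (K_le0_anti H1 H2) oppr0.
Qed.

Lemma K_ge0_norm k : K_le 0 k -> K_norm k = k.
Proof. by rewrite /K_norm => ->. Qed.

Lemma K_lt_def k l : K_lt k l = (l != k) && K_le k l.
Proof. by []. Qed.

HB.instance Definition _ := Num.IntegralDomain_isLeReal.Build K
  K_le0D K_le0M K_le0_anti K_le_sub K_le0_total K_normN K_ge0_norm K_lt_def.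

End Fractions.

(** The interface to the construction. That every field element is a fraction later yields the
    Archimedean property relative to the numbers of the model. *)
Lemma fractions M : discrete_semiring M -> exists (F : realFieldType) (i : num M -> F),
  [/\ i (nzero M) = 0, i (none M) = 1,
      forall x y, i (nadd x y) = i x + i y & forall x y, i (nmul x y) = i x * i y] /\
  (forall x y, nlt x y <-> i x < i y) /\
  (forall z, exists x y c, z = (i x - i y) / (i c + 1)).
Proof.
move=> HM.
pose i (x : carrier_of HM) : K HM := cls (@frac_eq _ HM) ((x, 0 : carrier_of HM), 0 :
  carrier_of HM).
exists (K HM), i.
have iD x y : i (nadd x y) = i x + i y.
  apply: etrans (esym (K_add _ _ _ _ _ _)); apply/K_eq.
  by change (nadd x y) with ((x : carrier_of HM) + y); ring.
have i1 : i (none M) = 1 by [].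
have iM x y : i (nmul x y) = i x * i y.
  apply: etrans (esym (K_mul _ _ _ _ _ _)); apply/K_eq.
  by change (nmul x y) with ((x : carrier_of HM) * y); ring.
split; first by split.
split=> [x y|z].
  have -> : (i x < i y) = ~~ (i y <= i x) by rewrite real_ltNge ?num_real.
  have -> : (i y <= i x) = `[< ~ @nlt M x y >].
    change (K_le (i y) (i x) = `[< ~ @nlt M x y >]).
    rewrite /K_le /i K_subE; apply: asbool_equiv_eq.
    by rewrite K_nonnegP !mul0r !add0r !addr0 !mulr1.
  by split=> [H|/asboolPn/contrapT//]; apply/asboolPn => H1.
have [a [b [c zE]]] := KP z; exists a, b, c.
have c0 : i c + 1 != 0.
  have -> : i c + 1 = i (nadd c (none M)) by rewrite iD i1.
  apply/negP => /eqP/K_eq; rewrite !mul0r !addr0 add0r mulr1 => e.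
  by have := lt0S c; rewrite [c + 1]e => /(dsr_irrefl HM).
apply: (mulIf c0); rewrite divfK // zE -i1 -iD /i K_subE.
apply: etrans (K_mul _ _ _ _ _ _) _; apply/K_eq.
change (nadd c (none M)) with ((c : carrier_of HM) + 1); ring.
Qed.

(** * Definability in a model *)

Definition tl {T : Type} (v : nat -> T) (n : nat) : T := v n.+1.

Section Bounded.
Variables (M : structure) (X0 : sets M).
Notation env := (nat -> num M).

(** Terms and bounded formulas taken semantically, as functions of an environment: parameters are
    absorbed as constants, and index 0 is the variable bound last. *)
Inductive poly : (env -> num M) -> Prop :=
| poly_var j : poly (fun v => v j)
| poly_const c : poly (fun _ => c)
| poly_add t u : poly t -> poly u -> poly (fun v => nadd (t v) (u v))
| poly_mul t u : poly t -> poly u -> poly (fun v => nmul (t v) (u v)).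

Inductive bdd : (env -> Prop) -> Prop :=
| bdd_bot : bdd (fun _ => False)
| bdd_eq t u : poly t -> poly u -> bdd (fun v => t v = u v)
| bdd_lt t u : poly t -> poly u -> bdd (fun v => nlt (t v) (u v))
| bdd_mem t X : poly t -> bdd (fun v => smem (t v) X)
| bdd_imp P Q : bdd P -> bdd Q -> bdd (fun v => P v -> Q v)
| bdd_all t (Q : num M -> env -> Prop) : poly t ->
    bdd (fun v => Q (v 0%N) (tl v)) -> bdd (fun v => forall x, nlt x (t v) -> Q x v).

Definition look (sg : nat -> nat + num M) (v : env) : env :=
  fun n => match sg n with inl j => v j | inr c => c end.

(** Interleaving keeps the parameters of two formulas apart when the formulas are combined. *)
Definition join {T : Type} (f g : nat -> T) (n : nat) : T :=
  if odd n then g n./2 else f n./2.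

Lemma join_double T (f g : nat -> T) n : join f g n.*2 = f n.
Proof. by rewrite /join odd_double doubleK. Qed.

Lemma join_doubleS T (f g : nat -> T) n : join f g n.*2.+1 = g n.
Proof. by rewrite /join /= odd_double /= uphalf_double. Qed.

Lemma look_double s1 s2 v n : look (join s1 s2) v n.*2 = look s1 v n.
Proof. by rewrite /look join_double. Qed.

Lemma look_doubleS s1 s2 v n : look (join s1 s2) v n.*2.+1 = look s2 v n.
Proof. by rewrite /look join_doubleS. Qed.

Let evn := fun n => Var n.*2.
Let odn := fun n => Var n.*2.+1.

Lemma teval_evn s1 s2 v u : teval (look (join s1 s2) v) (tsubst evn u) = teval (look s1 v) u.
Proof. by rewrite teval_tsubst; congr teval; apply: funext => n /=; rewrite look_double. Qed.

Lemma teval_odn s1 s2 v u : teval (look (join s1 s2) v) (tsubst odn u) = teval (look s2 v) u.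
Proof. by rewrite teval_tsubst; congr teval; apply: funext => n /=; rewrite look_doubleS. Qed.

Lemma poly_term t : poly t -> exists u sg, forall v, t v = teval (look sg v) u.
Proof.
elim=> {t} [j|c|t1 t2 _ [u1 [s1 e1]] _ [u2 [s2 e2]]|t1 t2 _ [u1 [s1 e1]] _ [u2 [s2 e2]]].
- by exists (Var 0), (fun _ => inl j).
- by exists (Var 0), (fun _ => inr c).
- exists (Plus (tsubst evn u1) (tsubst odn u2)), (join s1 s2) => v.
  by rewrite /= teval_evn teval_odn e1 e2.
- exists (Times (tsubst evn u1) (tsubst odn u2)), (join s1 s2) => v.
  by rewrite /= teval_evn teval_odn e1 e2.
Qed.

Lemma bounded_fsubst A : bounded A -> forall sg rh, bounded (fsubst sg rh A).
Proof.
elim=> {A} /=; try by move=> *; constructor.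
move=> t A _ IA sg rh; rewrite -/(up sg) tsubst_up.
by constructor; apply: IA.
Qed.

Lemma bdd_form P : bdd P ->
  exists A sg w, bounded A /\ forall v, P v <-> msat (look sg v) w A.
Proof.
elim=> {P}.
- by exists Bot, (fun=> inl 0%N), (fun=> X0); split=> //; constructor.
- move=> t u /poly_term [a [s1 e1]] /poly_term [b [s2 e2]].
  exists (EqN (tsubst evn a) (tsubst odn b)), (join s1 s2), (fun _ => X0).
  by split=> [|v]; [constructor | rewrite /= teval_evn teval_odn e1 e2].
- move=> t u /poly_term [a [s1 e1]] /poly_term [b [s2 e2]].
  exists (LtN (tsubst evn a) (tsubst odn b)), (join s1 s2), (fun _ => X0).
  by split=> [|v]; [constructor | rewrite /= teval_evn teval_odn e1 e2].
- move=> t X /poly_term [a [s1 e1]].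
  by exists (Mem a 0), s1, (fun _ => X); split=> [|v]; [constructor | rewrite /= e1].
- move=> P Q _ [A [s1 [w1 [bA eA]]]] _ [B [s2 [w2 [bB eB]]]].
  exists (Imp (fsubst evn double A) (fsubst odn (fun n => n.*2.+1) B)), (join s1 s2),
    (join w1 w2).
  split=> [|v]; first by constructor; apply: bounded_fsubst.
  rewrite eA eB /= !msat_fsubst.
  rewrite (_ : (fun n => teval _ (evn n)) = look s1 v); last by apply: funext => n /=;
    rewrite look_double.
  rewrite (_ : (fun n => teval _ (odn n)) = look s2 v); last by apply: funext => n /=;
    rewrite look_doubleS.
  rewrite (_ : (fun n => join w1 w2 n.*2) = w1); last by apply: funext => n;
    rewrite join_double.
  by rewrite (_ : (fun n => join w1 w2 n.*2.+1) = w2); last by apply: funext => n;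
    rewrite join_doubleS.
- move=> t Q /poly_term [a [s1 e1]] _ [A [s2 [w [bA eA]]]].
  (* Variables of [A] that look up index 0 become the bound variable; the others move past the
     binder to the odd positions, where [s2'] undoes the shift of the environment. *)
  pose rn n := match s2 n with inl 0%N => Var 0 | _ => Var n.*2.+2 end.
  pose s2' n : nat + num M := match s2 n with inl j => inl j.-1 | inr c => inr c end.
  exists (AllNum (Imp (LtN (Var 0) (tlift (tsubst evn a))) (fsubst rn id A))), (join s1 s2'), w.
  split=> [|v]; first by constructor; apply: bounded_fsubst.
  have /= lt_e x : teval (scons x (look (join s1 s2') v)) (tlift (tsubst evn a)) = t v.
    by rewrite e1 -(teval_evn s1 s2' v a) /tlift teval_tsubst.
  have sat_e x : Q x v <-> msat (scons x (look (join s1 s2') v)) w (fsubst rn id A).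
    rewrite msat_fsubst; have := eA (scons x v); rewrite /= => ->.
    rewrite (_ : look s2 (scons x v) = fun n =>
      teval (scons x (look (join s1 s2') v)) (rn n)) //.
    apply: funext => n; rewrite /rn /look.
    by case e: (s2 n) => [[|j]|c] //=; rewrite join_doubleS /s2' e.
  by split=> /= H x; [rewrite lt_e => /H/sat_e | move=> Hx; apply/sat_e/H; rewrite lt_e].
Qed.

Lemma bdd_ext P Q : bdd P -> (forall v, P v <-> Q v) -> bdd Q.
Proof. by move=> HP H; rewrite (_ : Q = P) //; apply: funext => v; apply/propext;
  rewrite H. Qed.

Lemma poly_subst t s : poly t -> (forall n, poly (s n)) -> poly (fun v => t (fun n => s n v)).
Proof. by elim=> {t} [j|c|t u _ It _ Iu|t u _ It _ Iu] H; [|constructor|constructor;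
  auto|constructor; auto]. Qed.

Lemma bdd_subst P : bdd P -> forall s, (forall n, poly (s n)) ->
  bdd (fun v => P (fun n => s n v)).
Proof.
elim=> {P}; try by move=> *; constructor; auto using poly_subst.
move=> t Q pt _ IH s ps; apply: bdd_all; first exact: poly_subst.
apply: (IH (fun n v => if n is m.+1 then s m (tl v) else v 0%N)) => -[|n];
  first exact: poly_var.
exact: (poly_subst (ps n) (fun j => poly_var j.+1)).
Qed.

Lemma poly_ren t (r : nat -> nat) : poly t -> poly (fun v => t (fun n => v (r n))).
Proof. by move=> pt; apply: (poly_subst pt) => n; apply: poly_var. Qed.

Lemma bdd_ren P (r : nat -> nat) : bdd P -> bdd (fun v => P (fun n => v (r n))).
Proof. by move=> bP; apply: (bdd_subst bP) => n; apply: poly_var. Qed.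

Lemma bdd_not P : bdd P -> bdd (fun v => ~ P v).
Proof. by move=> bP; apply: bdd_imp => //; apply: bdd_bot. Qed.

Lemma bdd_and P Q : bdd P -> bdd Q -> bdd (fun v => P v /\ Q v).
Proof.
move=> bP bQ; apply: (bdd_ext (bdd_not (bdd_imp bP (bdd_not bQ)))) => v.
by split; [move=> H; apply: contrapT; tauto | tauto].
Qed.

Lemma bdd_or P Q : bdd P -> bdd Q -> bdd (fun v => P v \/ Q v).
Proof.
move=> bP bQ; apply: (bdd_ext (bdd_imp (bdd_not bP) bQ)) => v.
by split; [move=> H; apply: contrapT; tauto | tauto].
Qed.

Lemma bdd_ex t (Q : num M -> env -> Prop) : poly t ->
  bdd (fun v => Q (v 0%N) (tl v)) -> bdd (fun v => exists x, nlt x (t v) /\ Q x v).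
Proof.
move=> pt bQ; apply: (bdd_ext (bdd_not (bdd_all (Q :=
  fun x v => ~ Q x v) pt (bdd_not bQ)))) => v.
split=> [H|[x [xt Qx]] H]; last exact: H xt Qx.
by apply: contrapT => H1; apply: H => x xt Qx; apply: H1; exists x.
Qed.

End Bounded.

Arguments poly_var {M} j.
Arguments bdd_bot {M}.

(** * Models of RCA0 together with their fraction field *)

Record rca := Rca {
  rca_struct :> structure;
  rca_field : realFieldType;
  N : num rca_struct -> rca_field;
  some_set : sets rca_struct;
  N0 : N (nzero rca_struct) = 0;
  N1 : N (none rca_struct) = 1;
  ND : forall x y, N (nadd x y) = N x + N y;
  NM : forall x y, N (nmul x y) = N x * N y;
  nltE : forall x y, nlt x y = (N x < N y);
  N_ge0 : forall x, 0 <= N x;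
  N_inj : forall x y, N x = N y -> x = y;
  N_disc : forall x y, N x < N y -> N x + 1 <= N y;
  N_sub : forall x y, N x <= N y -> exists z, N z = N y - N x;
  N_frac : forall z, exists x y c, z = (N x - N y) / (N c + 1);
  rca_ind : forall A v w, Sigma01 A -> @msat rca_struct v w (induction A);
  rca_comp : forall A B v w, bounded A -> bounded B ->
    @msat rca_struct v w (comprehension A B) }.

Lemma msat_and M v w A B : @msat M v w (And A B) <-> msat v w A /\ msat v w B.
Proof.
split=> [H|[a b] H]; last exact: H a b.
by split; apply: contrapT => H1; apply: H => a b; apply: H1.
Qed.

Lemma msat_iff M v w A B : @msat M v w (Iff A B) <-> (msat v w A <-> msat v w B).
Proof. by rewrite /Iff msat_and /=; tauto. Qed.

Lemma msat_exN M v w A : @msat M v w (ExNum A) <-> exists x, msat (scons x v) w A.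
Proof.
split=> [H|[x Hx] H]; last exact: H x Hx.
by apply: contrapT => H1; apply: H => x Hx; apply: H1; exists x.
Qed.

Lemma msat_exS M v w A : @msat M v w (ExSet A) <-> exists X, msat v (scons X w) A.
Proof.
split=> [H|[x Hx] H]; last exact: H x Hx.
by apply: contrapT => H1; apply: H => x Hx; apply: H1; exists x.
Qed.

Lemma rca_of_model M : models M RCA0 -> sets M -> exists R : rca, rca_struct R = M.
Proof.
move=> HM X0; pose v0 (_ : nat) := nzero M; pose w0 (_ : nat) := X0.
(* Each axiom is fetched by its position. Its satisfaction is convertible to the wanted statement up
   to the encoding of the connectives, which [or], [and] and [ex] undo. *)
have ax n : (n < 17)%N -> msat v0 w0 (List.nth n PA_minus Bot).
  by move=> /ssrnat.ltP Hn; apply/HM/RCA0_basic/List.nth_In.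
have or P Q : ((P -> False) -> Q) -> P \/ Q by move=> H; case: (EM P); auto.
have and P Q : P -> Q -> (P -> Q -> False) -> False by auto.
have ex T (P : T -> Prop) : ((forall x, P x -> False) -> False) -> exists x, P x.
  by move=> H; apply: contrapT => H1; apply: H => x Px; apply: H1; exists x.
have addC : commutative (@nadd M) by exact: (ax 1%N isT).
have mulC : commutative (@nmul M) by exact: (ax 3%N isT).
have tot : forall x y : num M, nlt x y \/ x = y \/ nlt y x.
  move=> x y; have H : forall x y : num M, (nlt x y -> False) -> (x = y -> False) -> nlt y x.
    by exact: (ax 10%N isT).
  by apply: (or) => H1; apply: (or); apply: H.
have dsr : discrete_semiring M.
  split=> //.
  - move=> x y z; apply: esym; move: x y z.
    exact: (ax 0%N isT).
  - move=> x; rewrite addC; move: x.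
    exact: (ax 5%N isT).
  - move=> x y z; apply: esym; move: x y z.
    exact: (ax 2%N isT).
  - move=> x; rewrite mulC; move: x.
    exact: (ax 7%N isT).
  - move=> x; rewrite mulC; move: x.
    exact: (ax 6%N isT).
  - move=> x y z; rewrite mulC [nmul x z]mulC [nmul y z]mulC; move: z x y.
    exact: (ax 4%N isT).
  - move=> x y z H1 H2; have := ax 8%N isT.
    by move=> /(_ x y z); apply; apply: (and).
  - exact: (ax 9%N isT).
  - exact: (ax 11%N isT).
  - move=> x y z H1 H2; have := ax 12%N isT.
    by move=> /(_ x y z); apply; apply: (and).
  - move=> x y H; apply: (ex); move: x y H.
    exact: (ax 13%N isT).
  - exact: (ax 14%N isT).
  - move=> x H; suff [] : nlt (none M) x \/ none M = x by auto.
    apply: (or); move: x H.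
    exact: (ax 15%N isT).
  - move=> x; suff [] : nlt (nzero M) x \/ nzero M = x by auto.
    apply: (or); move: x.
    exact: (ax 16%N isT).
have [F [i [[i0 i1 iD iM] [ilt ifrac]]]] := fractions dsr.
have ile x y : i x <= i y <-> x = y \/ nlt x y.
  rewrite le_eqVlt; split=> [/orP[/eqP e|/ilt]|]; [|by right|].
    case: (tot x y) => [|[|]] ; [by right|by left|by move/ilt; rewrite e ltxx].
  by case=> [->|/ilt ->]; rewrite ?eqxx ?orbT.
have ge0 x : 0 <= i x by rewrite -i0; apply/ile; case: (dsr_ge0 dsr x); auto.
have sub x y : i x <= i y -> exists z, i z = i y - i x.
  move/ile => [->|/(dsr_sub dsr)[z <-]]; first by exists (nzero M); rewrite i0 subrr.
  by exists z; rewrite iD addrAC subrr add0r.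
have ilt' x y : nlt x y = (i x < i y) by apply/propext/ilt.
unshelve eexists (@Rca M F i X0 i0 i1 iD iM ilt' ge0 _ _ sub ifrac _ _) => //.
- move=> x y e; have /ile [] // : i x <= i y by rewrite e.
  by move/ilt; rewrite e ltxx.
- move=> x y H; have [z ez] := sub _ _ (ltW H).
  have /ilt /(dsr_ge1 dsr) H1 : i (nzero M) < i z by rewrite i0 ez subr_gt0.
  have : i (none M) <= i z by apply/ile; case: H1 => [->|]; auto.
  by rewrite i1 ez; lra.
- by move=> A v w SA; apply/HM/RCA0_induction.
- by move=> A B v w bA bB; apply/HM/RCA0_comprehension.
Qed.

Declare Scope rca_scope.
Delimit Scope rca_scope with rca.
Notation "0" := (nzero _) : rca_scope.
Notation "1" := (none _) : rca_scope.
Notation "x + y" := (nadd x y) : rca_scope.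
Notation "x * y" := (nmul x y) : rca_scope.
Notation "x < y" := (nlt x y) : rca_scope.

#[export] Hint Rewrite nltE ND NM N0 N1 : toN.
Ltac toN := autorewrite with toN in *.

(** * Closure properties of Sigma^0_1 and Delta^0_1 predicates *)

Section Definability.
Variable R : rca.
Notation D := (num R).
Notation env := (nat -> D).
Notation K := (rca_field R).
Implicit Types (x y z a b c : D) (P Q : env -> Prop) (t u : env -> D).

Lemma N_lt1 x : ~ (x < 0)%rca.
Proof. by toN => H; have := N_ge0 x; lra. Qed.

Lemma nlt_succ x y : (x < y + 1)%rca <-> (x < y)%rca \/ x = y.
Proof.
toN; split=> [H|[H|->]]; [|lra|lra].
have [H1|H1] := ltP (N x) (N y); [by left|right; apply: N_inj].
by move: H1; rewrite le_eqVlt => /orP[/eqP ->//|/N_disc]; lra.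
Qed.

Lemma zero_or_succ x : x = 0%rca \/ exists y, x = (y + 1)%rca.
Proof.
have := N_ge0 x; rewrite le_eqVlt => /orP[/eqP e|H]; [left|right].
  by apply: N_inj; rewrite N0.
have [y ey] : exists y, N y = N x - N (none R).
  by apply: N_sub; have := @N_disc _ (nzero R) x; toN => /(_ H); lra.
by exists y; apply: N_inj; toN; rewrite ey; lra.
Qed.

(* Sigma^0_1 and Delta^0_1 predicates, and functions with Sigma^0_1 graph, with
   parameters. *)
Definition S1 P : Prop := exists Q : D -> env -> Prop,
  bdd (fun v => Q (v 0%N) (tl v)) /\ forall v, P v <-> exists x, Q x v.
Definition D1 P : Prop := S1 P /\ S1 (fun v => ~ P v).
Definition DF t : Prop := S1 (fun v => t (tl v) = v 0%N).

Lemma S1_ext P Q : S1 P -> (forall v, P v <-> Q v) -> S1 Q.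
Proof. by move=> HP H; rewrite (_ : Q = P) //; apply: funext => v; apply/propext;
  rewrite H. Qed.

Lemma D1_ext P Q : D1 P -> (forall v, P v <-> Q v) -> D1 Q.
Proof. by move=> HP H; rewrite (_ : Q = P) //; apply: funext => v; apply/propext;
  rewrite H. Qed.

Lemma bdd_ren2 (Q : D -> env -> Prop) (r : nat -> nat) j :
  bdd (fun v => Q (v 0%N) (tl v)) -> bdd (fun v : env => Q (v j) (fun n => v (r n))).
Proof. move=> bQ; exact: (bdd_ren (fun n => if n is m.+1 then r m else j) bQ). Qed.

Lemma S1_bdd P : bdd P -> S1 P.
Proof.
move=> bP; exists (fun _ => P); split; first exact: (bdd_ren S bP).
by move=> v; split=> [H|[]//]; exists (nzero R).
Qed.

Lemma D1_bdd P : bdd P -> D1 P.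
Proof. by move=> bP; split; apply: S1_bdd => //; apply: bdd_not. Qed.

Lemma S1_ren P (r : nat -> nat) : S1 P -> S1 (fun v => P (fun n => v (r n))).
Proof.
move=> [Q [bQ e]]; exists (fun x v => Q x (fun n => v (r n))); split=> [|v]; last exact: e.
exact: (bdd_ren2 (fun n => (r n).+1) 0%N bQ).
Qed.

Lemma max_bound x y : exists z, (x < z)%rca /\ (y < z)%rca.
Proof.
by exists (x + y + 1)%rca; toN; have := N_ge0 x; have := N_ge0 y; lra.
Qed.

(** A common bound for the two witnesses replaces two unbounded quantifiers by one. *)
Lemma S1_and P Q : S1 P -> S1 Q -> S1 (fun v => P v /\ Q v).
Proof.
move=> [P' [bP eP]] [Q' [bQ eQ]].
exists (fun z v => (exists x, (x < z)%rca /\ P' x v) /\ (exists x, (x < z)%rca /\ Q' x v));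
  split.
  apply: bdd_and.
    by apply: (bdd_ex (Q := fun x v => P' x (tl v)));
      [exact: poly_var|apply: (bdd_ren2 (fun n => n.+2) 0%N)].
  by apply: (bdd_ex (Q := fun x v => Q' x (tl v)));
    [exact: poly_var|apply: (bdd_ren2 (fun n => n.+2) 0%N)].
move=> v; rewrite eP eQ; split=> [[[x Hx] [y Hy]]|[z [[x [_ Hx]] [y [_ Hy]]]]].
  by have [z [Hz1 Hz2]] := max_bound x y; exists z; split; [exists x|exists y].
by split; [exists x|exists y].
Qed.

Lemma S1_or P Q : S1 P -> S1 Q -> S1 (fun v => P v \/ Q v).
Proof.
move=> [P' [bP eP]] [Q' [bQ eQ]].
exists (fun z v => P' z v \/ Q' z v); split; first exact: bdd_or.
move=> v; rewrite eP eQ; split=> [[[x Hx]|[x Hx]]|[x [Hx|Hx]]].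
- by exists x; left.
- by exists x; right.
- by left; exists x.
- by right; exists x.
Qed.

Lemma S1_ex (Q : D -> env -> Prop) :
  S1 (fun v => Q (v 0%N) (tl v)) -> S1 (fun v => exists x, Q x v).
Proof.
move=> [Q' [bQ eQ]].
exists (fun z v => exists x, (x < z)%rca /\ exists y, (y < z)%rca /\ Q' y (scons x v)); split.
  apply: (bdd_ex (Q := fun x v => exists y, (y < v 0%N)%rca /\ Q' y (scons x (tl v))));
    first exact: poly_var.
  apply: (bdd_ex (Q := fun y v => Q' y (scons (v 0%N) (tl (tl v))))); first exact: poly_var.
  rewrite (_ : (fun v => _) = fun v :
    env => Q' (v 0%N) (fun n => v (if n is m.+1 then m.+3 else 1%N))).
    exact: (bdd_ren2 _ 0%N bQ).
  by apply: funext => v; congr Q'; apply: funext => -[].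
move=> v; split=> [[x Hx]|[z [x [_ [y [_ Hy]]]]]].
  have /(eQ (scons x v)) [y Hy] : Q (scons x v 0%N) (tl (scons x v)) by [].
  by have [z [H1 H2]] := max_bound x y; exists z, x; split=> //; exists y.
by exists x; have /(eQ (scons x v)) : exists y, Q' y (scons x v) by exists y.
Qed.

Lemma S1_form (P : D -> Prop) : S1 (fun v => P (v 0%N)) ->
  exists A v w, bounded A /\ forall x, P x <-> exists y, msat (scons y (scons x v)) w A.
Proof.
move=> [Q [/(bdd_form (some_set R)) [A [sg [w [bA eA]]]] eQ]].
pose rn n := match sg n with inl 0%N => Var 0 | inl 1%N => Var 1 | _ => Var n.+2 end.
pose v0 : env := fun n => match sg n with inr c => c | inl _ => nzero R end.
exists (fsubst rn id A), v0, w; split; first exact: bounded_fsubst.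
move=> x; have -> : P x = P (scons x (fun=> nzero R) 0%N) by [].
rewrite eQ.
have e y : Q y (scons x (fun=> nzero R)) <-> msat (scons y (scons x v0)) w (fsubst rn id A).
  have /= -> := eA (scons y (scons x (fun=> nzero R))); rewrite msat_fsubst.
  rewrite (_ : look sg _ = fun n => teval (scons y (scons x v0)) (rn n)) //.
  apply: funext => n; rewrite /look /rn.
  by case e: (sg n) => [[|[|j]]|c] //=; rewrite /v0 e.
by split=> -[y /e Hy]; exists y.
Qed.

Lemma ind_S1 (P : D -> Prop) : S1 (fun v => P (v 0%N)) ->
  P 0%rca -> (forall x, P x -> P (x + 1)%rca) -> forall x, P x.
Proof.
move=> /S1_form [A [v [w [bA eA]]]] P0 PS x.
have := @rca_ind R (ExNum A) v w (Sigma01_ex A bA).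
have eP y : P y <-> msat (scons y v) w (ExNum A) by rewrite msat_exN eA.
move: (ExNum A) eP => B {}eP /= H.
apply/eP; apply: H => H; apply: H => [|y]; rewrite msat_fsubst.
  rewrite (_ : (fun n => teval _ _) = scons (nzero R) v); last by apply: funext => -[].
  exact/eP.
rewrite (_ : (fun n => teval _ _) = scons (y + 1)%rca v); last by apply: funext => -[].
by move=> /eP/PS/eP.
Qed.

(** This is Sigma^0_1 collection: induction on [b] gives a common bound [z] for the witnesses of all
    [x < b], and [z] becomes the only unbounded quantifier. *)
Lemma S1_ball_poly t (Q : D -> env -> Prop) : poly t ->
  S1 (fun v => Q (v 0%N) (tl v)) -> S1 (fun v => forall x, (x < t v)%rca -> Q x v).
Proof.
move=> pt [Q' [bQ eQ]].
exists (fun z v => forall x, (x < t v)%rca -> exists y, (y < z)%rca /\ Q' y (scons x v)); split.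
  apply: (bdd_all (t := fun v => t (tl v)) (Q := fun x v => exists y, (y < v 0%N)%rca /\
    Q' y (scons x (tl v)))).
    exact: (poly_ren S pt).
  apply: (bdd_ex (Q := fun y v => Q' y (scons (v 0%N) (tl (tl v))))); first exact: poly_var.
  rewrite (_ : (fun v => _) = fun v :
    env => Q' (v 0%N) (fun n => v (if n is m.+1 then m.+3 else 1%N))).
    exact: (bdd_ren2 _ 0%N bQ).
  by apply: funext => v; congr Q'; apply: funext => -[].
move=> v; split=> [H|[z H] x /H [y [_ Hy]]]; last first.
  by have /(eQ (scons x v)) : exists y, Q' y (scons x v) by exists y.
suff [z Hz] : exists z, forall x, (x < t v)%rca -> (x < t v)%rca ->
  exists y, (y < z)%rca /\ Q' y (scons x v).
  by exists z => x Hx; apply: Hz.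
apply: (@ind_S1 (fun b => exists z, forall x, (x < b)%rca -> (x < t v)%rca ->
  exists y, (y < z)%rca /\ Q' y (scons x v))).
- exists (fun z e => forall x, (x < e 0%N)%rca -> (x < t v)%rca ->
    exists y, (y < z)%rca /\ Q' y (scons x v)).
  split=> //.
  apply: (bdd_all (Q := fun x e => (x < t v)%rca ->
    exists y, (y < e 0%N)%rca /\ Q' y (scons x v))).
    exact: (poly_var 1).
  apply: bdd_imp; first exact: (bdd_lt (poly_var 0) (poly_const _)).
  apply: (bdd_ex (Q := fun y e => Q' y (scons (e 0%N) v))); first exact: (poly_var 1).
  rewrite (_ : (fun e => _) = fun e :
    env => Q' (e 0%N) (fun n => if n is m.+1 then v m else e 1%N)).
    apply: (bdd_subst bQ (s := fun n e => match n with 0 => e 0 | 1 => e 1 | m.+2 => v m end)).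
    by case=> [|[|n]]; constructor.
  by apply: funext => e; congr Q'; apply: funext => -[].
- by exists 0%rca => x /N_lt1.
- move=> b [z Hz].
  case: (EM (b < t v)%rca) => [Hb|Hb]; last first.
    by exists z => x /nlt_succ [|->] //; apply: Hz.
  have /(eQ (scons b v)) [y0 Hy0] : Q (scons b v 0%N) (tl (scons b v)) by apply: H.
  exists (z + y0 + 1)%rca => x /nlt_succ [Hx|->] Hxt; last first.
    by exists y0; split=> //; toN; have := N_ge0 z; lra.
  have [y [Hy1 Hy2]] := Hz x Hx Hxt; exists y; split=> //.
  by toN; have := N_ge0 y0; lra.
Qed.

Lemma DF_poly t : poly t -> DF t.
Proof.
move=> pt; apply: S1_bdd; apply: bdd_eq; last exact: poly_var.
exact: (poly_ren S pt).
Qed.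

(** The value of [t] is quantified existentially through its graph. Applied to the complement as
    well, this preserves Delta^0_1 predicates. *)
Lemma S1_sub t (Q : D -> env -> Prop) :
  DF t -> S1 (fun v => Q (v 0%N) (tl v)) -> S1 (fun v => Q (t v) v).
Proof.
move=> dt SQ; apply: (@S1_ext (fun v => exists x, t v = x /\ Q x v)).
  by apply: (@S1_ex (fun x v => t v = x /\ Q x v)); apply: S1_and.
by move=> v; split=> [[x [-> ]]|H] //; exists (t v).
Qed.

Lemma D1_sub t (Q : D -> env -> Prop) :
  DF t -> D1 (fun v => Q (v 0%N) (tl v)) -> D1 (fun v => Q (t v) v).
Proof.
move=> dt [SQ SNQ]; split; first exact: S1_sub.
exact: (@S1_sub t (fun x v => ~ Q x v)).
Qed.

Lemma DF_ren t (r : nat -> nat) : DF t -> DF (fun v => t (fun n => v (r n))).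
Proof. exact: (@S1_ren _ (fun n => if n is m.+1 then (r m).+1 else 0%N)). Qed.

Lemma DF_sub t (f : D -> env -> D) :
  DF t -> DF (fun v => f (v 0%N) (tl v)) -> DF (fun v => f (t v) v).
Proof.
move=> dt df; apply: (@S1_sub (fun v => t (tl v)) (fun x v => f x (tl v) = v 0%N)).
  exact: (DF_ren S dt).
exact: (@S1_ren _ (fun n => match n with 0 => 1 | 1 => 0 | m.+2 => m.+2 end) df).
Qed.

Lemma D1_not P : D1 P -> D1 (fun v => ~ P v).
Proof. by move=> [H1 H2]; split=> //; apply: (S1_ext H1) => v; split;
  [auto|apply: contrapT]. Qed.

Lemma D1_and P Q : D1 P -> D1 Q -> D1 (fun v => P v /\ Q v).
Proof.
move=> [H1 H2] [H3 H4]; split; first exact: S1_and.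
apply: (S1_ext (S1_or H2 H4)) => v; split; first tauto.
by case: (EM (P v)); tauto.
Qed.

Lemma D1_or P Q : D1 P -> D1 Q -> D1 (fun v => P v \/ Q v).
Proof.
move=> dP dQ; apply: (D1_ext (D1_not (D1_and (D1_not dP) (D1_not dQ)))) => v.
by case: (EM (P v)); case: (EM (Q v)); tauto.
Qed.

Lemma D1_imp P Q : D1 P -> D1 Q -> D1 (fun v => P v -> Q v).
Proof.
move=> dP dQ; apply: (D1_ext (D1_or (D1_not dP) dQ)) => v.
by case: (EM (P v)); tauto.
Qed.

Lemma S1_ball t (Q : D -> env -> Prop) : DF t ->
  S1 (fun v => Q (v 0%N) (tl v)) -> S1 (fun v => forall x, (x < t v)%rca -> Q x v).
Proof.
move=> dt SQ; apply: (@S1_sub t (fun b v => forall x, (x < b)%rca -> Q x v)) => //.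
apply: (@S1_ball_poly (fun v => v 0%N) (fun x v => Q x (tl v))); first exact: poly_var.
exact: (@S1_ren _ (fun n => if n is m.+1 then m.+2 else 0%N) SQ).
Qed.

Lemma S1_bex t (Q : D -> env -> Prop) : DF t ->
  S1 (fun v => Q (v 0%N) (tl v)) -> S1 (fun v => exists x, (x < t v)%rca /\ Q x v).
Proof.
move=> dt SQ; apply: (@S1_ex (fun x v => (x < t v)%rca /\ Q x v)); apply: S1_and => //.
apply: (@S1_sub (fun v => t (tl v)) (fun y v => (v 0%N < y)%rca)); first exact: (DF_ren S dt).
by apply: S1_bdd; apply: bdd_lt; [exact: (poly_var 1)|exact: (poly_var 0)].
Qed.

Lemma D1_ball t (Q : D -> env -> Prop) : DF t ->
  D1 (fun v => Q (v 0%N) (tl v)) -> D1 (fun v => forall x, (x < t v)%rca -> Q x v).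
Proof.
move=> dt [S1Q S2Q]; split; first exact: S1_ball.
apply: (S1_ext (@S1_bex t (fun x v => ~ Q x v) dt S2Q)) => v.
split=> [[x [Hx nQ]] H|H]; first exact/nQ/H.
by apply: contrapT => H1; apply: H => x Hx; apply: contrapT => nQ; apply: H1; exists x.
Qed.

Lemma D1_bex t (Q : D -> env -> Prop) : DF t ->
  D1 (fun v => Q (v 0%N) (tl v)) -> D1 (fun v => exists x, (x < t v)%rca /\ Q x v).
Proof.
move=> dt dQ; apply: (D1_ext (D1_not (@D1_ball t (fun x v => ~ Q x v) dt (D1_not dQ)))) => v.
split=> [H|[x [xt Qx]] H]; last exact: H xt Qx.
by apply: contrapT => H1; apply: H => x xt Qx; apply: H1; exists x.
Qed.

Lemma D1_eq t u : DF t -> DF u -> D1 (fun v => t v = u v).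
Proof.
move=> dt du; apply: (@D1_sub t (fun x v => x = u v)) => //.
apply: (@D1_sub (fun v => u (tl v)) (fun y v => v 0%N = y)); first exact: (DF_ren S du).
by apply: D1_bdd; apply: bdd_eq; [exact: (poly_var 1)|exact: (poly_var 0)].
Qed.

Lemma D1_lt t u : DF t -> DF u -> D1 (fun v => (t v < u v)%rca).
Proof.
move=> dt du; apply: (@D1_sub t (fun x v => (x < u v)%rca)) => //.
apply: (@D1_sub (fun v => u (tl v)) (fun y v => (v 0%N < y)%rca)); first exact: (DF_ren S du).
by apply: D1_bdd; apply: bdd_lt; [exact: (poly_var 1)|exact: (poly_var 0)].
Qed.

Lemma D1_mem t X : DF t -> D1 (fun v => smem (t v) X).
Proof.
move=> dt; apply: (@D1_sub t (fun x v => smem x X)) => //.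
by apply/D1_bdd/bdd_mem/poly_var.
Qed.

Lemma D1_const (A : Prop) : D1 (fun _ => A).
Proof.
case: (EM A) => H; last by apply: (D1_ext (D1_bdd bdd_bot)) => v; tauto.
by apply: (D1_ext (D1_not (D1_bdd bdd_bot))) => v; tauto.
Qed.

Lemma DF_var j : DF (fun v => v j).
Proof. exact/DF_poly/poly_var. Qed.

Lemma DF_const c : DF (fun _ => c).
Proof. exact/DF_poly/poly_const. Qed.

Lemma DF_add t u : DF t -> DF u -> DF (fun v => t v + u v)%rca.
Proof.
move=> dt du; apply: (@DF_sub t (fun x v => x + u v)%rca) => //.
apply: (@DF_sub (fun v => u (tl v)) (fun x v => v 0%N + x)%rca); first exact: (DF_ren S du).
by apply: DF_poly; apply: poly_add; [exact: (poly_var 1)|exact: (poly_var 0)].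
Qed.

Lemma DF_mul t u : DF t -> DF u -> DF (fun v => t v * u v)%rca.
Proof.
move=> dt du; apply: (@DF_sub t (fun x v => x * u v)%rca) => //.
apply: (@DF_sub (fun v => u (tl v)) (fun x v => v 0%N * x)%rca); first exact: (DF_ren S du).
by apply: DF_poly; apply: poly_mul; [exact: (poly_var 1)|exact: (poly_var 0)].
Qed.

Definition def1 (f : D -> D) := DF (fun v => f (v 0%N)).
Definition def2 (f : D -> D -> D) := DF (fun v => f (v 0%N) (v 1%N)).

Lemma DF_app1 f t : def1 f -> DF t -> DF (fun v => f (t v)).
Proof.
by move=> df dt; apply: (@DF_sub t (fun x v => f x)).
Qed.

Lemma DF_app2 f t u : def2 f -> DF t -> DF u -> DF (fun v => f (t v) (u v)).
Proof.
move=> df dt du; apply: (@DF_sub t (fun x v => f x (u v))) => //.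
apply: (@DF_sub (fun v => u (tl v)) (fun x v => f (v 0%N) x)); first exact: (DF_ren S du).
exact: (DF_ren (fun n => if n is 0 then 1 else 0)%N df).
Qed.

Lemma S1_D1 P : D1 P -> S1 P. Proof. by case. Qed.

Lemma DF_if P t u : D1 P -> DF t -> DF u -> DF (fun v => if `[< P v >] then t v else u v).
Proof.
move=> [p1 p2] dt du.
apply: (@S1_ext (fun v => (P (tl v) /\ t (tl v) = v 0%N) \/ (~ P (tl v) /\ u (tl v) = v 0%N))).
  by apply: S1_or; apply: S1_and => //; [exact: (S1_ren S p1)|exact: (S1_ren S p2)].
by move=> v; case: asboolP; tauto.
Qed.

(** The comprehension axiom wants a Pi^0_1 form of [P], which is the negated matrix for the
    complement; the parameters of both forms are interleaved. *)
Lemma comprehend (P : D -> Prop) : D1 (fun v => P (v 0%N)) ->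
  exists X, forall x, smem x X <-> P x.
Proof.
move=> [/S1_form [A [v [w [bA eA]]]] /(@S1_form (fun x => ~ P x)) [B [v' [w' [bB eB]]]]].
pose evn := fun n => Var n.*2.
pose odn := fun n => Var n.*2.+1.
pose lft (r : nat -> nat) n := match n with 0 => Var 0 | 1 => Var 1 | m.+2 => Var (r m).+2 end.
pose A' := fsubst (lft double) double A.
pose B' := Not (fsubst (lft (fun n => n.*2.+1)) (fun n => n.*2.+1) B).
have eA' x y : msat (scons y (scons x (join v v'))) (join w w') A' <->
  msat (scons y (scons x v)) w A.
  rewrite /A' msat_fsubst (_ : (fun n => join w w' n.*2) = w); last by apply: funext => n;
    rewrite join_double.
  rewrite (_ : (fun n => teval _ _) = scons y (scons x v)) //.
  by apply: funext => -[|[|n]] //=; rewrite join_double.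
have eB' x y : msat (scons y (scons x (join v v'))) (join w w') B' <->
  ~ msat (scons y (scons x v')) w' B.
  rewrite /B' /= msat_fsubst (_ : (fun n => join w w' n.*2.+1) = w');
    last by apply: funext => n; rewrite join_doubleS.
  rewrite (_ : (fun n => teval _ _) = scons y (scons x v')) //.
  by apply: funext => -[|[|n]] //=; rewrite join_doubleS.
have eBP x : (forall y, msat (scons y (scons x (join v v'))) (join w w') B') <-> P x.
  split=> [H|H y]; first by apply: contrapT => /eB [y Hy]; have /eB' := H y.
  by apply/eB' => Hy; have /eB : exists y, msat (scons y (scons x v')) w' B by exists y.
have /msat_exS [X HX] : msat (join v v') (join w w')
    (ExSet (AllNum (Iff (Mem (Var 0) 0) (AllNum (liftS B'))))).
  apply: (@rca_comp R A' B'); first exact: bounded_fsubst.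
    by constructor; [exact: bounded_fsubst|constructor].
  move=> x; apply: (proj2 (msat_iff _ _ (ExNum A') (AllNum B'))); rewrite msat_exN /=;
    apply: iff_trans (iff_sym (eBP x)).
  by rewrite eA; split=> -[y /eA' Hy]; exists y.
exists X => x; have /(msat_iff _ _ (Mem (Var 0) 0) (AllNum (liftS B'))) H := HX x.
apply: iff_trans H (iff_trans _ (eBP x)).
have e y : msat (scons y (scons x (join v v'))) (scons X (join w w')) (liftS B') <->
  msat (scons y (scons x (join v v'))) (join w w') B' by rewrite /liftS msat_fsubst.
by split=> H y; apply/(e y)/H.
Qed.

End Definability.

(** * Substitution into definable predicates, and the tactic for definability *)

Section Application.
Variable R : rca.
Notation D := (num R).
Notation env := (nat -> D).
Notation K := (rca_field R).
Implicit Types (x y z a b c : D).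

Definition defP1 (P : D -> Prop) := D1 (fun v => P (v 0%N)).
Definition defP2 (P : D -> D -> Prop) := D1 (fun v => P (v 0%N) (v 1%N)).
Definition defP3 (P : D -> D -> D -> Prop) := D1 (fun v => P (v 0%N) (v 1%N) (v 2%N)).

Lemma D1_ren (P : env -> Prop) (r : nat -> nat) : D1 P -> D1 (fun v => P (fun n => v (r n))).
Proof. by move=> [H1 H2]; split; [exact: (S1_ren r H1)|exact: (S1_ren r H2)]. Qed.

Lemma D1_app1 P (t : env -> D) : defP1 P -> DF t -> D1 (fun v => P (t v)).
Proof. by move=> dP dt; apply: (@D1_sub R t (fun x v => P x)). Qed.

Lemma D1_app2 P (t u : env -> D) : defP2 P -> DF t -> DF u -> D1 (fun v => P (t v) (u v)).
Proof.
move=> dP dt du; apply: (@D1_sub R t (fun x v => P x (u v))) => //.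
apply: (@D1_sub R (fun v => u (tl v)) (fun x v => P (v 0%N) x)); first exact: (DF_ren S du).
exact: (D1_ren (fun n => if n is 0 then 1 else 0)%N dP).
Qed.

Lemma D1_app3 P (t u w : env -> D) : defP3 P -> DF t -> DF u -> DF w ->
  D1 (fun v => P (t v) (u v) (w v)).
Proof.
move=> dP dt du dw; apply: (@D1_sub R t (fun x v => P x (u v) (w v))) => //.
apply: (@D1_sub R (fun v => u (tl v)) (fun x v => P (v 0%N) x (w (tl v)))).
  exact: (DF_ren S du).
apply: (@D1_sub R (fun v => w (tl (tl v))) (fun x v => P (v 1%N) (v 0%N) x)).
  exact: (DF_ren (fun n => n.+2) dw).
exact: (D1_ren (fun n => match n with 0 => 2 | 1 => 1 | _ => 0 end)%N dP).
Qed.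

End Application.

Ltac dfn_hint := solve [assumption | auto with dfn].

(** Bounded quantifiers are recognized only in the literal forms [forall x, x < t -> _] and
    [exists x, x < t /\ _], which dictates how the predicates below are written. *)
Ltac dfn1 :=
  cbv beta delta [tl]; first [assumption |
  match goal with
  | |- D1 (fun _ => ?A) => apply: D1_const
  | |- D1 (fun v => forall x, nlt x _ -> _) => apply: D1_ball
  | |- D1 (fun v => exists x, nlt x _ /\ _) => apply: D1_bex
  | |- D1 (fun v => _ /\ _) => apply: D1_and
  | |- D1 (fun v => _ \/ _) => apply: D1_or
  | |- D1 (fun v => ~ _) => apply: D1_not
  | |- D1 (fun v => nlt _ _) => apply: D1_lt
  | |- D1 (fun v => smem _ _) => apply: D1_mem
  | |- D1 (fun v => @eq (num _) _ _) => apply: D1_eq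
  | |- D1 (fun v => ?A -> ?B) => apply: D1_imp
  | |- D1 (fun v => ?f (@?t v) (@?u v) (@?w v)) => apply: (@D1_app3 _ f t u w); [dfn_hint | | |]
  | |- D1 (fun v => ?f (@?t v) (@?u v)) => apply: (@D1_app2 _ f t u); [dfn_hint | |]
  | |- D1 (fun v => ?f (@?t v)) => apply: (@D1_app1 _ f t); [dfn_hint |]
  | |- S1 (fun v => exists x, nlt x _ /\ _) => apply: S1_bex
  | |- S1 (fun v => exists x, _) => apply: S1_ex
  | |- S1 (fun v => forall x, nlt x _ -> _) => apply: S1_ball
  | |- S1 (fun v => _ /\ _) => apply: S1_and
  | |- S1 (fun v => _ \/ _) => apply: S1_or
  | |- S1 _ => apply: S1_D1
  | |- DF (fun _ => ?c) => apply: DF_const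
  | |- DF (fun v => v _) => apply: DF_var
  | |- DF (fun v => nadd _ _) => apply: DF_add
  | |- DF (fun v => nmul _ _) => apply: DF_mul
  | |- DF (fun v => if asbool _ then _ else _) => apply: DF_if
  | |- DF (fun v => ?f (@?t v) (@?u v)) => apply: (@DF_app2 _ f t u); [dfn_hint | |]
  | |- DF (fun v => ?f (@?t v)) => apply: (@DF_app1 _ f t); [dfn_hint |]
  end].
Ltac dfn := rewrite /def1 /def2 /defP1 /defP2 /defP3 /=; repeat dfn1.


(** * Pairing, coding of finite sets and primitive recursion *)

Section Recursion.
Variable R : rca.
Notation D := (num R).
Notation env := (nat -> D).
Notation K := (rca_field R).
Implicit Types (x y z a b c : D).

Lemma ind_D1 (P : D -> Prop) : defP1 P -> P 0%rca ->
  (forall x, P x -> P (x + 1)%rca) -> forall x, P x.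
Proof. by case=> H _; apply: ind_S1. Qed.

Lemma ltS x y : (x < y + 1)%rca <-> N x <= N y.
Proof.
rewrite nlt_succ nltE le_eqVlt; split=> [[->|->]|/orP[/eqP/N_inj|]]; rewrite ?eqxx ?orbT; auto.
Qed.

Lemma least_D1 (P : D -> Prop) : defP1 P -> (exists x, P x) ->
  exists x, P x /\ forall y, (y < x)%rca -> ~ P y.
Proof.
move=> dP [x Px]; apply: contrapT => H.
suff H1 : forall z y, (y < z)%rca -> ~ P y.
  by apply: (H1 (x + 1)%rca x) => //; apply/nlt_succ; right.
apply: ind_D1 => [|y /N_lt1//|z IH y /nlt_succ[/IH//|-> Pz]].
  by dfn.
by apply: H; exists z.
Qed.

Lemma make_function (P : D -> D -> Prop) : S1 (fun v => P (v 0%N) (v 1%N)) ->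
  (forall x, exists y, P x y) -> (forall x y z, P x y -> P x z -> y = z) ->
  exists f : D -> D, def1 f /\ forall x, P x (f x).
Proof.
move=> dP ex uniq; exists (fun x => projT1 (cid (ex x))); split; last by move=> x; case: cid.
apply: (@S1_ext _ (fun v => P (v 1%N) (v 0%N))).
  exact: (S1_ren (fun n => if n is 0 then 1 else 0)%N dP).
move=> v; case: cid => y /= Hy; rewrite /tl in Hy.
by split=> [H|<-//]; apply: uniq Hy H.
Qed.

Definition pair x y : D := ((x + y) * (x + y) + x)%rca.

(** The code lies in the interval from [(x + y)^2] to below [(x + y + 1)^2], so it determines first
    the sum and then [x]. *)
Lemma pair_inj x y a b : pair x y = pair a b -> x = a /\ y = b.
Proof.
move=> /(congr1 (@N R)); rewrite /pair; toN => e.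
have [[[hx hy] ha] hb] := (N_ge0 x, N_ge0 y, N_ge0 a, N_ge0 b).
have [H|H|H] := ltgtP (N x + N y) (N a + N b).
- have : N (x + y)%rca + 1 <= N (a + b)%rca by apply: N_disc; toN.
  by toN => {}H; exfalso; nra.
- have : N (a + b)%rca + 1 <= N (x + y)%rca by apply: N_disc; toN.
  by toN => {}H; exfalso; nra.
- by rewrite H in e; split; apply: N_inj; lra.
Qed.

Lemma pair_ge1 x y : (x < pair x y + 1)%rca.
Proof. by rewrite /pair; toN; have := N_ge0 x; have := N_ge0 y; nra. Qed.

Lemma pair_ge2 x y : (y < pair x y + 1)%rca.
Proof.
rewrite /pair; toN; have := N_ge0 x; have := N_ge0 y => H1 H2.
have [->|[z ->]] := zero_or_succ y; toN; first by nra.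
by have := N_ge0 z; nra.
Qed.

Lemma def_pair : def2 pair.
Proof. by rewrite /pair; dfn. Qed.
Hint Resolve def_pair : dfn.

Lemma unpairing : exists fg : (D -> D) * (D -> D), [/\ def1 fg.1, def1 fg.2,
  forall x y, fg.1 (pair x y) = x /\ fg.2 (pair x y) = y &
  forall z, (fg.1 z < z + 1)%rca /\ (fg.2 z < z + 1)%rca].
Proof.
(* Not every number is a pair; the default 0 makes the projections total and keeps them below their
   argument. *)
pose P z x := (exists y, (y < z + 1)%rca /\ z = pair x y) \/
  (x = 0%rca /\ forall x', (x' < z + 1)%rca -> forall y, (y < z + 1)%rca -> z <> pair x' y).
pose Q z y := (exists x, (x < z + 1)%rca /\ z = pair x y) \/
  (y = 0%rca /\ forall x, (x < z + 1)%rca -> forall y', (y' < z + 1)%rca -> z <> pair x y').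
have pairP z : (exists x y, z = pair x y) \/ forall x y, z <> pair x y.
  case: (EM (exists x y, z = pair x y)) => [|H]; [by left|right=> x y e].
  by apply: H; exists x, y.
have [|||f [df fP]] := @make_function P.
- by rewrite /P; dfn.
- move=> z; have [[x [y ->]]|H] := pairP z; last by exists 0%rca; right; split=> // *; apply: H.
  by exists x; left; exists y; split=> //; apply: pair_ge2.
- move=> z x x' [[y [_ ->]]|[-> H]] [[y' [_ e]]|[-> H']] //.
  + by case: (pair_inj e).
  + by case: (H' x (pair_ge1 _ _) y (pair_ge2 _ _)).
  + by rewrite e in H; case: (H x' (pair_ge1 _ _) y' (pair_ge2 _ _)).
have [|||g [dg gQ]] := @make_function Q.
- by rewrite /Q; dfn.
- move=> z; have [[x [y ->]]|H] := pairP z; last by exists 0%rca; right; split=> // *; apply: H.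
  by exists y; left; exists x; split=> //; apply: pair_ge1.
- move=> z y y' [[x [_ ->]]|[-> H]] [[x' [_ e]]|[-> H']] //.
  + by case: (pair_inj e).
  + by case: (H' x (pair_ge1 _ _) y (pair_ge2 _ _)).
  + by rewrite e in H; case: (H x' (pair_ge1 _ _) y' (pair_ge2 _ _)).
have lt0 z : (0 < z + 1)%rca by toN; have := N_ge0 z; lra.
exists (f, g); split=> //= [x y|z]; split.
- case: (fP (pair x y)) => [[z [_ /pair_inj[]]]//|[_ H]].
  by case: (H x (pair_ge1 _ _) y (pair_ge2 _ _)).
- case: (gQ (pair x y)) => [[z [_ /pair_inj[]]]//|[_ H]].
  by case: (H x (pair_ge1 _ _) y (pair_ge2 _ _)).
- by case: (fP z) => [[y [_ e]]|[-> _] //]; rewrite {2}e; apply: pair_ge1.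
- by case: (gQ z) => [[x [_ e]]|[-> _] //]; rewrite {2}e; apply: pair_ge2.
Qed.

Definition p1 : D -> D := (projT1 (cid unpairing)).1.
Definition p2 : D -> D := (projT1 (cid unpairing)).2.

Lemma p1_pair x y : p1 (pair x y) = x.
Proof. by rewrite /p1; case: cid => fg /= [_ _ /(_ x y)[]]. Qed.

Lemma p2_pair x y : p2 (pair x y) = y.
Proof. by rewrite /p2; case: cid => fg /= [_ _ /(_ x y)[]]. Qed.

Lemma p1_le z : N (p1 z) <= N z.
Proof. by apply/ltS; rewrite /p1; case: cid => fg /= [_ _ _ /(_ z)[]]. Qed.

Lemma p2_le z : N (p2 z) <= N z.
Proof. by apply/ltS; rewrite /p2; case: cid => fg /= [_ _ _ /(_ z)[]]. Qed.

Lemma def_p1 : def1 p1.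
Proof. by rewrite /p1; case: cid => fg /= []. Qed.

Lemma def_p2 : def1 p2.
Proof. by rewrite /p2; case: cid => fg /= []. Qed.

(* As for Goedel's beta function, [x] is a member of the finite set coded by [a]
   and [b] if [1 + (x + 1) b] divides [a]. *)
Definition incode a b x : Prop :=
  exists q, (q < a + 1)%rca /\ a = (q * ((x + 1) * b + 1))%rca.

Lemma def_incode : defP3 incode.
Proof. by rewrite /incode; dfn. Qed.

Lemma incodeP a b x : incode a b x <-> exists q, a = (q * ((x + 1) * b + 1))%rca.
Proof.
split=> [[q [_ ?]]|[q e]]; exists q => //; split=> //; rewrite {1}e.
suff : 0 <= N (q * ((x + 1) * b))%rca by toN; lra.
exact: N_ge0.
Qed.

Hint Resolve def_p1 def_p2 def_incode : dfn.

(* With P = 1 + (x+1)b, Q = 1 + (y+1)b and b = c(x-y), one has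
   1 = (1 - c(x+1)(y+1)) Q + c(y+1)^2 P. *)
Lemma incode_mul a b x y : x <> y ->
  (exists c, N b = N c * (N x - N y) \/ N b = - N c * (N x - N y)) ->
  (incode (a * ((y + 1) * b + 1))%rca b x <-> incode a b x).
Proof.
move=> xy [c Hc]; split=> /incodeP[q e]; apply/incodeP; last first.
  by exists (q * ((y + 1) * b + 1))%rca; apply: N_inj; rewrite e; toN; ring.
have {}e := congr1 (@N R) e; toN.
have [hx hy ha hb] : [/\ 0 <= N x, 0 <= N y, 0 <= N a & 0 <= N b] by split; apply: N_ge0.
pose P := (N x + 1) * N b + 1.
have P0 : 0 < P by rewrite /P; nra.
suff [u [w H]] : exists u w : D, N a = (N u - N w) * P.
  have [z Hz] : exists z, N z = N u - N w by apply: N_sub; nra.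
  by exists z; apply: N_inj; toN; rewrite Hz.
case: Hc => Hc.
  exists (q + a * c * (y + 1) * (y + 1))%rca, (q * c * (x + 1) * (y + 1))%rca; toN.
  transitivity (N a * ((N y + 1) * N b + 1) * (1 - N c * (N x + 1) * (N y + 1)) + N a * N c *
    (N y + 1) ^+ 2 * P).
    by rewrite /P Hc; ring.
  by rewrite e -/P; ring.
exists (q + q * c * (x + 1) * (y + 1))%rca, (a * c * (y + 1) * (y + 1))%rca; toN.
transitivity (N a * ((N y + 1) * N b + 1) * (1 + N c * (N x + 1) * (N y + 1)) - N a * N c *
  (N y + 1) ^+ 2 * P).
  by rewrite /P Hc; ring.
by rewrite e -/P; ring.
Qed.

Lemma common_multiple n : exists b, (0 < b)%rca /\
  forall x, (x < n)%rca -> exists c, (c < b + 1)%rca /\ b = (c * (x + 1))%rca.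
Proof.
move: n; apply: ind_S1; first by dfn.
  by exists 1%rca; split=> [|x /N_lt1//]; toN.
move=> n [b [b0 Hb]]; exists (b * (n + 1))%rca; split.
  by toN; have := N_ge0 n; nra.
move=> x /nlt_succ[/Hb[c [Hc e]]|->].
  exists (c * (n + 1))%rca; split; last by apply: N_inj; rewrite e; toN; ring.
  by move/ltS: Hc => Hc; apply/ltS; toN; have := N_ge0 n; nra.
by exists b; split=> //; apply/ltS; toN; have := N_ge0 n; have := N_ge0 b; nra.
Qed.

(** Induction on [m] codes the part of [X] below [m]: multiplying [a] by the modulus of [m] adds [m]
    and, by [incode_mul], nothing else below [n]. *)
Lemma code_exists X n : exists a b, forall x, (x < n)%rca -> (incode a b x <-> smem x X).
Proof.
have [b [b0 Hb]] := common_multiple n.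
suff H : forall m, exists a, forall x, (x < n)%rca -> (incode a b x <->
  (x < m)%rca /\ smem x X).
  have [a Ha] := H n; exists a, b => x Hx; rewrite Ha //; tauto.
apply: ind_S1.
  apply: (@S1_ext _ (fun v => exists a, forall x, (x < n)%rca ->
    (incode a b x -> (x < v 0%N)%rca /\ smem x X) /\ ((x < v 0%N)%rca /\ smem x X ->
      incode a b x))).
    by dfn.
  by move=> v; split=> -[a Ha]; exists a => x /Ha; tauto.
  (* The code 1 stands for the empty set because every modulus exceeds 1. *)
  exists 1%rca => x Hx; split=> [/incodeP[q]|[/N_lt1//]].
  move/(congr1 (@N R)); toN => e; have := N_ge0 x; have := N_ge0 q => h1 h2.
  have [q0|[q' q1]] := zero_or_succ q; first by rewrite q0 in e; toN; lra.
  rewrite q1 in e; toN; exfalso.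
  have w0 : 0 < (N x + 1) * N b by apply: mulr_gt0 => //; lra.
  by have := N_ge0 q'; nra.
move=> m [a Ha].
have [mX|mX] := EM ((m < n)%rca /\ smem m X); last first.
  exists a => x Hx; rewrite Ha // nlt_succ; split=> [[]|[[|e]]]; try tauto.
  by rewrite e in Hx *; tauto.
exists (a * ((m + 1) * b + 1))%rca => x Hx.
case: (EM (x = m)) => [->|xm].
  split=> [_|_]; first by split; [apply/nlt_succ; right|tauto].
  by apply/incodeP; exists a.
rewrite incode_mul //; first by rewrite Ha // nlt_succ; tauto.
have [z [zn zx]] : exists z, (z < n)%rca /\ (N x - N m = N z + 1 \/ N x - N m = - (N z + 1)).
  have [H|H|H] := ltgtP (N x) (N m); last by case: xm; apply: N_inj.
  - have [z Hz] : exists z, N z = N m - N (x + 1)%rca by apply: N_sub; toN; apply: N_disc.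
    by exists z; toN; case: mX => mn _; have := N_ge0 x; toN; split; [lra|right; lra].
  - have [z Hz] : exists z, N z = N x - N (m + 1)%rca by apply: N_sub; toN; apply: N_disc.
    by exists z; toN; have := N_ge0 m; toN; split; [lra|left; lra].
have [c [_ e]] := Hb z zn; exists c; rewrite e; toN.
by case: zx => ->; [left|right]; ring.
Qed.

Section PrimitiveRecursion.
Variables (a0 : D) (g : D -> D -> D).
Hypothesis def_g : def2 g.

(* [(a, b, l)] codes a finite set of pairs every member of which, other than
   [(0, a0)], is the successor of another member. *)
Definition trace n y a b l : Prop :=
  (pair n y < l)%rca /\ (incode a b (pair n y) /\ forall i, (i < l)%rca ->
    forall u, (u < l)%rca ->
    (pair i u < l)%rca -> incode a b (pair i u) ->
    (i = 0%rca /\ u = a0) \/ exists j, (j < i)%rca /\ exists w, (w < l)%rca /\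
      (i = (j + 1)%rca /\ ((pair j w < l)%rca /\ (incode a b (pair j w) /\ u = g j w)))).

Definition value n y : Prop := exists a b l, trace n y a b l.

Lemma S1_value : S1 (fun v => value (v 0%N) (v 1%N)).
Proof. by rewrite /value /trace; dfn. Qed.

Lemma pair_lt1 x y z : (pair x y < z)%rca -> (x < z)%rca.
Proof. by move=> H; have /ltS := pair_ge1 x y; toN; lra. Qed.

Lemma pair_lt2 x y z : (pair x y < z)%rca -> (y < z)%rca.
Proof. by move=> H; have /ltS := pair_ge2 x y; toN; lra. Qed.

Lemma value0 : value 0%rca a0.
Proof.
have [|X HX] := @comprehend R (fun x => x = pair 0%rca a0); first by dfn.
have [a [b H]] := code_exists X (pair 0%rca a0 + 1)%rca.
exists a, b, (pair 0%rca a0 + 1)%rca; split; first by apply/nlt_succ; right.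
split; first by apply/H; [apply/nlt_succ; right|apply/HX].
by move=> i _ u _ Hl /(H _ Hl)/HX/pair_inj; left.
Qed.

Lemma value_step n y : value n y -> value (n + 1)%rca (g n y).
Proof.
move=> [a [b [l [Hl [Hc Ht]]]]].
pose p := pair (n + 1)%rca (g n y).
have [|X HX] := @comprehend R (fun x => ((x < l)%rca /\ incode a b x) \/ x = p); first by dfn.
have [a' [b' H]] := code_exists X (l + p + 1)%rca.
have lt_l x : (x < l)%rca -> (x < l + p + 1)%rca.
  by move=> Hx; have := N_ge0 p; toN; lra.
have lt_p : (p < l + p + 1)%rca by have := N_ge0 l; toN; lra.
exists a', b', (l + p + 1)%rca; split=> //; split; first by apply/H/HX => //; right.
move=> i _ u _ Hiu /(H _ Hiu)/HX[[H1 H2]|/pair_inj[-> ->]]; last first.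
  right; exists n; split; first by apply/nlt_succ; right.
  exists y; split; first exact/lt_l/(pair_lt2 Hl).
  by split=> //; split; [exact: lt_l|split=> //; apply/H; [exact: lt_l|apply/HX; left]].
case: (Ht i (pair_lt1 H1) u (pair_lt2 H1) H1 H2) => [|[j [ji [w [wl [e [Hjw [Hc' eu]]]]]]]];
  first by left.
right; exists j; split=> //; exists w; split; first exact: lt_l.
by split=> //; split; [exact: lt_l|split=> //; apply/H; [exact: lt_l|apply/HX; left]].
Qed.

Lemma value_uniq n y z : value n y -> value n z -> y = z.
Proof.
move=> [a [b [l [Hl [Hc Ht]]]]] [a' [b' [l' [Hl' [Hc' Ht']]]]].
(* With both traces fixed, all quantifiers are bounded by [l] and [l'], so the claim is Delta^0_1 in
   [i]. *)
suff H : forall i u, (u < l)%rca -> forall u', (u' < l')%rca ->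
  (pair i u < l)%rca -> incode a b (pair i u) ->
  (pair i u' < l')%rca -> incode a' b' (pair i u') -> u = u'.
  exact: (H n y (pair_lt2 Hl) z (pair_lt2 Hl')).
apply: ind_D1; first by dfn.
  move=> u ul u' ul' H1 H2 H3 H4.
  case: (Ht _ (pair_lt1 H1) _ ul H1 H2) => [[_ ->]|[j [/N_lt1//]]].
  by case: (Ht' _ (pair_lt1 H3) _ ul' H3 H4) => [[_ ->]|[j [/N_lt1//]]].
have S0 x : (x + 1)%rca <> 0%rca by move=> /(congr1 (@N R)); toN; have := N_ge0 x; lra.
have Sinj x x' : (x + 1)%rca = (x' + 1)%rca -> x = x'.
  by move=> /(congr1 (@N R)); toN => e; apply: N_inj; lra.
move=> i IH u ul u' ul' H1 H2 H3 H4.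
case: (Ht _ (pair_lt1 H1) _ ul H1 H2) => [[/S0//]|[j [_ [w [wl [/Sinj<- [Hw [Hcw ->]]]]]]]].
case: (Ht' _ (pair_lt1 H3) _ ul' H3 H4) =>
  [[/S0//]|[j' [_ [w' [wl' [/Sinj<- [Hw' [Hcw' ->]]]]]]]].
by congr g; apply: IH.
Qed.

Lemma primitive_recursion : exists h : D -> D,
  [/\ def1 h, h 0%rca = a0 & forall x, h (x + 1)%rca = g x (h x)].
Proof.
have [|||h [dh Hh]] := @make_function value.
- exact: S1_value.
- apply: ind_S1; last by move=> n [y /value_step Hy]; exists (g n y).
    apply: (@S1_ex _ (fun y v => value (v 0%N) y)).
    exact: (S1_ren (fun n => if n is 0 then 1 else 0)%N S1_value).
  by exists a0; apply: value0.
- exact: value_uniq.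
exists h; split=> // [|x]; first exact: value_uniq (Hh _) value0.
exact: value_uniq (Hh _) (value_step (Hh _)).
Qed.

End PrimitiveRecursion.

Lemma power_function : exists h : D -> D,
  [/\ def1 h, h 0%rca = 1%rca & forall x, h (x + 1)%rca = ((1 + 1) * h x)%rca].
Proof. by apply: (@primitive_recursion 1%rca (fun _ y => (1 + 1) * y)%rca); dfn. Qed.

Definition pw : D -> D := projT1 (cid power_function).

Lemma def_pw : def1 pw.
Proof. by rewrite /pw; case: cid => h /= []. Qed.

Lemma pw0 : pw 0%rca = 1%rca.
Proof. by rewrite /pw; case: cid => h /= []. Qed.

Lemma pwS x : pw (x + 1)%rca = ((1 + 1) * pw x)%rca.
Proof. by rewrite /pw; case: cid => h /= []. Qed.

End Recursion.

#[export] Hint Resolve def_pair def_p1 def_p2 def_incode def_pw : dfn.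

(** * Definable functions with rational values *)

Section Rationals.
Variable R : rca.
Notation D := (num R).
Notation env := (nat -> D).
Notation K := (rca_field R).
Implicit Types (x y z a b c k : D) (s t : env -> K).

Definition rat a b c : D := pair (pair a b) c.
Definition val (q : D) : K :=
  (N (p1 (p1 q)) - N (p2 (p1 q))) / (N (p2 q) + 1).

Lemma val_rat a b c : val (rat a b c) = (N a - N b) / (N c + 1).
Proof. by rewrite /val /rat !p1_pair !p2_pair. Qed.

Lemma NS_gt0 c : 0 < N c + 1.
Proof. by have := N_ge0 c; lra. Qed.

(** Field elements are no objects of the model, so a definable field-valued function is given by its
    numerator and denominator parts. *)
Definition KF t : Prop := exists a b c : env -> D, [/\ DF a, DF b, DF c &
  forall v, t v = (N (a v) - N (b v)) / (N (c v) + 1)].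
Definition defK1 (f : D -> K) := KF (fun v => f (v 0%N)).
Definition defK2 (f : D -> D -> K) := KF (fun v => f (v 0%N) (v 1%N)).

Lemma KF_frac (a b c : env -> D) : DF a -> DF b -> DF c ->
  KF (fun v => (N (a v) - N (b v)) / (N (c v) + 1)).
Proof. by move=> da db dc; exists a, b, c. Qed.

Lemma KF_ext s t : KF s -> (forall v, s v = t v) -> KF t.
Proof. by move=> ks /funext <-. Qed.

Lemma KF_N (a : env -> D) : DF a -> KF (fun v => N (a v)).
Proof.
move=> da; apply: (KF_ext (@KF_frac a (fun=> 0%rca) (fun=> 0%rca) da _ _)); try by dfn.
by move=> v /=; toN; rewrite subr0 add0r divr1.
Qed.

Lemma KF_const (z : K) : KF (fun _ => z).
Proof. by have [a [b [c ->]]] := N_frac z; apply: KF_frac; dfn. Qed.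

Lemma KF_val (q : env -> D) : DF q -> KF (fun v => val (q v)).
Proof. by move=> dq; apply: KF_frac; dfn. Qed.

Lemma KF_add s t : KF s -> KF t -> KF (fun v => s v + t v).
Proof.
move=> [a [b [c [da db dc e]]]] [a' [b' [c' [da' db' dc' e']]]].
exists (fun v => a v * (c' v + 1) + a' v * (c v + 1))%rca,
  (fun v => b v * (c' v + 1) + b' v * (c v + 1))%rca, (fun v => c v * c' v + c v + c' v)%rca.
split; try by dfn.
move=> v; rewrite e e'; toN; have := NS_gt0 (c v); have := NS_gt0 (c' v) => h h'.
have n0 : (N (c v) * N (c' v) + N (c v) + N (c' v) + 1) != 0.
  by rewrite (_ : _ + 1 = (N (c v) + 1) * (N (c' v) + 1)) ?mulf_neq0 ?gt_eqF //; ring.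
by field; rewrite n0 !gt_eqF.
Qed.

Lemma KF_mul s t : KF s -> KF t -> KF (fun v => s v * t v).
Proof.
move=> [a [b [c [da db dc e]]]] [a' [b' [c' [da' db' dc' e']]]].
exists (fun v => a v * a' v + b v * b' v)%rca,
  (fun v => a v * b' v + b v * a' v)%rca, (fun v => c v * c' v + c v + c' v)%rca.
split; try by dfn.
move=> v; rewrite e e'; toN; have := NS_gt0 (c v); have := NS_gt0 (c' v) => h h'.
have n0 : (N (c v) * N (c' v) + N (c v) + N (c' v) + 1) != 0.
  by rewrite (_ : _ + 1 = (N (c v) + 1) * (N (c' v) + 1)) ?mulf_neq0 ?gt_eqF //; ring.
by field; rewrite n0 !gt_eqF.
Qed.

Lemma KF_opp t : KF t -> KF (fun v => - t v).
Proof.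
move=> kt; apply: (KF_ext (KF_mul (KF_const (-1)) kt)) => v; ring.
Qed.

Lemma KF_if (P : env -> Prop) s t : D1 P -> KF s -> KF t ->
  KF (fun v => if `[< P v >] then s v else t v).
Proof.
move=> dP [a [b [c [da db dc e]]]] [a' [b' [c' [da' db' dc' e']]]].
exists (fun v => if `[< P v >] then a v else a' v), (fun v => if `[< P v >] then b v else b' v),
  (fun v => if `[< P v >] then c v else c' v).
split; try exact: DF_if.
by move=> v; rewrite e e'; case: asboolP.
Qed.

Lemma KF_ren t (r : nat -> nat) : KF t -> KF (fun v => t (fun n => v (r n))).
Proof.
move=> [a [b [c [da db dc e]]]].
by exists (fun v => a (fun n => v (r n))), (fun v => b (fun n => v (r n))),
  (fun v => c (fun n => v (r n)));
  split=> //; exact: DF_ren.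
Qed.

Lemma KF_sub (u : env -> D) (f : D -> env -> K) :
  DF u -> KF (fun v => f (v 0%N) (tl v)) -> KF (fun v => f (u v) v).
Proof.
move=> du [a [b [c [da db dc e]]]].
exists (fun v => a (scons (u v) v)), (fun v => b (scons (u v) v)), (fun v => c (scons (u v) v)).
have sub (d : env -> D) : DF d -> DF (fun v => d (scons (u v) v)).
  move=> dd; apply: (@DF_sub _ u (fun x v => d (scons x v))) => //.
  rewrite (_ : (fun v => _) = d) //; apply: funext => v.
  by congr d; apply: funext => -[].
by split=> [|||v]; try exact: sub; rewrite -e.
Qed.

Lemma KF_app1 f (u : env -> D) : defK1 f -> DF u -> KF (fun v => f (u v)).
Proof. by move=> df du; apply: (@KF_sub u (fun x v => f x)). Qed.

Lemma KF_app2 f (u w : env -> D) : defK2 f -> DF u -> DF w -> KF (fun v => f (u v) (w v)).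
Proof.
move=> df du dw; apply: (@KF_sub u (fun x v => f x (w v))) => //.
apply: (@KF_sub (fun v => w (tl v)) (fun x v => f (v 0%N) x)); first exact: (DF_ren S dw).
exact: (KF_ren (fun n => if n is 0 then 1 else 0)%N df).
Qed.

Lemma KF_code t : KF t -> exists q : env -> D, DF q /\
  forall v, (exists a b c, q v = rat a b c) /\ val (q v) = t v.
Proof.
move=> [a [b [c [da db dc e]]]]; exists (fun v => rat (a v) (b v) (c v)).
rewrite /rat; split; first by dfn.
by move=> v; split; [exists (a v), (b v), (c v)|rewrite e val_rat].
Qed.

Lemma D1_Kle s t : KF s -> KF t -> D1 (fun v => s v <= t v).
Proof.
move=> [a [b [c [da db dc e]]]] [a' [b' [c' [da' db' dc' e']]]].
apply: (@D1_ext _ (fun v =>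
  ~ (a' v * (c v + 1) + b v * (c' v + 1) < a v * (c' v + 1) + b' v * (c v + 1))%rca)).
  by dfn.
move=> v; rewrite e e' ler_pdivrMr ?NS_gt0 // mulrAC ler_pdivlMr ?NS_gt0 //; toN.
split=> H; last by lra.
rewrite leNgt; apply/negP => H1; apply: H; lra.
Qed.

Lemma D1_Klt s t : KF s -> KF t -> D1 (fun v => s v < t v).
Proof.
move=> ks kt; apply: (D1_ext (D1_not (D1_Kle kt ks))) => v.
by rewrite ltNge; split=> /negP.
Qed.

Definition eps k : K := (N (pw k))^-1.

Lemma pw_gt0 k : 0 < N (pw k).
Proof.
have H : (0 < pw k)%rca; last by toN.
move: k; apply: ind_D1; first by dfn.
  by rewrite pw0; toN.
by move=> k; rewrite pwS; toN; lra.
Qed.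

Lemma KF_eps (u : env -> D) : DF u -> KF (fun v => eps (u v)).
Proof.
move=> du; apply: (@KF_app1 eps) => //.
(* Denominators have the form [c + 1], so the predecessor of [pw] has to be definable. *)
have [f [df Hf]] : exists f : D -> D, def1 f /\ forall k, pw k = (f k + 1)%rca.
  apply: (@make_function _ (fun k y => pw k = (y + 1)%rca)); first by dfn.
    move=> k; case: (zero_or_succ (pw k)) => [e|//].
    by have := pw_gt0 k; rewrite e; toN; rewrite ltxx.
  by move=> k y z -> /(congr1 (@N R)); toN => e; apply: N_inj; lra.
apply: (KF_ext (@KF_frac (fun _ => 1%rca) (fun _ => 0%rca) (fun v => f (v 0%N)) _ _ _));
  try by dfn.
by move=> v /=; rewrite /eps Hf; toN; rewrite subr0 div1r.
Qed.

End Rationals.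

Ltac kfn1 :=
  cbv beta delta [tl]; first [assumption |
  match goal with
  | |- D1 (fun v => is_true (@Order.le _ _ _ _)) => apply: D1_Kle
  | |- D1 (fun v => is_true (@Order.lt _ _ _ _)) => apply: D1_Klt
  | |- KF (fun _ => ?c) => apply: KF_const
  | |- KF (fun v => @N _ _) => apply: KF_N
  | |- KF (fun v => @val _ _) => apply: KF_val
  | |- KF (fun v => @eps _ _) => apply: KF_eps
  | |- KF (fun v => _ + _) => apply: KF_add
  | |- KF (fun v => - _) => apply: KF_opp
  | |- KF (fun v => _ * _) => apply: KF_mul
  | |- KF (fun v => if asbool _ then _ else _) => apply: KF_if
  | |- KF (fun v => ?f (@?t v) (@?u v)) => apply: (@KF_app2 _ f t u); [dfn_hint | |]
  | |- KF (fun v => ?f (@?t v)) => apply: (@KF_app1 _ f t); [dfn_hint |]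
  end].
Ltac kfn := rewrite /def1 /def2 /defP1 /defP2 /defP3 /defK1 /defK2 /=;
  repeat (first [kfn1 | dfn1]).

(** * Powers of two and the Archimedean property *)

Section Reals.
Variable R : rca.
Notation D := (num R).
Notation K := (rca_field R).
Notation eps := (@eps R).
Implicit Types (j k m n : D).

Lemma eps_gt0 k : 0 < eps k.
Proof. by rewrite invr_gt0 pw_gt0. Qed.

Lemma eps0 : eps 0%rca = 1.
Proof. by rewrite /eps pw0; toN; rewrite invr1. Qed.

Lemma epsS k : eps (k + 1)%rca = eps k / 2.
Proof.
rewrite /eps pwS; toN; have := pw_gt0 k => h.
by rewrite invfM mulrC (_ : 1 + 1 = 2).
Qed.

Lemma pw_eps k : N (pw k) * eps k = 1.
Proof. by rewrite /eps mulfV // gt_eqF ?pw_gt0. Qed.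

Lemma pw_gt k : N k < N (pw k).
Proof.
have : (k < pw k)%rca; last by toN.
move: k; apply: ind_D1; first by dfn.
  by rewrite pw0; toN.
by move=> k; rewrite pwS => H; have := @N_disc R k (pw k); toN => /(_ H); have := N_ge0 k; lra.
Qed.

Lemma pwD j k : pw (j + k)%rca = (pw j * pw k)%rca :> D.
Proof.
move: k; apply: ind_D1; first by dfn.
  by rewrite pw0; apply: N_inj; toN; rewrite mulr1 (_ : (j + 0)%rca = j) //; apply: N_inj;
    toN; rewrite addr0.
move=> k IH; rewrite (_ : (j + (k + 1)) = (j + k) + 1)%rca; last by apply: N_inj; toN; ring.
by rewrite !pwS IH; apply: N_inj; toN; ring.
Qed.

Lemma epsD j k : eps (j + k)%rca = eps j * eps k.
Proof. by rewrite /eps pwD NM invfM. Qed.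

Lemma eps_le1 k : eps k <= 1.
Proof.
rewrite /eps invf_le1 ?pw_gt0 //.
have := @N_disc R (nzero R) (pw k); rewrite N0 => /(_ (pw_gt0 k)); lra.
Qed.

Lemma eps_anti j k : N j <= N k -> eps k <= eps j.
Proof.
move=> /N_sub[z Hz]; rewrite (_ : k = (j + z)%rca); last by apply: N_inj; toN; lra.
by rewrite epsD ler_piMr ?eps_le1 // ltW ?eps_gt0.
Qed.

Lemma archimedean (z : K) : exists n, z <= N n.
Proof.
have [a [b [c ->]]] := @N_frac R z; exists a.
rewrite ler_pdivrMr ?NS_gt0 //; have := @N_ge0 R a; have := @N_ge0 R b => h2 h1.
by have := mulr_ge0 h1 (N_ge0 c); lra.
Qed.

Lemma eps_small (z : K) : 0 < z -> exists k, eps k < z.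
Proof.
move=> z0; have [n Hn] := archimedean z^-1; exists n.
rewrite /eps -[z]invrK ltf_pV2 ?posrE ?invr_gt0 ?pw_gt0 //.
exact: le_lt_trans Hn (pw_gt n).
Qed.

Lemma floor_exists (z : K) : 0 <= z -> exists m, N m <= z < N m + 1.
Proof.
move=> z0; have [||m [H1 H2]] := @least_D1 R (fun m => z < N m + 1); first by kfn.
  by have [n Hn] := archimedean z; exists n; lra.
exists m; rewrite H1 andbT; case: (zero_or_succ m) => [->|[y e]]; first by toN.
have /H2/negP : (y < m)%rca by rewrite e; apply/nlt_succ; right.
by rewrite -leNgt e; toN.
Qed.

End Reals.

(** * The formulas of the theorem in a model *)

(* [sand], [sor], [siff] and [sex] spell out the abbreviations in terms of falsum,
   implication and universal quantification, so that the predicates below are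
   convertible to the satisfaction of the formulas that they mirror. *)
Definition sand (P Q : Prop) : Prop := (P -> Q -> False) -> False.
Definition sor (P Q : Prop) : Prop := (P -> False) -> Q.
Definition siff (P Q : Prop) : Prop := sand (P -> Q) (Q -> P).
Definition sex (T : Type) (P : T -> Prop) : Prop := (forall x, P x -> False) -> False.

Lemma sandE : sand = and.
Proof.
apply: funext => P; apply: funext => Q; apply: propext; rewrite /sand.
by case: (EM P); case: (EM Q); tauto.
Qed.

Lemma sorE : sor = or.
Proof.
apply: funext => P; apply: funext => Q; apply: propext; rewrite /sor.
by case: (EM P); case: (EM Q); tauto.
Qed.

Lemma siffE : siff = iff.
Proof. by apply: funext => P; apply: funext => Q; rewrite /siff sandE. Qed.

Lemma sexE T : @sex T = fun P => exists x, P x.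
Proof.
apply: funext => P; apply: propext; split=> [H|[x Px] H]; last exact: H x Px.
by apply: contrapT => H1; apply: H => x Px; apply: H1; exists x.
Qed.

Section Shallow.
Variable R : rca.
Notation D := (num R).
Notation S := (sets R).
Local Open Scope rca_scope.

Definition s_le (s t : D) := sor (s < t) (s = t).

Definition s_set_of_pairs (F : S) :=
  forall m, smem m F -> sex (fun x : D => sex (fun y => m = pair x y)).

Definition s_is_function (F : S) :=
  sand (s_set_of_pairs F)
  (sand (forall x : D, sex (fun y => smem (pair x y) F))
        (forall x y z : D, smem (pair x y) F -> smem (pair x z) F -> y = z)).

Definition s_pow2 (k p : D) := sex (fun F => sand (s_is_function F)
  (sand (smem (pair 0 1) F)
  (sand (forall i q, smem (pair i q) F -> smem (pair (i + 1) ((1 + 1) * q)) F)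
        (smem (pair k p) F)))).

Definition s_seq_length (s n : D) :=
  sex (fun p => sand (s_pow2 n p) (sand (s_le p s) (s < (1 + 1) * p))).

Definition s_initial_segment (t s : D) :=
  sand (0 < t) (sex (fun j => sex (fun p => sex (fun r =>
    sand (s_pow2 j p) (sand (r < p) (s = t * p + r)))))).

Definition s_seq_entry (s i b : D) :=
  sex (fun t => sand (s_seq_length t i) (s_initial_segment ((1 + 1) * t + b) s)).

Definition s_binary_tree (T : S) :=
  sand (forall s : D, smem s T -> 0 < s)
       (forall s t : D, smem s T -> s_initial_segment t s -> smem t T).

Definition s_infinite_set (T : S) := forall n : D, sex (fun s => sand (n < s) (smem s T)).

Definition s_is_path (F T : S) :=
  sand (s_is_function F)
  (sand (forall i b : D, smem (pair i b) F -> sor (b = 0) (b = 1))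
        (forall n : D, sex (fun s => sand (smem s T) (sand (s_seq_length s n)
          (forall i b, i < n -> smem (pair i b) F -> s_seq_entry s i b))))).

Definition s_WKL := forall T, sand (s_binary_tree T) (s_infinite_set T) ->
  sex (fun F => s_is_path F T).

Lemma msat_WKL v w : @msat R v w WKL = s_WKL.
Proof. by []. Qed.

Definition s_is_rat (q : D) :=
  sex (fun a => sex (fun b => sex (fun c => q = rat a b c))).

Definition s_rat_le_plus (q r m p : D) :=
  sex (fun a => sex (fun b => sex (fun c => sex (fun a' => sex (fun b' => sex (fun c' =>
    sand (q = rat a b c) (sand (r = rat a' b' c')
    (s_le (p * (a * (c' + 1) + b' * (c + 1)))
      (p * (b * (c' + 1) + a' * (c + 1)) + m * ((c + 1) * (c' + 1))))))))))).

Definition s_of_set (X : S) (k q : D) := smem (pair k q) X.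
Definition s_row (X : S) (i k q : D) := smem (pair (pair i k) q) X.
Definition s_constant (c : D) (k q : D) := q = c.

Definition s_represents_real (u : D -> D -> Prop) :=
  sand (forall k, sex (fun q => u k q))
  (sand (forall k q r, u k q -> u k r -> q = r)
  (sand (forall k q, u k q -> s_is_rat q)
        (forall k i p q r, s_pow2 k p -> u k q -> u (k + i) r ->
           sand (s_rat_le_plus q r 1 p) (s_rat_le_plus r q 1 p)))).

Definition s_is_real (X : S) := sand (s_set_of_pairs X) (s_represents_real (s_of_set X)).

Definition s_is_real_sequence (X : S) :=
  sand (forall m, smem m X -> sex (fun i => sex (fun k => sex (fun q =>
          m = pair (pair i k) q))))
       (forall i, s_represents_real (s_row X i)).

Definition s_real_le (u v : D -> D -> Prop) :=
  forall k p q r, s_pow2 k p -> u k q -> v k r -> s_rat_le_plus q r (1 + 1) p.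

Definition s_real_lt (u v : D -> D -> Prop) := s_real_le v u -> False.

Definition s_in_unit_interval (X : S) := sand (s_is_real X)
  (sand (s_real_le (s_constant (rat 0 0 0)) (s_of_set X))
        (s_real_le (s_of_set X) (s_constant (rat 1 0 0)))).

Definition s_in_interval (A B : S) (i : D) (X : S) := sand (s_is_real X)
  (sand (s_real_lt (s_row A i) (s_of_set X)) (s_real_lt (s_of_set X) (s_row B i))).

Definition s_interval_family (A B : S) := sand (s_is_real_sequence A) (s_is_real_sequence B).

Definition s_covers (A B : S) :=
  forall X, s_in_unit_interval X -> sex (fun i => s_in_interval A B i X).

Definition s_HeineBorel := forall A B, sand (s_interval_family A B) (s_covers A B) ->
  sex (fun j => forall X, s_in_unit_interval X ->
    sex (fun i => sand (i < j) (s_in_interval A B i X))).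

Lemma msat_HeineBorel v w : @msat R v w HeineBorel = s_HeineBorel.
Proof. by []. Qed.

Definition s_CL (P : S -> Prop) :=
  sand (sex (fun A => sex (fun B => sand (s_interval_family A B) (sand (s_covers A B)
          (forall i X Y, s_in_interval A B i X -> s_in_interval A B i Y -> siff (P X) (P Y))))))
       (sex (fun Z => sand (forall m : D, siff (smem m Z) (sex (fun k => sex (fun q =>
          sand (s_constant (rat 0 0 0) k q) (m = pair k q))))) (P Z))) ->
  forall X, s_in_unit_interval X -> P X.

(** Everything but the occurrences of [Psi] agrees by computation. Substitution into an unknown
    formula does not compute, so [G] abstracts these occurrences and [msat_fsubst] rewrites them. *)
Lemma msat_CL Psi v w : @msat R v w (CL Psi) = s_CL (fun X => msat v (scons X w) Psi).
Proof.
pose G (P Q : D -> S -> S -> S -> S -> Prop) (P' : S -> Prop) :=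
  sand (sex (fun A => sex (fun B => sand (s_interval_family A B) (sand (s_covers A B)
          (forall i X Y, s_in_interval A B i X -> s_in_interval A B i Y ->
             siff (P i A B X Y) (Q i A B X Y))))))
       (sex (fun Z => sand (forall m : D, siff (smem m Z) (sex (fun k => sex (fun q =>
          sand (s_constant (rat 0 0 0) k q) (m = pair k q))))) (P' Z))) ->
  forall X, s_in_unit_interval X -> P' X.
transitivity (G
  (fun i A B X Y => @msat R (scons i v) (scons Y (scons X (scons B (scons A w))))
    (apply_form Psi (fun e => Nat.sub e 3%N) 1%N 4%N))
  (fun i A B X Y => @msat R (scons i v) (scons Y (scons X (scons B (scons A w))))
    (apply_form Psi (fun e => Nat.sub e 4%N) 1%N 4%N))
  (fun Z => @msat R v (scons Z w) (apply_form Psi (fun e => Nat.sub e 1%N) 0%N 1%N))).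
  by [].
have fs (v' : nat -> D) (w' : nat -> S) (X : nat ->
  nat) d e : (fun n => v' (d + n)%coq_nat) = v ->
    (fun n => w' (e + n)%coq_nat) = w ->
    msat v' w' (apply_form Psi X d e) = msat v (scons (w' (X e)) w) Psi.
  move=> <- <-; rewrite /apply_form msat_fsubst; congr (msat _ _ Psi).
  by apply: funext => -[|n].
transitivity (G (fun i A B X Y => msat v (scons X w) Psi) (fun i A B X Y =>
  msat v (scons Y w) Psi)
  (fun X => msat v (scons X w) Psi)); last by [].
by congr G; do ![apply: funext => ?]; rewrite fs.
Qed.

End Shallow.

(** * Reals as definable sequences in the field of fractions *)

Section RealTheory.
Variable R : rca.
Notation D := (num R).
Notation K := (rca_field R).
Notation eps := (@eps R).
Implicit Types (i j k l : D) (q r p : D) (x y : D -> K).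

Definition Cau x := forall k i, x k <= x (k + i)%rca + eps k /\ x (k + i)%rca <= x k + eps k.
Definition rle x y := forall k, x k <= y k + 2 * eps k.
Definition rlt x y := exists k, x k + 2 * eps k < y k.
Definition cst (z : K) : D -> K := fun _ => z.

Lemma Cau_le x k l : Cau x -> N k <= N l -> x k <= x l + eps k /\ x l <= x k + eps k.
Proof.
move=> cx /N_sub[i Hi]; have := cx k i.
by rewrite (_ : (k + i)%rca = l) //; apply: N_inj; toN; lra.
Qed.

Lemma Cau_dist x k l : Cau x -> x k <= x l + eps k + eps l.
Proof.
move=> cx; have := eps_gt0 k; have := eps_gt0 l => hl hk.
by have [H|/ltW H] := leP (N k) (N l); have := Cau_le cx H; lra.
Qed.

Lemma Cau_cst z : Cau (cst z).
Proof. by move=> k i; have := eps_gt0 k; rewrite /cst; lra. Qed.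

Lemma not_rle x y : ~ rle y x <-> rlt x y.
Proof.
split=> [H|[k Hk] H]; last by have := H k; lra.
apply: contrapT => H1; apply: H => k; rewrite leNgt; apply/negP => Hk.
by apply: H1; exists k.
Qed.

Lemma eps_small2 (z : K) k l : 0 < z -> exists m, [/\ eps m < z, N k <= N m & N l <= N m].
Proof.
move=> /eps_small [m Hm]; exists (m + k + l)%rca.
have h1 := N_ge0 k; have h2 := N_ge0 l; have h3 := N_ge0 m.
split; try by toN; lra.
by apply: le_lt_trans Hm; apply: eps_anti; toN; lra.
Qed.

(** All later terms of [x] are at most [x k + eps k] and those of [y] at least [y l - eps l]; a
    precision below half of the gap witnesses the inequality. *)
Lemma rlt_intro x y k l : Cau x -> Cau y -> x k + eps k < y l - eps l -> rlt x y.
Proof.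
move=> cx cy H.
have [m [Hm km lm]] : exists m, [/\ eps m < (y l - eps l - (x k + eps k)) / 2,
  N k <= N m & N l <= N m].
  by apply: eps_small2; lra.
by exists m; have := Cau_le cx km; have := Cau_le cy lm; lra.
Qed.

Lemma rle_dist x y k l : Cau x -> Cau y -> rle x y -> x k <= y l + eps k + eps l.
Proof.
move=> cx cy H; rewrite leNgt; apply/negP => Hlt.
have [m [Hm km lm]] : exists m, [/\ eps m < (x k - (y l + eps k + eps l)) / 2,
  N k <= N m & N l <= N m].
  by apply: eps_small2; lra.
by have := H m; have := Cau_le cx km; have := Cau_le cy lm; lra.
Qed.

Lemma rlt_cst x z k : Cau x -> x k + eps k < z -> rlt x (cst z).
Proof.
move=> cx H; have [l Hl] : exists l, eps l < z - (x k + eps k) by apply: eps_small; lra.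
by apply: (@rlt_intro _ _ k l) => //; [exact: Cau_cst|rewrite /cst; lra].
Qed.

Lemma cst_rlt x z k : Cau x -> z < x k - eps k -> rlt (cst z) x.
Proof.
move=> cx H; have [l Hl] : exists l, eps l < x k - eps k - z by apply: eps_small; lra.
by apply: (@rlt_intro _ _ l k) => //; [exact: Cau_cst|rewrite /cst; lra].
Qed.

(* A number within [d] of the unit interval is within [d] of one of the [2^n]
   dyadic cells of length [2^-n]. *)
Lemma grid (z d : K) n : 0 <= d -> - d <= z <= 1 + d ->
  exists m, N m + 1 <= N (pw n) /\ N m * eps n - d <= z <= (N m + 1) * eps n + d.
Proof.
move=> d0 /andP[z0 z1].
have e0 := eps_gt0 n; have pe := pw_eps n; have p0 := pw_gt0 n.
have pw1 : N (nzero R) + 1 <= N (pw n) by apply: N_disc; rewrite N0.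
have [zn|zp] := ltP z 0.
  by exists 0%rca; toN; split=> //; apply/andP; split; lra.
have [z1'|z1'] := leP 1 z.
  have [m Hm] : exists m, N m = N (pw n) - N (none R) by apply: N_sub; move: pw1; toN; lra.
  have me : N m * eps n = 1 - eps n by rewrite Hm N1 mulrBl pe mul1r.
  exists m; split; first by rewrite Hm N1; lra.
  rewrite mulrDl mul1r me.
  by apply/andP; split; lra.
have [m /andP[m1 m2]] : exists m, N m <= z * N (pw n) < N m + 1.
  by apply: floor_exists; apply: mulr_ge0 => //; lra.
have zE : z = z * N (pw n) * eps n by rewrite -mulrA pe mulr1.
exists m; split.
  apply: N_disc; apply: le_lt_trans m1 _.
  by rewrite -[ltRHS]mul1r ltr_pM2r.
by rewrite zE; apply/andP; split; nra.
Qed.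

Section Presentation.
Implicit Types (u v : D -> D -> Prop).

Definition presents u x := [/\ forall k, exists q, u k q,
  forall k q r, u k q -> u k r -> q = r &
  forall k q, u k q -> (exists a b c, q = rat a b c) /\ val q = x k].

(** Any set as in the formula obeys the recursion of [pw], hence agrees with it by induction;
    conversely the graph of [pw] is a set, its first entries being bounded by the codes of the
    pairs. *)
Lemma s_pow2P k p : s_pow2 k p <-> p = pw k.
Proof.
rewrite /s_pow2 /s_is_function /s_set_of_pairs sandE !sexE.
split=> [[F [[_ [tot fn]] [F0 [FS Fk]]]]|->].
  apply: fn Fk _; move: {p} k; apply: ind_D1; first by dfn.
    by rewrite pw0.
  by move=> k /FS; rewrite pwS.
have [|F HF] := @comprehend R (fun m => exists i, (i < m + 1)%rca /\ m = pair i (pw i)).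
  by dfn.
have FP i j : smem (pair i j) F <-> j = pw i.
  split=> [/HF[z [_ /pair_inj[-> ->]]]//|->]; apply/HF; exists i; split=> //.
  exact: pair_ge1.
exists F; split; last by rewrite !FP pw0; split=> //; split=> // i q /FP ->; apply/FP;
  rewrite pwS.
split; first by move=> m /HF[i [_ ->]]; exists i, (pw i).
by split=> [i|i j l /FP -> /FP ->//]; exists (pw i); apply/FP.
Qed.

Lemma s_leP i j : @s_le R i j <-> N i <= N j.
Proof.
rewrite /s_le sorE nltE le_eqVlt; split=> [[->|->]|/orP[/eqP/N_inj ->|->]];
  rewrite ?eqxx ?orbT //; auto.
Qed.

Lemma rat_inj a b c a' b' c' : rat a b c = rat a' b' c' :> D -> [/\ a = a', b = b' & c = c'].
Proof. by move=> /pair_inj[/pair_inj[-> ->] ->]. Qed.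

Lemma s_rat_leP q r m p : (exists a b c, q = rat a b c) -> (exists a b c, r = rat a b c) ->
  0 < N p -> s_rat_le_plus q r m p <-> val q <= val r + N m / N p.
Proof.
move=> [a [b [c ->]]] [a' [b' [c' ->]]] p0.
have -> : s_rat_le_plus (rat a b c) (rat a' b' c') m p <->
  N (p * (a * (c' + 1) + b' * (c + 1)))%rca <=
  N (p * (b * (c' + 1) + a' * (c + 1)) + m * ((c + 1) * (c' + 1)))%rca.
  rewrite /s_rat_le_plus sandE !sexE; split.
    by move=> [? [? [? [? [? [? [/rat_inj[<- <- <-] [/rat_inj[<- <- <-] /s_leP]]]]]]]].
  by move=> /s_leP H; exists a, b, c, a', b', c'.
rewrite !val_rat; toN; have h := NS_gt0 c; have h' := NS_gt0 c'.
rewrite -subr_ge0 -[X in _ <-> is_true X]subr_ge0.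
have -> : (N a' - N b') / (N c' + 1) + N m / N p - (N a - N b) / (N c + 1) =
  (N p * (N b * (N c' + 1) + N a' * (N c + 1)) + N m * ((N c + 1) * (N c' + 1)) -
   N p * (N a * (N c' + 1) + N b' * (N c + 1))) / (N p * ((N c + 1) * (N c' + 1))).
  by field; rewrite !gt_eqF.
by rewrite pmulr_lge0 // invr_gt0 !mulr_gt0.
Qed.

Lemma representsP u x : presents u x -> s_represents_real u <-> Cau x.
Proof.
move=> [tot fn ux].
have le_e m k : m / N (pw k) = m * eps k by [].
rewrite /s_represents_real /s_is_rat sandE !sexE; split=> [[_ [_ [_ H]]] k i|cx].
  have [[q Hq] [r Hr]] := (tot k, tot (k + i)%rca).
  have := H k i (pw k) q r (proj2 (s_pow2P _ _) erefl) Hq Hr.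
  have [[qr eq] [rr er]] := (ux _ _ Hq, ux _ _ Hr).
  by rewrite !s_rat_leP ?pw_gt0 // eq er le_e N1 mul1r.
split=> //; split=> //; split=> [k q /ux[]//|k i p q r /s_pow2P -> Hq Hr].
have [[qr eq] [rr er]] := (ux _ _ Hq, ux _ _ Hr).
by rewrite !s_rat_leP ?pw_gt0 // eq er le_e N1 mul1r; apply: cx.
Qed.

Lemma real_leP u v x y : presents u x -> presents v y -> s_real_le u v <-> rle x y.
Proof.
move=> [tu fu ux] [tv fv vy]; rewrite /s_real_le; split=> H k.
  have [[q Hq] [r Hr]] := (tu k, tv k).
  have := H k (pw k) q r (proj2 (s_pow2P _ _) erefl) Hq Hr.
  have [[qr eq] [rr er]] := (ux _ _ Hq, vy _ _ Hr).
  by rewrite s_rat_leP ?pw_gt0 // eq er; toN.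
move=> p q r /s_pow2P -> Hq Hr.
have [[qr eq] [rr er]] := (ux _ _ Hq, vy _ _ Hr).
by rewrite s_rat_leP ?pw_gt0 // eq er; toN; apply: H.
Qed.

Lemma real_ltP u v x y : presents u x -> presents v y -> s_real_lt u v <-> rlt x y.
Proof.
move=> ux vy; rewrite -not_rle /s_real_lt.
by have := real_leP vy ux; tauto.
Qed.

Lemma presents_constant a b c : presents (s_constant (rat a b c)) (cst (val (rat a b c))).
Proof.
split=> [k|k q r -> ->|k q ->] //; first by exists (rat a b c).
by split=> //; exists a, b, c.
Qed.

Lemma val0 : val (rat (nzero R) 0 0)%rca = 0.
Proof. by rewrite val_rat; toN; rewrite subrr mul0r. Qed.

Lemma val1 : val (rat (none R) 0 0)%rca = 1.
Proof. by rewrite val_rat; toN; rewrite subr0 add0r divr1. Qed.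

Definition is_unit x := [/\ defK1 x, Cau x, rle (cst 0) x & rle x (cst 1)].

Definition set_presents (X : sets R) x := s_set_of_pairs X /\ presents (s_of_set X) x.

Lemma is_realP X x : set_presents X x -> s_is_real X <-> Cau x.
Proof.
by move=> [pX ux]; rewrite /s_is_real sandE (representsP ux); tauto.
Qed.

Lemma unit_intervalP X x : set_presents X x ->
  s_in_unit_interval X <-> [/\ Cau x, rle (cst 0) x & rle x (cst 1)].
Proof.
move=> pX; have [_ ux] := pX; rewrite /s_in_unit_interval sandE (is_realP pX).
have := real_leP (presents_constant (nzero R) 0 0)%rca ux; rewrite val0 => ->.
by have := real_leP ux (presents_constant (none R) 0 0)%rca; rewrite val1 => ->;
  split=> [[? []]|[]].
Qed.

Lemma in_intervalP A B i X a b x : set_presents X x -> Cau x ->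
  presents (s_row A i) a -> presents (s_row B i) b ->
  s_in_interval A B i X <-> rlt a x /\ rlt x b.
Proof.
move=> pX cx pa pb; have [_ ux] := pX; rewrite /s_in_interval sandE (is_realP pX).
by rewrite (real_ltP pa ux) (real_ltP ux pb); tauto.
Qed.

Lemma real_presented X : s_is_real X -> exists x, [/\ set_presents X x, Cau x & defK1 x].
Proof.
rewrite /s_is_real /s_represents_real sandE sexE => H.
have [sX [tot [fn [rt _]]]] := H.
have [|||f [df Hf]] := @make_function R (s_of_set X) => //.
  by rewrite /s_of_set; dfn.
have pX : set_presents X (fun k => val (f k)).
  split=> //; split=> // k q Hq; have -> : q = f k by apply: fn Hq _.
  by split=> //; have := rt _ _ (Hf k); rewrite /s_is_rat sexE.
exists (fun k => val (f k)); split=> //; last by kfn.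
by apply/(is_realP pX); rewrite /s_is_real /s_represents_real sandE sexE.
Qed.

Lemma make_real x : defK1 x -> Cau x -> exists X, set_presents X x /\ s_is_real X.
Proof.
move=> /KF_code[q [dq Hq]] cx; pose f k := q (fun=> k).
have df : def1 f by apply: (@DF_ren _ _ (fun=> 0%N) dq).
have [|X HX] := @comprehend R (fun m => exists k, (k < m + 1)%rca /\ m = pair k (f k)).
  by dfn.
have XP k r : smem (pair k r) X <-> r = f k.
  split=> [/HX[z [_ /pair_inj[-> ->]]]//|->]; apply/HX; exists k; split=> //.
  exact: pair_ge1.
have pX : set_presents X x.
  split; first by rewrite /s_set_of_pairs !sexE => m /HX[k [_ ->]]; exists k, (f k).
  split=> [k|k r r' /XP -> /XP ->|k r /XP ->] //; first by exists (f k); apply/XP.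
  by have := Hq (fun=> k).
by exists X; split=> //; apply/(is_realP pX).
Qed.

Lemma sequence_presented S : s_is_real_sequence S -> exists x : D -> D -> K,
  defK2 x /\ forall i, presents (s_row S i) (x i) /\ Cau (x i).
Proof.
rewrite /s_is_real_sequence sandE sexE => -[_ HS].
have H i := HS i; rewrite /s_represents_real sandE sexE in H.
have [|||f [df Hf]] := @make_function R (fun z q => s_row S (p1 z) (p2 z) q).
- by rewrite /s_row; dfn.
- by move=> z; have [tot _] := H (p1 z); apply: tot.
- by move=> z q r; have [_ [fn _]] := H (p1 z); apply: fn.
exists (fun i k => val (f (pair i k))); split; first by kfn.
move=> i; have [tot [fn [rt _]]] := H i.
have pS : presents (s_row S i) (fun k => val (f (pair i k))).
  split=> // k q Hq; have := Hf (pair i k); rewrite p1_pair p2_pair => Hf'.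
  have -> : q = f (pair i k) by apply: fn Hq _.
  by split=> //; have := rt _ _ Hf'; rewrite /s_is_rat sexE.
by split=> //; apply/(representsP pS).
Qed.

Lemma make_sequence (x : D -> D -> K) : defK2 x -> (forall i, Cau (x i)) ->
  exists S, s_is_real_sequence S /\ forall i, presents (s_row S i) (x i).
Proof.
move=> /KF_code[q [dq Hq]] cx; pose f i k := q (fun n => if n is 0%N then i else k).
have df : def2 f.
  rewrite /def2 /f; have := @DF_ren _ _ (fun n => if n is 0 then 0 else 1)%N dq.
  rewrite (_ : (fun e => _) = fun e : nat ->
    D => q (fun n => if n is 0%N then e 0%N else e 1%N)) //.
  by apply: funext => e; congr q; apply: funext => -[].
have [|X HX] := @comprehend R (fun m => exists i, (i < m + 1)%rca /\
  exists k, (k < m + 1)%rca /\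
    m = pair (pair i k) (f i k)).
  by dfn.
have XP i k r : smem (pair (pair i k) r) X <-> r = f i k.
  split=> [/HX[i' [_ [k' [_ /pair_inj[/pair_inj[-> ->] ->]]]]]//|->]; apply/HX.
  have /ltS h1 := pair_ge1 (pair i k) (f i k).
  exists i; split; first by have /ltS := pair_ge1 i k => h2; apply/ltS; lra.
  by exists k; split=> //; have /ltS := pair_ge2 i k => h2; apply/ltS; lra.
have pX i : presents (s_row X i) (x i).
  split=> [k|k r r' /XP -> /XP ->|k r /XP ->] //; first by exists (f i k); apply/XP.
  by have := Hq (fun n => if n is 0%N then i else k).
exists X; split=> //; rewrite /s_is_real_sequence sandE !sexE; split.
  by move=> m /HX[i [_ [k [_ ->]]]]; exists i, k, (f i k).
by move=> i; apply/(representsP (pX i)).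
Qed.

End Presentation.

End RealTheory.

(** * Trees *)

Section Trees.
Variable R : rca.
Notation D := (num R).
Notation K := (rca_field R).
Notation eps := (@eps R).
Implicit Types (i j k l m n r s t b : D).

Definition len s n : Prop := N (pw n) <= N s /\ N s < 2 * N (pw n).
Definition init t s : Prop := 0 < N t /\ exists j r, N r < N (pw j) /\ s = (t * pw j + r)%rca.

Lemma def_len : defP2 len.
Proof. by rewrite /len; kfn. Qed.
Hint Resolve def_len : dfn.

Lemma s_seq_lengthP s n : s_seq_length s n <-> len s n.
Proof.
rewrite /s_seq_length sandE !sexE /len; split=> [[p [/s_pow2P -> [/s_leP H1 H2]]]|[H1 H2]].
  by split=> //; move: H2; toN; lra.
by exists (pw n); rewrite s_pow2P s_leP; split=> //; split=> //; toN; lra.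
Qed.

Lemma s_initial_segmentP t s : s_initial_segment t s <-> init t s.
Proof.
rewrite /s_initial_segment sandE !sexE /init nltE N0.
split=> -[H1]; first by move=> [j [p [r [/s_pow2P -> [H2 ->]]]]]; split=> //; exists j, r;
  rewrite -nltE.
by move=> [j [r [H2 ->]]]; split=> //; exists j, (pw j), r; rewrite s_pow2P nltE.
Qed.

Lemma pw_mono i j : N i <= N j -> N (pw i) <= N (pw j).
Proof. by move=> /eps_anti; rewrite lef_pV2 // posrE pw_gt0. Qed.

Lemma N_eq_of_lt1 i j : N i < N j + 1 -> N j < N i + 1 -> i = j.
Proof.
move=> H1 H2; apply: N_inj; apply/eqP; rewrite eq_le; apply/andP; split.
  by rewrite -ltS; toN.
by rewrite -ltS; toN.
Qed.

Lemma len_inj s m n : len s m -> len s n -> m = n.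
Proof.
have aux i j : len s i -> len s j -> N i < N j + 1.
  move=> [Hi _] [_ Hj]; rewrite ltNge; apply/negP => H.
  have : N (pw (j + 1)%rca) <= N (pw i) by apply: pw_mono; toN.
  by rewrite pwS; toN; lra.
by move=> Hm Hn; apply: N_eq_of_lt1; apply: aux.
Qed.

Lemma len_exists s : 0 < N s -> exists n, len s n.
Proof.
move=> s0; have [||n [H1 H2]] := @least_D1 R (fun n => N s < 2 * N (pw n)); first by kfn.
  by exists s; have := pw_gt s; have := pw_gt0 s; lra.
exists n; split=> //; case: (zero_or_succ n) => [->|[y e]].
  by rewrite pw0 N1; have := @N_disc R (nzero R) s; rewrite N0 => /(_ s0); lra.
have /H2/negP : (y < n)%rca by rewrite e; apply/nlt_succ; right.
by rewrite -leNgt e pwS; toN; lra.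
Qed.

Lemma length_function : exists L : D -> D, def1 L /\ forall s, 0 < N s -> len s (L s).
Proof.
(* The number 0 codes no sequence; its default length 0 makes the function total. *)
have [|||L [dL HL]] := @make_function R (fun s n => (0 < N s /\ len s n) \/ (~ 0 < N s /\
  n = 0%rca)).
- by kfn.
- move=> s; case: (EM (0 < N s)) => H; last by exists 0%rca; right.
  by have [n Hn] := len_exists H; exists n; left.
- by move=> s m n [[H1 H2]|[H1 ->]] [[H3 H4]|[H3 ->]] //; apply: len_inj H2 H4.
by exists L; split=> // s s0; case: (HL s) => -[].
Qed.

Lemma len_gt0 s n : len s n -> 0 < N s.
Proof. by move=> [H _]; apply: lt_le_trans H; apply: pw_gt0. Qed.

(** A code [s] of length [n] is read as the dyadic interval from [s 2^-n] to [(s + 1) 2^-n]. Under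
    this reading initial segments are larger intervals, and the later arguments about trees use only
    the resulting inequalities. *)
Lemma len_init t s n : init t s -> len s n -> exists i, [/\ len t i, N i <= N n,
  N t * eps i <= N s * eps n & (N s + 1) * eps n <= (N t + 1) * eps i].
Proof.
move=> [t0 [j [r [Hr ->]]]] Hs; have [i Hi] := len_exists t0; exists i.
have [H1 H2] := Hi.
have r0 := N_ge0 r; have pj := pw_gt0 j; have pi := pw_gt0 i.
have r1 : N r + 1 <= N (pw j) by apply: N_disc.
have e : n = (i + j)%rca.
  apply: len_inj Hs _; split; rewrite pwD; toN; first by nra.
  have t1 : N t + 1 <= N ((1 + 1) * pw i)%rca by apply: N_disc; toN; lra.
  by move: t1; toN => t1; nra.
have ei := eps_gt0 i; have ej := eps_gt0 j.
have E z : z * N (pw j) * (eps i * eps j) = z * eps i.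
  by transitivity (z * eps i * (N (pw j) * eps j)); [ring|rewrite pw_eps mulr1].
split=> //; rewrite e ?epsD; toN.
- by have := N_ge0 j; lra.
- by rewrite mulrDl E lerDl mulr_ge0 // mulr_ge0 // ltW.
- have h : (N r + 1) * (eps i * eps j) <= N (pw j) * (eps i * eps j).
    by rewrite ler_pM2r // mulr_gt0.
  by have := E 1; have := E (N t); lra.
Qed.

Lemma initS t s : 0 < N t -> s = ((1 + 1) * t)%rca \/ s = ((1 + 1) * t + 1)%rca -> init t s.
Proof.
move=> t0 H; split=> //; exists 1%rca.
have p1 : pw 1%rca = (1 + 1)%rca :> D.
  rewrite (_ : 1 = 0 + 1)%rca; last by apply: N_inj; toN; rewrite add0r.
  by rewrite pwS pw0; apply: N_inj; toN; ring.
case: H => ->; [exists 0%rca|exists 1%rca]; rewrite p1;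
  (split; [by toN; lra | by apply: N_inj; toN; ring]).
Qed.

Lemma lenS t s n : s = ((1 + 1) * t)%rca \/ s = ((1 + 1) * t + 1)%rca ->
  len t n <-> len s (n + 1)%rca.
Proof.
move=> H; rewrite /len pwS; split=> [[H1 H2]|].
  have t1 : N t + 1 <= N ((1 + 1) * pw n)%rca by apply: N_disc; toN; lra.
  by move: t1; toN => t1; case: H => ->; toN; split; lra.
case: H => ->; toN => -[H1 H2]; split; try lra.
by rewrite -ltS; toN; lra.
Qed.

Lemma init_exists s n m : len s n -> N m <= N n -> exists t, init t s /\ len t m.
Proof.
move=> Hs /N_sub[d Hd]; have [s1 s2] := Hs.
have nE : n = (m + d)%rca by apply: N_inj; toN; lra.
have pd := pw_gt0 d; have s0 := N_ge0 s.
have [t /andP[t1 t2]] : exists t, N t <= N s / N (pw d) < N t + 1.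
  by apply: floor_exists; rewrite divr_ge0 // ltW.
move: t1 t2; rewrite ler_pdivlMr // ltr_pdivrMr // => t1 t2.
rewrite nE pwD NM in s1 s2.
have Lt : len t m.
  split.
    rewrite -ltS; toN; rewrite -(ltr_pM2r pd); exact: le_lt_trans s1 t2.
  by rewrite -(ltr_pM2r pd); lra.
exists t; split=> //; split; first exact: len_gt0 Lt.
have [r Hr] : exists r, N r = N s - N (t * pw d)%rca by apply: N_sub; toN.
exists d, r; split; first by move: Hr; toN => ->; lra.
by apply: N_inj; move: Hr; toN; lra.
Qed.

Definition infinite_tree (T : D -> Prop) := [/\ defP1 T, forall s, T s -> 0 < N s,
  forall s t, T s -> init t s -> T t & forall n, exists s, N n < N s /\ T s].
Definition branch (T : D -> Prop) (g : D -> D) := def1 g /\ forall n,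
  [/\ T (g n), len (g n) n & g (n + 1)%rca = ((1 + 1) * g n)%rca \/ g (n + 1)%rca = ((1 + 1)
    * g n + 1)%rca].

(** A node above [2 * 2^n] has length at least [n]; cut it down to length [n]. *)
Lemma level_inhabited T n : infinite_tree T -> exists s, T s /\ len s n.
Proof.
move=> [_ T0 Tc Tu]; have [s [Hs Ts]] := Tu ((1 + 1) * pw n)%rca.
have [m Hm] := len_exists (T0 _ Ts).
have [|t [ts tn]] := @init_exists s m n Hm; last by exists t; split=> //; apply: Tc ts.
rewrite leNgt; apply/negP => /ltW/pw_mono; case: Hm => _; move: Hs; toN; have := pw_gt0 n; lra.
Qed.

Lemma WKL_branch : @s_WKL R -> forall T, infinite_tree T -> exists g, branch T g.
Proof.
move=> wkl T [dT T0 Tc Tu].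
have [X HX] := comprehend dT.
have := wkl X; rewrite /s_binary_tree /s_infinite_set /s_is_path /s_is_function sandE sorE
  !sexE => -[].
  split; first by split=> [s /HX/T0|s t /HX Ts /s_initial_segmentP H];
    [rewrite nltE N0|apply/HX/(Tc s)].
  by move=> n; have [s [Hs /HX Ts]] := Tu n; exists s; rewrite nltE.
move=> F [[_ [tot fn]] [bit path]].
have [|||f [df Hf]] := @make_function R (fun i b => smem (pair i b) F) => //; first by dfn.
have [g [dg g0 gS]] : exists g : D -> D, [/\ def1 g, g 0%rca = 1%rca &
    forall n, g (n + 1)%rca = ((1 + 1) * g n + f n)%rca].
  by apply: (@primitive_recursion R 1%rca (fun n y => (1 + 1) * y + f n)%rca); dfn.
have bitf i : f i = 0%rca \/ f i = 1%rca by apply: bit (Hf i).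
have gT n : T (g n) /\ len (g n) n.
  have [s [/HX Ts [/s_seq_lengthP Ls ent]]] := path n.
  (* That [g i] is an initial segment of [s] is expressed by nested intervals, so that with [s]
     fixed the induction predicate has no unbounded quantifier. At [i = n] it forces [g n = s]. *)
  suff H i : N i <= N n ->
    N (g i) * eps i <= N s * eps n /\ N s * eps n < (N (g i) + 1) * eps i.
    have [H1 H2] := H n (lexx _).
    rewrite ler_pM2r ?eps_gt0 // in H1; rewrite ltr_pM2r ?eps_gt0 // in H2.
    by rewrite (_ : g n = s) //; apply: N_eq_of_lt1 => //; lra.
  move: i; apply: ind_D1; first by kfn.
    move=> _; rewrite g0 eps0; toN; have [s1 s2] := Ls; have en := eps_gt0 n; have := pw_eps n.
    by move: (eps n) (N (pw n)) en s1 s2 => e p e0 s1 s2 ep; split; nra.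
  move=> i IH; toN => Hi; have [|H1 H2] := IH; first by lra.
  have : s_seq_entry s i (f i) by apply: ent (Hf i); toN; lra.
  rewrite /s_seq_entry sandE sexE => -[t [/s_seq_lengthP Lt /s_initial_segmentP It]].
  have bt : ((1 + 1) * t + f i)%rca = ((1 + 1) * t)%rca \/ ((1 + 1) * t + f i)%rca = ((1 + 1)
    * t + 1)%rca.
    by case: (bitf i) => ->; [left; apply: N_inj; toN; lra|right].
  have [i' [Li' _ C1 C2]] := len_init It Ls.
  have ei' : i' = (i + 1)%rca by apply: len_inj Li' (proj1 (lenS _ bt) Lt).
  rewrite {}ei' epsS in C1 C2.
  have ei := eps_gt0 i; have en := eps_gt0 n.
  have b01 : 0 <= N (f i) <= 1 by case: (bitf i) => ->; toN; lra.
  have tg : t = g i.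
    move: C1 C2; toN => C1 C2; apply: N_eq_of_lt1; rewrite -(ltr_pM2r ei); nra.
  rewrite gS epsS -tg; move: C1 C2; toN => C1 C2; split; lra.
exists g; split=> // n; have [H1 H2] := gT n; split=> //; rewrite gS.
by case: (bitf n) => ->; [left; apply: N_inj; toN; lra|right].
Qed.

Lemma branch_WKL : (forall T, infinite_tree T -> exists g, branch T g) -> @s_WKL R.
Proof.
move=> H X; rewrite /s_binary_tree /s_infinite_set /s_is_path /s_is_function /s_set_of_pairs
  sandE sorE !sexE => -[[X0 Xc] Xu].
have [|g [dg Hg]] := H (fun s => smem s X).
  split; first by dfn.
  - by move=> s /X0; rewrite nltE N0.
  - by move=> s t Xs /s_initial_segmentP; apply: Xc.
  - by move=> n; have [s [Hs Xs]] := Xu n; exists s; rewrite -nltE.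
have [|F HF] := @comprehend R (fun m => exists i, (i < m + 1)%rca /\
  exists b, (b < m + 1)%rca /\
    (m = pair i b /\ g (i + 1)%rca = ((1 + 1) * g i + b)%rca)).
  by dfn.
have FP i b : smem (pair i b) F <-> g (i + 1)%rca = ((1 + 1) * g i + b)%rca.
  split=> [/HF[i' [_ [b' [_ [/pair_inj[-> ->]]]]]]//|e]; apply/HF; exists i; split;
    first exact: pair_ge1.
  by exists b; split; first exact: pair_ge2.
have binj i b c : g (i + 1)%rca = ((1 + 1) * g i + b)%rca ->
  g (i + 1)%rca = ((1 + 1) * g i + c)%rca -> b = c.
  by move=> -> /(congr1 (@N R)); toN => e; apply: N_inj; lra.
have bex i : exists b, (b = 0%rca \/ b = 1%rca) /\ g (i + 1)%rca = ((1 + 1) * g i + b)%rca.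
  have [_ _ [e|e]] := Hg i; [exists 0%rca|exists 1%rca]; rewrite e; split; auto.
  by apply: N_inj; toN; lra.
exists F; split; first split.
- by move=> m /HF[i [_ [b [_ [-> _]]]]]; exists i, b.
- split=> [i|i b c /FP e1 /FP e2]; last exact: binj e1 e2.
  by have [b [_ e]] := bex i; exists b; apply/FP.
split=> [i b /FP e|n].
  by have [c [Hc e']] := bex i; rewrite (binj _ _ _ e e').
have [Tg Lg _] := Hg n; exists (g n); split=> //; split; first exact/s_seq_lengthP.
move=> i b Hi /FP e; rewrite /s_seq_entry sandE sexE; exists (g i).
split; first by have [_ Li _] := Hg i; apply/s_seq_lengthP.
apply/s_initial_segmentP; rewrite -e.
have [d Hd] : exists d, N d = N n - N (i + 1)%rca by apply: N_sub; toN; apply: N_disc.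
have -> : n = ((i + 1) + d)%rca by apply: N_inj; toN; lra.
split; first by have [_ /len_gt0] := Hg (i + 1)%rca.
(* Induction on the distance from [i + 1] to [n]; the digits appended so far form the remainder,
   which is bounded by a power of two. *)
exists d; move: {Hd} d;
  apply: (@ind_D1 R (fun d => exists r, N r < N (pw d) /\
    g (i + 1 + d)%rca = (g (i + 1) * pw d + r)%rca)).
- apply: (@D1_ext _ (fun v => exists r, (r < pw (v 0%N))%rca /\
    g (i + 1 + v 0%N)%rca = (g (i + 1) * pw (v 0%N) + r)%rca)).
    by dfn.
  by move=> v; split=> -[r []]; exists r; rewrite ?nltE // -nltE.
- exists 0%rca; rewrite pw0; split; first by toN; lra.
  rewrite (_ : (i + 1 + 0)%rca = (i + 1)%rca); last by apply: N_inj; toN; lra.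
  by apply: N_inj; toN; lra.
move=> d [r [Hr er]].
have -> : (i + 1 + (d + 1))%rca = ((i + 1 + d) + 1)%rca by apply: N_inj; toN; lra.
have r1 : N r + 1 <= N (pw d) by apply: N_disc.
have [_ _ [->|->]] := Hg (i + 1 + d)%rca; rewrite er pwS.
  exists ((1 + 1) * r)%rca; split; first by toN; lra.
  by apply: N_inj; toN; ring.
exists ((1 + 1) * r + 1)%rca; split; first by toN; lra.
by apply: N_inj; toN; ring.
Qed.

End Trees.

#[export] Hint Resolve def_len : dfn.

(** * Weak Koenig's lemma implies the Heine-Borel theorem *)

Section HeineBorelTheorem.
Variable R : rca.
Notation D := (num R).
Notation K := (rca_field R).
Notation eps := (@eps R).
Implicit Types (i j k l m n s t : D) (x : D -> K) (a b : D -> D -> K).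

Definition family a b := [/\ defK2 a, defK2 b, forall i, Cau (a i) & forall i, Cau (b i)].
Definition inside a b i x := rlt (a i) x /\ rlt x (b i).
Definition covering a b := forall x, is_unit x -> exists i, inside a b i x.
Definition HB := forall a b, family a b -> covering a b ->
  exists j, forall x, is_unit x -> exists i, N i < N j /\ inside a b i x.

Lemma family_presented (A B : sets R) : s_interval_family A B -> exists a b, family a b /\
  forall i X x, set_presents X x -> Cau x -> s_in_interval A B i X <-> inside a b i x.
Proof.
rewrite /s_interval_family sandE =>
  -[/sequence_presented[a [da Ha]] /sequence_presented[b [db Hb]]].
exists a, b; split; first by split=> // i; [case: (Ha i)|case: (Hb i)].
move=> i X x pX cx; have [pa _] := Ha i; have [pb _] := Hb i.
exact: in_intervalP pX cx pa pb.
Qed.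

Lemma family_sets a b : family a b -> exists A B : sets R, s_interval_family A B /\
  forall i X x, set_presents X x -> Cau x -> s_in_interval A B i X <-> inside a b i x.
Proof.
move=> [da db ca cb]; have [A [sA pA]] := make_sequence da ca;
  have [B [sB pB]] := make_sequence db cb.
exists A, B; rewrite /s_interval_family sandE; split=> // i X x pX cx.
exact: in_intervalP pX cx (pA i) (pB i).
Qed.

Lemma unit_presented (X : sets R) : s_in_unit_interval X ->
  exists x, [/\ set_presents X x, Cau x & is_unit x].
Proof.
move=> H; have [x [pX cx dx]] : exists x, [/\ set_presents X x, Cau x & defK1 x].
  by apply: real_presented; move: H; rewrite /s_in_unit_interval sandE => -[].
by exists x; split=> //; have [_ x0 x1] := proj1 (unit_intervalP pX) H.
Qed.

Lemma unit_set x : is_unit x -> exists X, set_presents X x /\ s_in_unit_interval X.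
Proof.
move=> [dx cx x0 x1]; have [X [pX rX]] := make_real dx cx.
by exists X; split=> //; apply/(unit_intervalP pX).
Qed.

Lemma covers_covering (A B : sets R) a b :
  (forall i X x, set_presents X x -> Cau x -> s_in_interval A B i X <-> inside a b i x) ->
  s_covers A B <-> covering a b.
Proof.
rewrite /s_covers sexE => HAB; split=> H.
  move=> x ux; have [X [pX uX]] := unit_set ux; have [i Hi] := H X uX.
  by have [_ cx _ _] := ux; exists i; apply/(HAB i X x pX).
move=> X /unit_presented[x [pX cx ux]]; have [i Hi] := H x ux.
by exists i; apply/(HAB i X x pX).
Qed.

Lemma HeineBorel_HB : @s_HeineBorel R -> HB.
Proof.
move=> H a b fab cov; have [A [B [sAB HAB]]] := family_sets fab.
have := H A B; rewrite sandE !sexE (covers_covering HAB) => -[//|j Hj].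
exists j => x ux; have [X [pX uX]] := unit_set ux.
have [i []] := Hj X uX; rewrite nltE => ij Hi; exists i; split=> //.
by have [_ cx _ _] := ux; apply/(HAB i X x pX).
Qed.

Lemma HB_HeineBorel : HB -> @s_HeineBorel R.
Proof.
move=> H A B; rewrite sandE !sexE =>
  -[/family_presented[a [b [fab HAB]]] /(covers_covering HAB) cov].
have [j Hj] := H a b fab cov.
exists j => X /unit_presented[x [pX cx ux]]; have [i [ij Hi]] := Hj x ux.
by exists i; rewrite nltE; split=> //; apply/(HAB i X x pX).
Qed.

(* A node [s] of length [n] stands for the dyadic interval
   [s 2^-n - 1, (s + 1) 2^-n - 1]; the tree consists of the nodes whose interval,
   enlarged by [2^-n] on both sides, is not seen by stage [n] to lie inside one
   of the first [n + 1] intervals. *)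
Lemma WKL_HB : @s_WKL R -> HB.
Proof.
move=> /WKL_branch wkl a b [da db ca cb] cov.
have [L [dL HL]] := length_function R.
pose seen s n i k l := a i k + eps k < N s * eps n - 1 - eps n /\
  (N s + 1) * eps n - 1 + eps n < b i l - eps l.
pose T s := 0 < N s /\ forall i, (i < L s + 1)%rca -> forall k, (k < L s + 1)%rca ->
  forall l, (l < L s + 1)%rca -> ~ seen s (L s) i k l.
have dT : defP1 T by rewrite /T /seen; kfn.
have Tc s t : T s -> init t s -> T t.
  move=> [s0 Ts] Hts; have [t0 _] := Hts; split=> // i /ltS Hi k /ltS Hk l /ltS Hl [H1 H2].
  have [n' [Ln' nn C1 C2]] := len_init Hts (HL s s0).
  have e := len_inj Ln' (HL t t0); rewrite {}e in nn C1 C2.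
  (* What is seen for [t] is still seen for [s]: the interval lies inside that of [t], its margin is
     no larger and the stage no earlier. *)
  apply: (Ts i _ k _ l _); try by apply/ltS; lra.
  by have := eps_anti nn; split; lra.
case: (EM (forall n, exists s, N n < N s /\ T s)) => [Tu|Tb].
  have [g [dg Hg]] := wkl T (And4 dT (fun s => @proj1 _ _) Tc Tu).
  (* The leading digit 1 of the codes places the intervals between 1 and 2; subtracting 1 moves them
     to the unit interval. *)
  pose x n := N (g n) * eps n - 1.
  have dx : defK1 x by rewrite /x; kfn.
  have step k i : x k <= x (k + i)%rca /\ x (k + i)%rca <= x k + eps k - eps (k + i)%rca.
    move: i; apply: ind_D1; first by kfn.
      rewrite (_ : (k + 0)%rca = k); last by apply: N_inj; toN; lra.
      by lra.
    move=> i; rewrite (_ : (k + (i + 1))%rca = ((k + i) + 1)%rca); last by apply: N_inj; toN;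
      ring.
    have ei := eps_gt0 (k + i)%rca.
    have [_ _ [e|e]] := Hg (k + i)%rca; rewrite /x e epsS; toN; lra.
  have cx : Cau x.
    by move=> k i; have := step k i; have := eps_gt0 k; have := eps_gt0 (k + i)%rca; lra.
  have gb n : 0 <= x n /\ x n <= 1 - eps n.
    have [_ [g1 g2] _] := Hg n; have en := eps_gt0 n; have pe := pw_eps n.
    have g3 : N (g n) + 1 <= N ((1 + 1) * pw n)%rca by apply: N_disc; toN; lra.
    rewrite /x; move: g1 g2 g3 en pe; toN; move: (N (g n)) (N (pw n)) (eps n) => G p e *.
    by split; nra.
  have ux : is_unit x.
    split=> // k; have := gb k; have := eps_gt0 k; rewrite /cst; lra.
  have [i [[k Hk] [l Hl]]] := cov x ux.
  have [n1 [Hn1 kn1 ln1]] :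
    exists n1, [/\ eps n1 < x k - 2 * eps k - a i k, N k <= N n1 & N l <= N n1].
    by apply: eps_small2; lra.
  have [n2 [Hn2 _ _]] : exists n2, [/\ eps n2 < (b i l - 2 * eps l - x l) / 2,
    N k <= N n2 & N l <= N n2].
    by apply: eps_small2; lra.
  (* The summands make room at the left endpoint, at the right endpoint, and for the index [i],
     which is tested only from stage [i] on. *)
  pose n := (n1 + n2 + i)%rca.
  have [h1 [h2 h3]] := (N_ge0 n1, (N_ge0 n2, N_ge0 i)).
  have en1 : eps n <= eps n1 by apply: eps_anti; rewrite /n; toN; lra.
  have en2 : eps n <= eps n2 by apply: eps_anti; rewrite /n; toN; lra.
  have kn : N k <= N n by rewrite /n; toN; lra.
  have ln : N l <= N n by rewrite /n; toN; lra.
  have in_ : N i <= N n by rewrite /n; toN; lra.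
  have [[g0 Tg] Lg _] := Hg n.
  have e := len_inj (HL _ g0) Lg; rewrite {}e in Tg.
  case: (Tg i _ k _ l _); try by apply/ltS.
  have := Cau_le cx kn; have := Cau_le cx ln; rewrite /seen -/(x n) => X1 X2.
  have xE : (N (g n) + 1) * eps n - 1 = x n + eps n by rewrite /x; ring.
  by rewrite xE; lra.
(* The bound on the codes is reused as a length: a code of length [n] is at least [2^n > n], so no
   node has length [n]. *)
have [n Hn] : exists n, forall s, T s -> N s <= N n.
  apply: contrapT => H; apply: Tb => n; apply: contrapT => H1; apply: H.
  by exists n => s Ts; rewrite leNgt; apply/negP => Hs; apply: H1; exists s.
exists (n + 1)%rca => x [dx cx x0 x1].
(* Three errors of size [eps M], two from [grid] and one from approximating [x], fit into the margin
   [eps n] of a seen interval. *)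
pose M := (n + 1 + 1)%rca.
have eM : eps M = eps n / 4 by rewrite /M !epsS; lra.
have en := eps_gt0 n.
have [m [m1 /andP[m2 m3]]] : exists m, N m + 1 <= N (pw n) /\
    N m * eps n - 2 * eps M <= x M <= (N m + 1) * eps n + 2 * eps M.
  apply: grid; first by lra.
  by have := x0 M; have := x1 M; rewrite /cst => h1 h2; apply/andP; split; lra.
pose s := (m + pw n)%rca.
have Ls : len s n by rewrite /s /len; toN; have := N_ge0 m; split; lra.
have s0 := len_gt0 Ls.
have sE : N s * eps n - 1 = N m * eps n by rewrite /s ND mulrDl pw_eps addrK.
have e := len_inj (HL _ s0) Ls.
have nT : ~ T s by move=> /Hn; have [] := Ls; have := pw_gt n; lra.
have [i [Hi [k [l [H1 H2]]]]] : exists i, N i <= N n /\ exists k l, seen s n i k l.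
  apply: contrapT => H; apply: nT; split=> //; rewrite e => i /ltS Hi k _ l _ Hs.
  by apply: H; exists i; split=> //; exists k, l.
exists i; split; first by toN; lra.
split.
  by apply: (@rlt_intro _ _ _ k M) => //; lra.
by apply: (@rlt_intro _ _ _ M l) => //; lra.
Qed.

End HeineBorelTheorem.

(** * The Heine-Borel theorem implies the Creeping Lemma *)

Section Creeping.
Variable R : rca.
Notation D := (num R).
Notation env := (nat -> D).
Notation K := (rca_field R).
Notation eps := (@eps R).
Implicit Types (c i j k l m q : D) (x : D -> K) (a b : D -> D -> K).

Lemma constant_set_exists q : exists X : sets R, forall m,
  smem m X <-> exists k, (k < m + 1)%rca /\ m = pair k q.
Proof. by apply: comprehend; dfn. Qed.

Definition constant_set q : sets R := projT1 (cid (constant_set_exists q)).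

Lemma constant_setP q m : smem m (constant_set q) <-> exists k, (k < m + 1)%rca /\ m = pair k q.
Proof. by rewrite /constant_set; case: cid. Qed.

Lemma constant_set_presents c i j :
  set_presents (constant_set (rat c i j)) (cst (val (rat c i j))).
Proof.
split; first by rewrite /s_set_of_pairs !sexE => m /constant_setP[k [_ ->]];
  exists k, (rat c i j).
have P k q : s_of_set (constant_set (rat c i j)) k q <-> q = rat c i j.
  split=> [/constant_setP[k' [_ /pair_inj[]]]//|->].
  by apply/constant_setP; exists k; split=> //; apply: pair_ge1.
split=> [k|k q r /P -> /P -> //|k q /P ->]; first by exists (rat c i j); apply/P.
by split=> //; exists c, i, j.
Qed.

Lemma poly_teval (s : nat -> env -> D) (u : term) : (forall n, poly (s n)) ->
  poly (fun v => teval (fun n => s n v) u).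
Proof. by move=> ps; elim: u => /=; try by move=> *; constructor. Qed.

(** Membership in the code of a constant sequence is itself a bounded statement about [q]. This
    makes [Psi] at a rational point Sigma^0_1 in the rational, as the creeping induction demands. *)
Lemma bdd_constant_set A : bounded A -> forall (s : nat -> env -> D) (q : env -> D) w,
  (forall n, poly (s n)) -> poly q ->
  bdd (fun v => msat (fun n => s n v) (scons (constant_set (q v)) w) A).
Proof.
elim=> {A} /=.
- by move=> *; apply: bdd_bot.
- by move=> t u s q w ps pq; apply: bdd_eq; apply: poly_teval.
- by move=> t u s q w ps pq; apply: bdd_lt; apply: poly_teval.
- move=> t [|X] s q w ps pq /=; last by apply/bdd_mem/poly_teval.
  pose u v := teval (fun n => s n v) t.
  have pu : poly u by apply: poly_teval.
  apply: (@bdd_ext _ (fun v => exists k, (k < u v + 1)%rca /\ u v = pair k (q v))).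
    apply: (bdd_ex (Q := fun k v => u v = pair k (q v))).
      by apply: poly_add => //; apply: poly_const.
    apply: bdd_eq; first exact: (poly_ren S pu).
    have pq' := poly_ren S pq; have p0 := @poly_var R 0.
    by rewrite /pair; do ![exact: p0 | exact: pq' | apply: poly_add | apply: poly_mul].
  by move=> v; rewrite constant_setP.
- by move=> A B _ IA _ IB s q w ps pq; apply: bdd_imp; [exact: IA|exact: IB].
- move=> t A _ IA s q w ps pq.
  rewrite (_ : (fun v => _) = fun v => forall x : D, (x < teval (fun n => s n v) t)%rca ->
    msat (scons x (fun n => s n v)) (scons (constant_set (q v)) w) A); last first.
    by apply: funext => v; apply: eq_forall => x; rewrite /tlift teval_tsubst.
  apply: (bdd_all (Q := fun (x :
    D) v => msat (scons x (fun n => s n v)) (scons (constant_set (q v)) w) A)).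
    exact: poly_teval.
  rewrite (_ : (fun v => _) = fun v :
    env => msat (fun n => (if n is n'.+1 then fun v => s n' (tl v) else fun v => v 0%N) v)
    (scons (constant_set (q (tl v))) w) A).
    apply: IA; last exact: (poly_ren S pq).
    by case=> [|n]; [exact: poly_var|exact: (poly_ren S (ps n))].
  by apply: funext => v; congr (msat _ _ A); apply: funext => -[].
Qed.

Lemma S1_constant_set Psi v0 w : Sigma01 Psi ->
  S1 (fun v => msat v0 (scons (constant_set (v 0%N)) w) Psi).
Proof.
case=> A bA; exists (fun y v => msat (scons y v0) (scons (constant_set (v 0%N)) w) A); split.
  rewrite (_ : (fun v => _) = fun v :
    env => msat (fun n => (if n is n'.+1 then fun _ => v0 n' else fun v => v 0%N) v)
    (scons (constant_set (v 1%N)) w) A).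
    apply: (bdd_constant_set bA); last exact: poly_var.
    by case=> [|n]; constructor.
  by apply: funext => v; congr (msat _ _ A); apply: funext => -[].
by move=> v; rewrite msat_exN.
Qed.

Lemma is_unit_cst (z : K) : 0 <= z <= 1 -> is_unit (cst z).
Proof.
move=> /andP[z0 z1]; split; [exact: KF_const|exact: Cau_cst| |] => k;
  have := eps_gt0 k; rewrite /cst; lra.
Qed.

Lemma rlt_cst_cst (y z : K) : rlt (@cst R y) (cst z) <-> y < z.
Proof.
split=> [[k]|H]; first by rewrite /cst; have := eps_gt0 k; lra.
have [k Hk] : exists k, eps k < (z - y) / 2 by apply: eps_small; lra.
by exists k; rewrite /cst; lra.
Qed.

Section Refinement.
Variables (a b : D -> D -> K).
Hypothesis fab : family a b.

(* The index [n] codes a rational [c] and numbers [k], [i], [l], [l'].  The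
   [n]-th interval of the refined covering is (c - 2^-k, c + 2^-k) if the
   approximations of precision [l] and [l'] to the endpoints of the [i]-th
   interval show that the latter contains (c - 2^(1-k), c + 2^(1-k)); otherwise
   it is empty. *)
Implicit Types n : D.
Let cc n : K := val (p1 (p1 n)).
Let kk n := p2 (p1 n).
Let ii n := p1 (p2 n).
Let ll n := p1 (p2 (p2 n)).
Let ll' n := p2 (p2 (p2 n)).
Definition verified n : Prop := a (ii n) (ll n) + eps (ll n) < cc n - 2 * eps (kk n) /\
  cc n + 2 * eps (kk n) < b (ii n) (ll' n) - eps (ll' n).
Definition fine_left n (_ : D) : K := if `[< verified n >] then cc n - eps (kk n) else 0.
Definition fine_right n (_ : D) : K := if `[< verified n >] then cc n + eps (kk n) else 0.

Lemma fine_family : family fine_left fine_right.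
Proof.
have [da db ca cb] := fab; split; try by move=> n; apply: Cau_cst.
- by rewrite /fine_left /verified /cc /kk /ii /ll /ll'; kfn.
- by rewrite /fine_right /verified /cc /kk /ii /ll /ll'; kfn.
Qed.

Lemma fine_insideE n x : Cau x -> inside fine_left fine_right n x ->
  [/\ verified n, rlt (cst (cc n - eps (kk n))) x & rlt x (cst (cc n + eps (kk n)))].
Proof.
move=> cx; rewrite /inside /fine_left /fine_right;
  case: asboolP => [ver [H1 H2]|_ [[k Hk] [l Hl]]]; first by split.
by exfalso; have := Cau_dist l k cx; have := Cau_dist k l cx; have := eps_gt0 k;
  have := eps_gt0 l; lra.
Qed.

Lemma verified_inside n x j : Cau x -> verified n ->
  cc n - 2 * eps (kk n) <= x j - eps j -> x j + eps j <= cc n + 2 * eps (kk n) ->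
  inside a b (ii n) x.
Proof.
have [da db ca cb] := fab; move=> cx [H1 H2] H3 H4; split.
  by apply: (@rlt_intro _ _ _ (ll n) j) => //; lra.
by apply: (@rlt_intro _ _ _ j (ll' n)) => //; lra.
Qed.

Lemma verified_inside_cst n z : verified n ->
  cc n - 2 * eps (kk n) <= z <= cc n + 2 * eps (kk n) -> inside a b (ii n) (cst z).
Proof.
have [da db ca cb] := fab; move=> [H1 H2] /andP[H3 H4]; split.
  by apply: (@rlt_cst _ _ _ (ll n)) => //; lra.
by apply: (@cst_rlt _ _ _ (ll' n)) => //; lra.
Qed.

Lemma fine_covering : covering a b -> covering fine_left fine_right.
Proof.
have [da db ca cb] := fab; move=> cov x ux.
have [i [[l Hl] [l' Hl']]] := cov x ux; have [dx cx _ _] := ux.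
have [k1 [Hk1 lk1 lk1']] :
  exists k, [/\ eps k < (x l - 2 * eps l - a i l) / 4, N l <= N k & N l' <= N k].
  by apply: eps_small2; lra.
have [k2 [Hk2 _ _]] : exists k, [/\ eps k < (b i l' - 2 * eps l' - x l') / 4,
  N l <= N k & N l' <= N k].
  by apply: eps_small2; lra.
pose k := (k1 + k2)%rca; pose m := (k + 1)%rca.
have [h1 h2] := (N_ge0 k1, N_ge0 k2).
have e1 : eps k <= eps k1 by apply: eps_anti; rewrite /k; toN; lra.
have e2 : eps k <= eps k2 by apply: eps_anti; rewrite /k; toN; lra.
have em : eps m = eps k / 2 := epsS k.
have [q [_ Hq]] := KF_code dx; have [_ vq] := Hq (fun=> m).
move: (q _) vq => c vc.
(* The center is the approximation to [x] of precision [k + 1], so its error is half of the radius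
   [eps k]. *)
exists (pair (pair c k) (pair i (pair l l'))).
have := Cau_dist l m cx; have := Cau_dist m l' cx; have ek := eps_gt0 k => X2 X1.
have ver : verified (pair (pair c k) (pair i (pair l l'))).
  rewrite /verified /cc /kk /ii /ll /ll' !(p1_pair, p2_pair) vc; split; lra.
rewrite /inside /fine_left /fine_right; case: asboolP => // _.
rewrite /cc /kk !(p1_pair, p2_pair) vc; split.
  by apply: (@cst_rlt _ _ _ m) => //; lra.
by apply: (@rlt_cst _ _ _ m) => //; lra.
Qed.

(** Projections do not exceed their argument, so the precision coded in [n] is below [j]. This
    provides the Lebesgue number of a finite subcovering. *)
Lemma kk_lt n j : N n < N j -> 2 * eps j <= eps (kk n).
Proof.
move=> nj; suff : eps j <= eps (kk n + 1)%rca by rewrite epsS; lra.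
apply: eps_anti.
have kn : N (kk n) <= N n.
  exact: le_trans (p2_le _) (p1_le _).
by apply: le_trans (N_disc nj); toN; lra.
Qed.

End Refinement.

Lemma HB_CL (P : sets R -> Prop) : HB R ->
  S1 (fun v => P (constant_set (v 0%N))) -> s_CL P.
Proof.
move=> hb SP; rewrite /s_CL sandE siffE !sexE.
move=> [[A [B [sAB [cAB PAB]]]] [Z [HZ PZ]]].
have [a [b [fab HAB]]] := family_presented sAB.
have cov := proj1 (covers_covering HAB) cAB.
have [j Hj] := hb _ _ (fine_family fab) (fine_covering fab cov).
(* As a stored denominator, [f] stands for [2^j], so [rat m 0 f] is the grid point [m 2^-j]. *)
have [f Hf] : exists f, N f = N (pw j) - N (none R).
  by apply: N_sub; have := @N_disc R (nzero R) (pw j); toN => /(_ (pw_gt0 j)); lra.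
pose G m := constant_set (rat m 0%rca f).
have valG m : val (rat m 0%rca f) = N m * eps j.
  by rewrite val_rat Hf N0 N1 subr0 subrK.
have pG m : set_presents (G m) (cst (N m * eps j)) by rewrite -valG;
  apply: constant_set_presents.
have ej := eps_gt0 j; have pe := pw_eps j; have pj := pw_gt0 j.
have iff_in i X Y x y : set_presents X x -> set_presents Y y -> Cau x -> Cau y ->
    inside a b i x -> inside a b i y -> P X <-> P Y.
  by move=> pX pY cx cy Hx Hy; apply: (PAB i); [apply/(HAB i X x)|apply/(HAB i Y y)].
have grid_unit m : N m <= N (pw j) -> is_unit (cst (N m * eps j)).
  by move=> Hm; apply: is_unit_cst; have := N_ge0 m; move: pe Hm; nra.
have pZ : set_presents Z (cst 0).
  have ZP k q : smem (pair k q) Z <-> q = (rat 0 0 0)%rca.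
    by split=> [/HZ[k' [q' [-> /pair_inj[_ ->]]]]//|->]; apply/HZ; exists k, (rat 0 0 0)%rca.
  split; first by rewrite /s_set_of_pairs !sexE => m /HZ[k [q [_ ->]]]; exists k, q.
  split=> [k|k q r /ZP -> /ZP -> //|k q /ZP ->]; first by exists (rat 0 0 0)%rca; apply/ZP.
  by rewrite val0; split=> //; exists 0%rca, 0%rca, 0%rca.
(* An implication with a decidable premise, written as a disjunction to stay Sigma^0_1. *)
have PG : forall m, ~ N m <= N (pw j) \/ P (G m).
  apply: ind_S1.
  - apply: S1_or; first by apply: S1_D1; apply: D1_not; kfn.
    apply: (@S1_sub R (fun v => rat (v 0%N) 0 f)%rca (fun q _ => P (constant_set q))) => //.
    by rewrite /rat; dfn.
  (* [Z] and [G 0] are different codes of 0; [P] passes between them because both lie in one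
     interval of the covering. *)
  - right; have g0 := pG 0%rca; rewrite N0 mul0r in g0.
    have [|i Hi] := cov (cst 0); first by apply: is_unit_cst; lra.
    by apply/(iff_in i (G 0%rca) Z _ _ g0 pZ); rewrite //; apply: Cau_cst.
  - move=> m IH; case: (EM (N (m + 1)%rca <= N (pw j))) => Hm; [right|by left].
    have Hm' : N m <= N (pw j) by move: Hm; toN; lra.
    case: IH => // PGm.
    have [n [nj Hn]] := Hj _ (grid_unit m Hm').
    have [ver /rlt_cst_cst H1 /rlt_cst_cst H2] := fine_insideE (Cau_cst _) Hn.
    (* The step [eps j] is at most half of the radius, so both grid points lie in the doubled
       interval, hence in one interval of the original covering. *)
    have kk := kk_lt nj.
    apply/(iff_in (p1 (p2 n)) _ _ _ _ (pG (m + 1)%rca) (pG m)) => //; try exact: Cau_cst.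
      by apply: (verified_inside_cst fab ver); toN; lra.
    by apply: (verified_inside_cst fab ver); lra.
move=> X /unit_presented[x [pX cx ux]].
have [n [nj Hn]] := Hj x ux.
have [ver [k1 H1] [k2 H2]] := fine_insideE cx Hn.
have kk := kk_lt nj.
pose M := (j + 1 + 1)%rca.
have eM : eps M = eps j / 4 by rewrite /M !epsS; lra.
have [_ _ x0 x1] := ux.
have [m [m1 /andP[m2 m3]]] : exists m, N m + 1 <= N (pw j) /\
    N m * eps j - 2 * eps M <= x M <= (N m + 1) * eps j + 2 * eps M.
  apply: grid; first by lra.
  by have := x0 M; have := x1 M; rewrite /cst => h1 h2; apply/andP; split; lra.
have [|PGm] := PG m; first by case; lra.
have D1 := Cau_dist k1 M cx; have D2 := Cau_dist M k2 cx.
have e1 := eps_gt0 k1; have e2 := eps_gt0 k2; rewrite /cst in H1 H2.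
apply/(iff_in (p1 (p2 n)) _ _ _ _ pX (pG m)) => //; try exact: Cau_cst.

  by apply: (@verified_inside _ _ fab n x M) => //; lra.
by apply: (verified_inside_cst fab ver); lra.
Qed.

End Creeping.

(** * The Creeping Lemma implies weak Koenig's lemma *)

Section Branches.
Variable R : rca.
Notation D := (num R).
Notation K := (rca_field R).
Notation eps := (@eps R).
Implicit Types (c d i j k l m n s t : D) (x : D -> K).

Definition half_consistent (g : D -> D) := forall n,
  g (n + 1)%rca = ((1 + 1) * g n)%rca \/ g (n + 1)%rca = ((1 + 1) * g n + 1)%rca.

Lemma half_consistentP (g : D -> D) :
  (forall n, 2 * N (g n) < N (g (n + 1)%rca) + 1 /\ N (g (n + 1)%rca) < 2 * N (g n) + 2) ->
  half_consistent g.
Proof.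
move=> H n; have [H1 H2] := H n.
have h1 : N ((1 + 1) * g n)%rca <= N (g (n + 1)%rca) by rewrite -ltS; toN; lra.
have h2 : N (g (n + 1)%rca) <= N ((1 + 1) * g n + 1)%rca by rewrite -ltS; toN; lra.
move: h1; rewrite le_eqVlt => /orP[/eqP/N_inj|/N_disc h1]; [by left|right].
by apply: N_inj; move: h1 h2; toN; lra.
Qed.

Lemma rlt_cst_trans (y z : K) x : Cau x -> rlt (cst y) x -> rlt x (cst z) -> y < z.
Proof. by move=> cx [k Hk] [l Hl]; have := Cau_dist k l cx; have := eps_gt0 k;
  have := eps_gt0 l; rewrite /cst in Hk Hl *; lra. Qed.

(* The [d]-th dyadic interval of length [2^-n] seems to contain [x], up to [z]. *)
Definition near x d n (z : K) := exists k, eps k <= z /\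
  N d * eps n - z <= x k <= (N d + 1) * eps n + z.

(* [g1] and [g2] are the two dyadic expansions of [x], which need not be
   distinct.  That a given [x] has definable expansions is shown by cases on
   whether [x] is a dyadic rational. *)
Lemma dyadic_expansions x : is_unit x -> exists g1 g2 : D -> D,
  [/\ def1 g1, def1 g2, half_consistent g1, half_consistent g2 &
  forall n, exists z, 0 < z /\ forall d, near x d n z -> d = g1 n \/ d = g2 n].
Proof.
move=> [dx cx x0 x1].
have eq_of_le d d' : N d < N d' + 1 -> N d' < N d + 1 -> d = d' by exact: N_eq_of_lt1.
case: (EM (exists n d, rle x (cst (N d * eps n)) /\ rle (cst (N d * eps n)) x)); last first.
  move=> ndy.
  (* For a non-dyadic [x] the strict comparisons, which are Sigma^0_1, always locate [x] in exactly
     one interval. *)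
  pose P n d := rlt (cst (N d * eps n)) x /\ rlt x (cst ((N d + 1) * eps n)).
  have [|||g [dg Pg]] := @make_function R P.
  - by rewrite /P /rlt /cst; kfn.
  - apply: ind_S1; first by rewrite /P /rlt /cst; kfn.
      have E0 : N (nzero R) * eps 0%rca = 0 by rewrite N0 mul0r.
      have E1 : N (none R) * eps 0%rca = 1 by rewrite N1 eps0 mulr1.
      have E2 : (N (nzero R) + 1) * eps 0%rca = 1 by rewrite N0 eps0 add0r mulr1.
      exists 0%rca; rewrite /P E0 E2; split; apply/not_rle => H; apply: ndy; exists 0%rca.
        by exists 0%rca; rewrite E0.
      by exists 1%rca; rewrite E1.
    move=> n [d [H1 H2]].
    have [H|H] : rlt x (cst (N ((1 + 1) * d + 1)%rca * eps (n + 1)%rca)) \/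
                 rlt (cst (N ((1 + 1) * d + 1)%rca * eps (n + 1)%rca)) x.
    + apply: contrapT => H; apply: ndy; exists (n + 1)%rca, ((1 + 1) * d + 1)%rca.
      by split; apply: contrapT => /not_rle; tauto.
    + exists ((1 + 1) * d)%rca; split; move: H1 H; toN; rewrite epsS => //.
      by rewrite (_ : (1 + 1) * N d * (eps n / 2) = N d * eps n) //; field.
    + exists ((1 + 1) * d + 1)%rca; split; move: H2 H; toN; rewrite epsS => //.
      by rewrite (_ : ((1 + 1) * N d + 1 + 1) * (eps n / 2) = (N d + 1) * eps n) //; field.
  - move=> n d d' [H1 H2] [H3 H4]; have en := eps_gt0 n.
    have := rlt_cst_trans cx H1 H4; have := rlt_cst_trans cx H3 H2.
    by rewrite !ltr_pM2r // => h1 h2; apply: eq_of_le; lra.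
  exists g, g; split=> //; try (apply: half_consistentP => n;
    have [H1 H2] := Pg n; have [H3 H4] := Pg (n + 1)%rca; have en := eps_gt0 n;
    have h1 := rlt_cst_trans cx H1 H4; have h2 := rlt_cst_trans cx H3 H2;
    rewrite epsS in h1 h2; split; rewrite -(ltr_pM2r en); lra).
  move=> n; have [[k Hk] [l Hl]] := Pg n; rewrite /cst in Hk Hl; have en := eps_gt0 n.
  exists (eps (k + l + 1)%rca); split; first exact: eps_gt0.
  move=> d [m [Hm /andP[m1 m2]]]; left.
  have e1 : eps (k + l)%rca <= eps k by apply: eps_anti; toN; have := N_ge0 l; lra.
  have e2 : eps (k + l)%rca <= eps l by apply: eps_anti; toN; have := N_ge0 k; lra.
  rewrite epsS in Hm m1 m2.
  have d1 := Cau_dist m l cx; have d2 := Cau_dist k m cx.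
  have k0 := eps_gt0 k; have l0 := eps_gt0 l.
  by apply: eq_of_le; rewrite -(ltr_pM2r en); lra.
move=> [n0 [d0 [xy yx]]]; pose y := N d0 * eps n0.
have y0 : 0 <= y by rewrite mulr_ge0 ?N_ge0 // ltW ?eps_gt0.
have dy : KF (fun _ : nat -> D => y) by apply: KF_const.
pose P n d := N d <= y * N (pw n) /\ y * N (pw n) < N d + 1.
(* [P] rounds [y 2^n] down; [Q] takes the predecessor of rounding up, the interval ending at [y]
   when [y 2^n] is a whole number. At [y = 0] no such interval exists and 0 is the default. *)
pose Q n d := (0 < y /\ (N d < y * N (pw n) /\ y * N (pw n) <= N d + 1)) \/ (~ 0 < y /\
  d = 0%rca).
have Pex n : exists d, P n d.
  have [|d /andP[H1 H2]] := @floor_exists R (y * N (pw n)); last by exists d.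
  by rewrite mulr_ge0 // N_ge0.
have [|||g1 [dg1 Pg1]] := @make_function R P => //.
- by rewrite /P; kfn.
- by move=> n d d' [? ?] [? ?]; apply: eq_of_le; lra.
have [|||g2 [dg2 Qg2]] := @make_function R Q.
- by rewrite /Q; kfn.
- move=> n; have [d [H1 H2]] := Pex n.
  case: (EM (0 < y)) => yp; last by exists 0%rca; right.
  have yn : 0 < y * N (pw n) by rewrite mulr_gt0 ?pw_gt0.
  move: H1; rewrite le_eqVlt => /orP[/eqP H1|H1]; last by exists d; left; split=> //;
    split=> //; lra.
  case: (zero_or_succ d) => [e|[d' e]]; first by rewrite -H1 e N0 ltxx in yn.
  by exists d'; left; split=> //; rewrite -H1 e; toN; lra.
- move=> n d d' [[yp [? ?]]|[yp ->]] [[yp' [? ?]]|[yp' ->]] //.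
  by apply: eq_of_le; lra.
have pS n : N (pw (n + 1)%rca) = 2 * N (pw n) by rewrite pwS; toN; lra.
exists g1, g2; split=> //.
- apply: half_consistentP => n; have [H1 H2] := Pg1 n; have := Pg1 (n + 1)%rca.
  by rewrite /P pS => -[H3 H4]; split; lra.
- apply: half_consistentP => n; have := Qg2 n; have := Qg2 (n + 1)%rca; rewrite /Q pS.
  move=> [[yp [H1 H2]]|[yp ->]] [[yp' [H3 H4]]|[yp' ->]] //; first by split; lra.
  by toN; lra.
move=> n; have [H1 H2] := Pg1 n; have en := eps_gt0 n; have pn := pw_gt0 n; have pe := pw_eps n.
have yE : y = y * N (pw n) * eps n by rewrite -mulrA pe mulr1.
have z1 : 0 < ((N (g1 n) + 1) - y * N (pw n)) * eps n by rewrite mulr_gt0 //; lra.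
(* The tolerance [z] is to be a quarter of the smaller of two distances, from [y] to the right end
   of the interval of [g1 n] and to the left end of that of [g2 n]. *)
pose z2 : K := if 0 < y then (y * N (pw n) - N (g2 n)) * eps n else eps n.
have z2p : 0 < z2.
  rewrite /z2; case: ifP => // yp; rewrite mulr_gt0 //.
  by case: (Qg2 n) => [[_ [? _]]|[]] //; lra.
pose z := Num.min (((N (g1 n) + 1) - y * N (pw n)) * eps n) z2 / 4.
have zz1 : z <= ((N (g1 n) + 1) - y * N (pw n)) * eps n / 4 by rewrite ler_pM2r ?invr_gt0 //
  ge_min lexx.
have zz2 : z <= z2 / 4 by rewrite ler_pM2r ?invr_gt0 // ge_min lexx orbT.
have z0 : 0 < z by rewrite divr_gt0 // lt_min z1 z2p.
exists z; split=> // d [k [Hk /andP[k1 k2]]].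
have ek := eps_gt0 k.
have a1 := rle_dist k k cx (@Cau_cst R y) xy; have a2 := rle_dist k k (@Cau_cst R y) cx yx.
rewrite /cst in a1 a2.
have dg : N d < N (g1 n) + 1 by rewrite -(ltr_pM2r en); lra.
case: (Qg2 n) => [[yp [H3 H4]]|[yp e]]; last first.
  left; apply: eq_of_le => //.
  have y00 : y = 0 by apply/eqP; rewrite eq_le y0 andbT leNgt; apply/negP.
  by have := N_ge0 d; rewrite y00 mul0r in H1; lra.
rewrite /z2 yp in zz2.
have gd : N (g2 n) < N d + 1 by rewrite -(ltr_pM2r en); lra.
case: (EM (N d < N (g2 n) + 1)) => Hd; [by right; apply: eq_of_le|left].
move/negP: Hd; rewrite -leNgt => Hd.
by apply: eq_of_le => //; lra.
Qed.

End Branches.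

(* The real is set variable 0 and the parameter is set variable 1. *)
Definition creep_form : form :=
  ExNum (Not (AllNum (Imp (LtN (Var 0) (tlift (Plus (Var 0) One)))
    (AllNum (Imp (LtN (Var 0) (tlift (Plus (Var 1) One)))
      (Imp (EqN (Var 2) (Plus (Times (Plus (Var 1) (Var 0)) (Plus (Var 1) (Var 0))) (Var 1)))
        (Imp (Mem (Var 2) 1) (Not (Mem (Var 0) 0))))))))).

Lemma Sigma01_creep_form : Sigma01 creep_form.
Proof. by do ![constructor]. Qed.

Section CreepingToKoenig.
Variable R : rca.
Notation D := (num R).
Notation K := (rca_field R).
Notation eps := (@eps R).
Implicit Types (c d i j k l m n s t : D) (x : D -> K).

(** One fixed formula suffices: all dependence on the tree goes into the parameter, a set of finite
    pieces of evidence that pair a length [n] with one element [m] of the code of the real. *)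
Lemma msat_creep_form v w (X : sets R) :
  msat v (scons X w) creep_form <-> exists n m, smem (pair n m) (w 0%N) /\ smem m X.
Proof.
rewrite msat_exN; split=> [[z Hz]|[n [m [HW HX]]]].
  apply: contrapT => H; apply: Hz => n Hn m Hm e HW HX; apply: H.
  by have {}e : z = pair n m := e; exists n, m; rewrite -e.
exists (pair n m) => H.
exact: (H n (pair_ge1 n m) m (pair_ge2 n m) erefl HW HX).
Qed.

Section Koenig.
Variable T : D -> Prop.
Hypothesis HT : infinite_tree T.
Hypothesis nobranch : ~ exists g, branch T g.

(* A node [s] of length [n] stands for [s 2^-(n+2), (s + 1) 2^-(n+2)], so that the
   nodes lie in [1/4, 1/2]; [below x] says that [x] is to the left of all nodes of
   some length. *)
Definition below x := exists n k, forall s, T s -> len s n ->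
  x k + eps k < N s * eps (n + 1 + 1)%rca.

(* The index [n] codes a rational [c] and numbers [k], [m].  The [n]-th interval
   of the covering is (c - 2^-k, c + 2^-k) if no node of length [m] meets it, and
   is empty otherwise. *)
Let cc n : K := val (p1 (p1 n)).
Let kk n := p2 (p1 n).
Let mm n := p2 n.
Definition free n : Prop := forall s, (s < (1 + 1) * pw (mm n))%rca -> T s -> len s (mm n) ->
  (N s + 1) * eps (mm n + 1 + 1)%rca < cc n - eps (kk n) \/
  cc n + eps (kk n) < N s * eps (mm n + 1 + 1)%rca.
Definition free_left n (_ : D) : K := if `[< free n >] then cc n - eps (kk n) else 0.
Definition free_right n (_ : D) : K := if `[< free n >] then cc n + eps (kk n) else 0.

Lemma free_family : family free_left free_right.
Proof.
have [dT _ _ _] := HT; split; try by move=> n; apply: Cau_cst.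
- by rewrite /free_left /free /cc /kk /mm; kfn.
- by rewrite /free_right /free /cc /kk /mm; kfn.
Qed.

Lemma free_insideE n x : Cau x -> inside free_left free_right n x ->
  [/\ free n, rlt (cst (cc n - eps (kk n))) x & rlt x (cst (cc n + eps (kk n)))].
Proof.
move=> cx; rewrite /inside /free_left /free_right;
  case: asboolP => [ver [H1 H2]|_ [[k Hk] [l Hl]]]; first by split.
by exfalso; have := Cau_dist l k cx; have := Cau_dist k l cx; have := eps_gt0 k;
  have := eps_gt0 l; lra.
Qed.

(* If no node of length [m] meets the interval and [x] is to the left of the nodes
   of length [n'], then the nodes of length [n' + m] are to the right of the whole
   interval. *)
Lemma below_inside n x y : Cau x -> Cau y -> inside free_left free_right n x ->
  inside free_left free_right n y -> below x -> below y.
Proof.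
have [_ T0 Tc _] := HT.
move=> cx cy /(free_insideE cx)[Hn [k1 x1] _] /(free_insideE cy)[_ _ [k2 y2]] [n' [k H]].
rewrite /cst in x1 y2.
exists (n' + mm n)%rca, k2 => s Ts Ls.
have [h1 h2] := (N_ge0 n', N_ge0 (mm n)).
have [|t [Ht Lt]] := @init_exists R s _ n' Ls; first by toN; lra.
have [|u [Hu Lu]] := @init_exists R s _ (mm n) Ls; first by toN; lra.
have [i [Li _ C1 _]] := len_init Ht Ls; rewrite (len_inj Li Lt) in C1.
have [i' [Li' _ C2 C3]] := len_init Hu Ls; rewrite (len_inj Li' Lu) in C2 C3.
have Tt := H t (Tc _ _ Ts Ht) Lt; have e2 := eps_gt0 k2; have e1 := eps_gt0 k1;
  have ek := eps_gt0 k.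
have d1 := Cau_dist k1 k cx; have en := eps_gt0 (n' + mm n)%rca.
rewrite !epsS in Tt *.
case: (Hn u _ (Tc _ _ Ts Hu) Lu); first by rewrite nltE; case: Lu => _; toN; lra.
  by rewrite !epsS => H1; lra.
by rewrite !epsS => H1; lra.
Qed.

(** An uncovered [x] has nodes of every length arbitrarily close to it. Each length then has a node
    on one of the two dyadic expansions of [x], and one expansion serves all lengths, which makes it
    a branch. *)
Lemma free_covering : covering free_left free_right.
Proof.
have [dT T0 Tc Tu] := HT.
move=> x ux; have [dx cx x0 x1] := ux; apply: contrapT => Hx.
have hit m k : exists s, [/\ T s, len s m,
  x (k + 1)%rca - eps k <= (N s + 1) * eps (m + 1 + 1)%rca &
    N s * eps (m + 1 + 1)%rca <= x (k + 1)%rca + eps k].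
  apply: contrapT => H; apply: Hx.
  have [q [_ Hq]] := KF_code dx; have [_ vq] := Hq (fun=> (k + 1)%rca).
  move: (q _) vq => c vc; exists (pair (pair c k) m).
  have fr : free (pair (pair c k) m).
    move=> s _; rewrite /mm /cc /kk !(p1_pair, p2_pair) vc => Ts Ls.
    apply: contrapT => H1; apply: H; exists s; split=> //; rewrite leNgt; apply/negP => H2;
      apply: H1; by [left|right].
  rewrite /inside /free_left /free_right; case: asboolP => // _.
  rewrite /cc /kk !(p1_pair, p2_pair) vc; have ek := eps_gt0 k; split.
    by apply: (@cst_rlt _ _ _ (k + 1)%rca) => //; rewrite epsS; lra.
  by apply: (@rlt_cst _ _ _ (k + 1)%rca) => //; rewrite epsS; lra.
have [g1 [g2 [dg1 dg2 hc1 hc2 Hg]]] := dyadic_expansions ux.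
(* The shift by two matches the scale: a node of length [m] has an interval of length [2^-(m+2)]. *)
pose on (g : D -> D) m := T (g (m + 1 + 1)%rca) /\ len (g (m + 1 + 1)%rca) m.
have hitg m : on g1 m \/ on g2 m.
  have [z [z0 Hz]] := Hg (m + 1 + 1)%rca; have [k Hk] := eps_small z0.
  have [s [Ts Ls s1 s2]] := hit m k.
  have ek := eps_gt0 k.
  have [e|e] : s = g1 (m + 1 + 1)%rca \/ s = g2 (m + 1 + 1)%rca.
    by apply: Hz; exists (k + 1)%rca; rewrite epsS; split; [lra|apply/andP; split; lra].
  - by left; rewrite /on -e.
  - by right; rewrite /on -e.
have down g : def1 g -> half_consistent g -> forall m d, on g (m + d)%rca -> on g m.
  move=> dg hc m; apply: ind_D1; first by rewrite /on; kfn.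
    by rewrite (_ : (m + 0)%rca = m) //; apply: N_inj; toN; lra.
  move=> d IH; rewrite (_ : (m + (d + 1))%rca = ((m + d) + 1)%rca); last by apply: N_inj;
    toN; ring.
  move=> [H1 H2]; apply: IH; have hd := hc (m + d + 1 + 1)%rca.
  have Ld := proj2 (lenS _ hd) H2; split=> //.
  by apply: Tc H1 _; apply: initS => //; apply: len_gt0 Ld.
have br g : def1 g -> half_consistent g -> ~ forall m, on g m.
  move=> dg hc H; apply: nobranch; exists (fun m => g (m + 1 + 1)%rca); split; first by dfn.
  by move=> m; have [? ?] := H m; split=> //; apply: hc.
(* Being on the tree is inherited by smaller lengths, so if [g1] is off it at [m], then [g2] is on
   it at every [l + m] and hence at every [l]. *)
apply: (br g1) => // m; apply: contrapT => Hm.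
apply: (br g2) => // l; apply: (down g2 dg2 hc2 l m).
case: (hitg (l + m)%rca) => // H; case: Hm.
apply: (down g1 dg1 hc1 m l); rewrite (_ : (m + l)%rca = (l + m)%rca) //.
by apply: N_inj; toN; lra.
Qed.

Lemma below0 : below (cst 0).
Proof.
(* Nodes of length 0 start at 1/4 or later, and precision 3 gives the error 1/8. *)
exists 0%rca, (1 + 1 + 1)%rca => s _ [H _]; rewrite pw0 N1 in H.
have e0 := eps0 R; have e1 := epsS (nzero R); have e2 := epsS (0 + 1)%rca;
  have e3 := epsS (1 + 1 : D)%rca.
have e4 := epsS (1 : D)%rca.
have z1 : (0 + 1)%rca = 1%rca :> D by apply: N_inj; toN; lra.
rewrite z1 in e1 e2 *.
by rewrite /cst; nra.
Qed.

(** Every length has a node, and all nodes start before 1/2. *)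
Lemma not_below1 : ~ below (cst 1).
Proof.
move=> [n [k H]]; have [s [Ts Ls]] := level_inhabited n HT.
have := H s Ts Ls; have [_ L2] := Ls; have := eps_gt0 k; have pe := pw_eps n;
  have en := eps_gt0 n.
rewrite !epsS /cst => h1 h2.
have : N s * eps n < 2 * N (pw n) * eps n by rewrite ltr_pM2r.
by rewrite -mulrA pe; lra.
Qed.

Lemma below_form : exists w : nat -> sets R, forall X x, set_presents X x ->
  forall v, msat v (scons X w) creep_form <-> below x.
Proof.
have [dT _ _ _] := HT.
pose P z := forall s, (s < (1 + 1) * pw (p1 z))%rca -> T s -> len s (p1 z) ->
  val (p2 (p2 z)) + eps (p1 (p2 z)) < N s * eps (p1 z + 1 + 1)%rca.
have [|W HW] := @comprehend R P; first by rewrite /P; kfn.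
exists (fun=> W) => X x [sX [tot fn pX]] v; rewrite msat_creep_form /=.
split=> [[n [m [/HW Pm Xm]]]|[n [k H]]].
  move: sX; rewrite /s_set_of_pairs !sexE => /(_ _ Xm)[k [q e]].
  rewrite e in Pm Xm; have [_ vq] := pX k q Xm.
  exists n, k => s Ts Ls; have := Pm s; rewrite !(p1_pair, p2_pair) vq; apply=> //.
  by rewrite nltE; case: Ls => _; toN; lra.
have [q Hq] := tot k; have [_ vq] := pX k q Hq.
exists n, (pair k q); split=> //; apply/HW => s _; rewrite !(p1_pair, p2_pair) vq.
exact: H.
Qed.

End Koenig.

Lemma CL_WKL : (forall Psi v w, Sigma01 Psi -> @s_CL R (fun X => msat v (scons X w) Psi)) ->
  @s_WKL R.
Proof.
move=> cl; apply: branch_WKL => T HT; apply: contrapT => nobranch.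
have [w Hw] := below_form HT.
pose v (_ : nat) := nzero R.
have := cl creep_form v w Sigma01_creep_form.
rewrite /s_CL sandE siffE !sexE => creep.
have [A [B [sAB HAB]]] := family_sets (free_family HT).
have u1 : is_unit (cst (1 : K)) by apply: is_unit_cst; lra.
have [X [pX uX]] := unit_set u1.
apply: (not_below1 HT); apply/(Hw X _ pX v); apply: creep => //; split.
  exists A, B; split=> //; split.
    by apply/(covers_covering HAB); apply: free_covering.
  move=> i Y Y' HY HY'.
  have real_of Z : s_in_interval A B i Z ->
    exists z, [/\ set_presents Z z, Cau z & inside (free_left T) (free_right T) i z].
    move=> HZ; have [z [pZ cz dz]] : exists z, [/\ set_presents Z z, Cau z & defK1 z].
      by apply: real_presented; move: HZ; rewrite /s_in_interval sandE => -[].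
    by exists z; split=> //; apply/(HAB i Z z).
  have [y [py cy iy]] := real_of Y HY; have [y' [py' cy' iy']] := real_of Y' HY'.
  rewrite (Hw Y y py) (Hw Y' y' py').
  by split; apply: (below_inside HT _ _ iy iy') || apply: (below_inside HT _ _ iy' iy).
have [|Z HZ] := @comprehend R (fun m => exists k, (k < m + 1)%rca /\
  m = pair k (rat (nzero R) 0 0)%rca).
  by dfn.
have ZP k q : smem (pair k q) Z <-> q = (rat 0 0 0)%rca.
  split=> [/HZ[k' [_ /pair_inj[]]]//|->]; apply/HZ; exists k; split=> //; exact: pair_ge1.
exists Z; split.
  move=> m; split=> [/HZ[k [_ ->]]|[k [q [-> ->]]]]; first by exists k, (rat 0 0 0)%rca.
  exact/ZP.
have pZ : set_presents Z (cst (0 : K)).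
  split; first by rewrite /s_set_of_pairs !sexE => m /HZ[k [_ ->]]; exists k, (rat 0 0 0)%rca.
  split=> [k|k q r /ZP -> /ZP -> //|k q /ZP ->]; first by exists (rat 0 0 0)%rca; apply/ZP.
  by rewrite val0; split=> //; exists 0%rca, 0%rca, 0%rca.
by apply/(Hw Z _ pZ); apply: below0.
Qed.

End CreepingToKoenig.

(** * The equivalences, transferred from models to provability *)

Theorem theorem7 :
  provable RCA0 (Iff WKL HeineBorel) /\
  equivalent_over RCA0 (single WKL) CreepingLemma /\
  equivalent_over RCA0 (single HeineBorel) CreepingLemma.
Proof.
have RofM T M (v : nat -> num M) (w : nat -> sets M) : (forall A, RCA0 A -> T A) ->
  models M T ->
    exists R : rca, rca_struct R = M.
  by move=> sub HM; apply: rca_of_model (w 0%N) => A v' w' /sub; apply: HM.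
have wh (R : rca) v w : @msat R v w WKL -> @msat R v w HeineBorel.
  by rewrite msat_WKL msat_HeineBorel => /WKL_HB/HB_HeineBorel.
have hc (R : rca) v w : @msat R v w HeineBorel -> forall Psi v' w', Sigma01 Psi ->
  @msat R v' w' (CL Psi).
  rewrite msat_HeineBorel => /HeineBorel_HB hb Psi v' w' SPsi; rewrite msat_CL.
  by apply: HB_CL => //; apply: S1_constant_set.
(* The schema is assumed under all valuations, so the tree may enter as the set parameter of
   [creep_form]. *)
have cw (R : rca) v w : (forall Psi v' w', Sigma01 Psi -> @msat R v' w' (CL Psi)) ->
  @msat R v w WKL.
  by move=> cl; rewrite msat_WKL; apply: CL_WKL => Psi v' w' SPsi; rewrite -msat_CL; apply: cl.
have modelsCL M U : models M (extend RCA0 U) -> (forall A, CreepingLemma A -> U A) ->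
    forall Psi v w, Sigma01 Psi -> @msat M v w (CL Psi).
  by move=> HM sub Psi v w SPsi; apply: HM; right; apply: sub; constructor.
split; last split; last split.
- apply: completeness => M HM v w; have [R eR] := RofM _ M v w (fun A => id) HM.
  subst M; apply/msat_iff; split; first exact: wh.
  by move=> /hc cl; apply: cw.
- split=> A.
    move=> [Psi SPsi]; apply: completeness => M HM v w.
    have [R eR] := RofM _ M v w (fun A => @or_introl _ _) HM; subst M.
    by apply: (hc R v w) => //; apply: wh; apply: HM; right.
  move=> ->; apply: completeness => M HM v w.
  have [R eR] := RofM _ M v w (fun A => @or_introl _ _) HM; subst M.
  by apply: cw; apply: modelsCL HM _.
- move=> A [Psi SPsi]; apply: completeness => M HM v w.
  have [R eR] := RofM _ M v w (fun A => @or_introl _ _) HM; subst M.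
  by apply: (hc R v w) => //; apply: HM; right.
- move=> A ->; apply: completeness => M HM v w.
  have [R eR] := RofM _ M v w (fun A => @or_introl _ _) HM; subst M.
  by apply/wh/cw; apply: modelsCL HM _.
Qed.
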